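(* Consider the reduced one-velocity, one-pressure $N$-phase model with viscosity, heat conduction, inter-phase temperature relaxation and external heat sources, given in the context. Consider the Riemann problem for it whose left ($L$) and right ($R$) initial states satisfy $$u^L=u^R=u>0,\quad \rho_k^L=\rho_k^R=\rho_k,\quad e_k^L=e_k^R=e_k,\quad \alpha_l^L\neq\alpha_l^R,\quad p_L=p_R=p,\quad T_L=T_R=T,$$ with the phase temperatures initially in equilibrium, i.e. $T_{k,L}=T_L$ and $T_{k,R}=T_R$. Then the solution to the model with this initial discontinuity preserves the PVT property.
   Context: **PVT property.** An interface-capturing numerical scheme has the PVT (pressure-velocity-temperature) property if it ensures $u_i^{n+1}=u=\text{const}$, $p_i^{n+1}=p=\text{const}$, $T_i^{n+1}=T=\text{const}$, provided that $u_i^n=u=\text{const}$, $p_i^n=p=\text{const}$, $T_i^n=T=\text{const}$. Here $u$, $p$, $T$ are the mixture velocity, pressure and temperature, $i$ is the index of the computational cell and $n$ is the time step. Saying that the solution to the model preserves this property means that the initially uniform velocity, pressure and temperature keep their uniform values as the solution evolves. **Variables.** There are $N$ phases, $k\in\{1,\dots,N\}$ and $l\in\{2,\dots,N\}$. Phase $k$ has volume fraction $\alpha_k$ (with $\sum_k\alpha_k=1$), phase density $\rho_k$, internal energy $e_k$ and temperature $T_k$. All phases share the velocity $\boldsymbol u$ (written $u$ in the Riemann problem) and the pressure $p$. The mixture density is $\rho=\sum_k\alpha_k\rho_k$, and $E_k=e_k+\frac12\boldsymbol u\cdot\boldsymbol u$, $\rho E=\sum_k\alpha_k\rho_kE_k$.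 Each phase obeys the stiffened gas equation of state $$\rho_ke_k=\frac{p+\gamma_kp_{\infty,k}}{\gamma_k-1}+\rho_kw_k=\rho_kC_{v,k}T_k+p_{\infty,k}+\rho_kw_k,$$ where $C_{v,k}$ is the specific heat at constant volume and $\gamma_k,p_{\infty,k},w_k$ are constants of the phase. **Model.** $$\partial_t(\alpha_k\rho_k)+\nabla\cdot(\alpha_k\rho_k\boldsymbol u)=0,$$ $$\partial_t(\rho\boldsymbol u)+\nabla\cdot(\rho\boldsymbol u\otimes\boldsymbol u-\overline{\overline T})=0,$$ $$\partial_t(\rho E)+\nabla\cdot(\rho E\boldsymbol u-\overline{\overline T}\cdot\boldsymbol u)=\sum_{k=1}^N(q_k+\mathcal I_k),$$ $$\partial_t\alpha_l+\boldsymbol u\cdot\nabla\alpha_l=\mathcal F_l,$$ where $$\mathcal F_k=\alpha_k\frac{A-A_k}{A_k}\nabla\cdot\boldsymbol u+A\sum_{j\ne k}\frac{\Gamma_k\mathcal G_k\alpha_j-\Gamma_j\mathcal G_j\alpha_k}{A_kA_j},\qquad \mathcal G_k=\alpha_k\overline{\overline\tau}_k:\overline{\overline D}+\mathcal Q_k+q_k+\mathcal I_k.$$ Here $A_k=\rho_ka_k^2$ with $a_k^2=(\partial p_k/\partial\rho_k)_{s_k}$ the squared phase sound speed ($s_k$ is the phase entropy), $1/A=\sum_k\alpha_k/A_k$, and $\Gamma_k=1/(\rho_k\xi_k)$ with $\xi_k=(\partial e_k/\partial p_k)_{\rho_k}$. - Stress: $\overline{\overline T}=-p\overline{\overline I}+\overline{\overline\tau}$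 and $\overline{\overline\tau}=\sum_k\alpha_k\overline{\overline\tau}_k$, where $\overline{\overline\tau}_k=2\mu_k\overline{\overline D}+(\mu_{b,k}-\frac23\mu_k)(\nabla\cdot\boldsymbol u)\overline{\overline I}$, $\overline{\overline D}=\frac12[\nabla\boldsymbol u+(\nabla\boldsymbol u)^{\mathrm T}]$, $\overline{\overline I}$ is the identity tensor, and $\mu_k>0$, $\mu_{b,k}>0$ are the shear and bulk viscosities. - Heat conduction: $q_k=\nabla\cdot(\alpha_k\lambda_k\nabla T_k)$, with heat conduction coefficient $\lambda_k$. - Temperature relaxation: $\mathcal Q_k=\sum_{j\ne k}\varsigma_{jk}(T_j-T_k)$, with relaxation rates $\varsigma_{jk}=\varsigma_{kj}>0$. - External heat source: $\mathcal I_k=\alpha_kI_k$, where $I_k\ge0$ is the intensity of the external heat source released in phase $k$.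
   Formalization: The preservation claim is proved for solutions along which the external heat source vanishes (α_k I_k = 0 for every phase), since uniform u, p, T contradicts the energy equation when heat is released; existence of a solution is proved for I_k = 0. *)

(* Defs.v *)
(* Phases carry the labels 1, ..., N; values at other labels are never used. *)
From Stdlib Require Import Reals Lra Lia.
From Coquelicot Require Import Coquelicot.
Open Scope R_scope.

Definition sum_phases (N : nat) (f : nat -> R) : R := sum_n_m f 1 N.

Definition sum_other_phases (N k : nat) (f : nat -> R) : R :=
  sum_phases N (fun j => if Nat.eqb j k then 0 else f j).

Inductive axis := ax0 | ax1 | ax2.

Definition axis_eqb (i j : axis) : bool :=
  match i, j with
  | ax0, ax0 | ax1, ax1 | ax2, ax2 => true
  | _, _ => false
  end.

Definition sum_axes (f : axis -> R) : R := f ax0 + f ax1 + f ax2.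

Definition kron (i j : axis) : R := if axis_eqb i j then 1 else 0.

Definition point := axis -> R.
Definition field := R -> point -> R.
Definition vfield := axis -> field.
Definition tfield := axis -> axis -> field.

Definition upd (X : point) (i : axis) (s : R) : point :=
  fun j => if axis_eqb j i then s else X j.

Definition d_t (f : field) : field :=
  fun t X => Derive (fun s => f s X) t.

Definition d_x (i : axis) (f : field) : field :=
  fun t X => Derive (fun s => f t (upd X i s)) (X i).

Definition divergence (v : vfield) : field :=
  fun t X => sum_axes (fun i => d_x i (v i) t X).

Definition dot (v w : vfield) : field :=
  fun t X => sum_axes (fun i => v i t X * w i t X).

Definition ddot (S T : tfield) : field :=
  fun t X => sum_axes (fun i => sum_axes (fun j => S i j t X * T i j t X)).

(* Local thermodynamic state of the mixture. *)
Record mixture := Mixture { vf : nat -> R; dens : nat -> R; pres : R }.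

(* The viscosities, heat conduction coefficients and relaxation rates may depend
   on the local state of the mixture; constants are the special case
   [fun _ => c]. *)
Record material := Material {
  gam : nat -> R;
  pinf : nat -> R;
  w : nat -> R;
  Cv : nat -> R;
  mu : nat -> mixture -> R;
  mub : nat -> mixture -> R;
  lam : nat -> mixture -> R;
  sig : nat -> nat -> mixture -> R
}.

Section Phase.
Variables (M : material) (k : nat).

(* [energy] and [temp] solve
     r e = (q + gam pinf) / (gam - 1) + r w = r Cv T + pinf + r w. *)
Definition energy (r q : R) : R :=
  ((q + gam M k * pinf M k) / (gam M k - 1)) / r + w M k.

Definition temp (r q : R) : R :=
  (r * energy r q - pinf M k - r * w M k) / (r * Cv M k).

(* The phase entropy, determined up to an additive constant by the Gibbs
   relation T ds = de - (q / r^2) dr; see [entropy_gibbs]. *)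
Definition entropy (r q : R) : R :=
  Cv M k * ln ((q + pinf M k) / Rpower r (gam M k)).

(* The pressure as a function of density and entropy;
   see [isentropic_pressure_entropy]. *)
Definition isentropic_pressure (r s : R) : R :=
  exp (s / Cv M k) * Rpower r (gam M k) - pinf M k.

Definition sound_speed_sq (r q : R) : R :=
  Derive (fun r' => isentropic_pressure r' (entropy r q)) r.

Definition bulk (r q : R) : R := r * sound_speed_sq r q.

Definition xi_coef (r q : R) : R := Derive (fun q' => energy r q') q.

Definition Gruneisen (r q : R) : R := / (r * xi_coef r q).

Lemma isentropic_pressure_entropy (r q : R) :
  0 < Cv M k -> 0 < q + pinf M k ->
  isentropic_pressure r (entropy r q) = q.
Proof.
  intros HC Hq. unfold isentropic_pressure, entropy.
  replace (Cv M k * ln ((q + pinf M k) / Rpower r (gam M k)) / Cv M k)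
    with (ln ((q + pinf M k) / Rpower r (gam M k))) by (field; lra).
  assert (HR : 0 < Rpower r (gam M k)) by apply exp_pos.
  rewrite exp_ln by (apply Rdiv_lt_0_compat; lra).
  field; lra.
Qed.

Lemma entropy_gibbs (r q : R) :
  1 < gam M k -> 0 < Cv M k -> 0 < r -> 0 < q + pinf M k ->
  temp r q * Derive (fun q' => entropy r q') q
    = Derive (fun q' => energy r q') q
  /\ temp r q * Derive (fun r' => entropy r' q) r
    = Derive (fun r' => energy r' q) r - q / r ^ 2.
Proof.
  intros Hg HC Hr Hq.
  assert (Hs : forall r' q', 0 < q' + pinf M k ->
     entropy r' q' = Cv M k * (ln (q' + pinf M k) - gam M k * ln r')).
  { intros r' q' Hq'. unfold entropy, Rdiv.
    assert (HR : 0 < Rpower r' (gam M k)) by apply exp_pos.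
    rewrite ln_mult by (auto; apply Rinv_0_lt_compat; auto).
    rewrite ln_Rinv by auto. unfold Rpower. rewrite ln_exp. ring. }
  split.
  - replace (Derive (fun q' => entropy r q') q)
      with (Cv M k * / (q + pinf M k)).
    2: { symmetry. apply is_derive_unique.
         apply is_derive_ext_loc
           with (f := fun q' => Cv M k * (ln (q' + pinf M k) - gam M k * ln r)).
         - exists (mkposreal _ Hq). intros y Hy.
           symmetry; apply Hs. apply Rabs_def2 in Hy. simpl in Hy.
           unfold minus, plus, opp in Hy; simpl in Hy. lra.
         - auto_derive; [lra | field; lra]. }
    replace (Derive (fun q' => energy r q') q) with (/ (gam M k - 1) / r).
    2: { symmetry. apply is_derive_unique. unfold energy.
         auto_derive; [lra | field; lra]. }
    unfold temp, energy. field. repeat split; lra.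
  - replace (Derive (fun r' => entropy r' q) r)
      with (- Cv M k * gam M k / r).
    2: { symmetry. apply is_derive_unique.
         apply is_derive_ext
           with (f := fun r' => Cv M k * (ln (q + pinf M k) - gam M k * ln r')).
         - intros y. symmetry; apply Hs; lra.
         - auto_derive; [lra | field; lra]. }
    replace (Derive (fun r' => energy r' q) r)
      with (- ((q + gam M k * pinf M k) / (gam M k - 1)) / r ^ 2).
    2: { symmetry. apply is_derive_unique. unfold energy.
         auto_derive; [lra | field; lra]. }
    unfold temp, energy. field. repeat split; lra.
Qed.

End Phase.

Definition admissible (N : nat) (M : material) (c : mixture) : Prop :=
  (forall k, (1 <= k <= N)%nat ->
     0 <= vf c k /\ 0 < dens c k /\ 0 < temp M k (dens c k) (pres c))
  /\ sum_phases N (vf c) = 1.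

Definition physical_material (N : nat) (M : material) : Prop :=
  (forall k, (1 <= k <= N)%nat -> 1 < gam M k /\ 0 < Cv M k)
  /\ (forall c, admissible N M c ->
        (forall k, (1 <= k <= N)%nat ->
           0 < mu M k c /\ 0 < mub M k c /\ 0 <= lam M k c)
        /\ (forall j k, (1 <= j <= N)%nat -> (1 <= k <= N)%nat -> j <> k ->
              sig M j k c = sig M k j c /\ 0 < sig M j k c)).

Record flow := Flow {
  alpha : nat -> field;
  rho : nat -> field;
  vel : vfield;
  p : field
}.

Section Model.
(* [heat k t X] is the intensity I_k of the external heat source. *)
Variables (N : nat) (M : material) (heat : nat -> field) (F : flow).

Definition mix : R -> point -> mixture :=
  fun t X => Mixture (fun k => alpha F k t X) (fun k => rho F k t X) (p F t X).

Definition e_ (k : nat) : field :=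
  fun t X => energy M k (rho F k t X) (p F t X).
Definition T_ (k : nat) : field := fun t X => temp M k (rho F k t X) (p F t X).
Definition A_ (k : nat) : field := fun t X => bulk M k (rho F k t X) (p F t X).
Definition Gamma_ (k : nat) : field :=
  fun t X => Gruneisen M k (rho F k t X) (p F t X).

Definition A_mix : field :=
  fun t X => / sum_phases N (fun k => alpha F k t X / A_ k t X).

Definition rho_mix : field :=
  fun t X => sum_phases N (fun k => alpha F k t X * rho F k t X).

Definition E_ (k : nat) : field :=
  fun t X => e_ k t X + / 2 * dot (vel F) (vel F) t X.

Definition rhoE : field :=
  fun t X => sum_phases N (fun k => alpha F k t X * rho F k t X * E_ k t X).

Definition div_u : field := divergence (vel F).

Definition strain : tfield :=
  fun i j t X => / 2 * (d_x i (vel F j) t X + d_x j (vel F i) t X).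

Definition tau_ (k : nat) : tfield :=
  fun i j t X =>
    2 * mu M k (mix t X) * strain i j t X
    + (mub M k (mix t X) - 2 / 3 * mu M k (mix t X)) * div_u t X * kron i j.

Definition tau : tfield :=
  fun i j t X => sum_phases N (fun k => alpha F k t X * tau_ k i j t X).

Definition stress : tfield :=
  fun i j t X => - p F t X * kron i j + tau i j t X.

Definition heat_flux (k : nat) : vfield :=
  fun i t X => alpha F k t X * lam M k (mix t X) * d_x i (T_ k) t X.

Definition q_ (k : nat) : field := divergence (heat_flux k).

Definition Q_ (k : nat) : field :=
  fun t X => sum_other_phases N k
    (fun j => sig M j k (mix t X) * (T_ j t X - T_ k t X)).

Definition I_ (k : nat) : field := fun t X => alpha F k t X * heat k t X.

Definition G_ (k : nat) : field :=
  fun t X => alpha F k t X * ddot (tau_ k) strain t X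
             + Q_ k t X + q_ k t X + I_ k t X.

Definition F_ (k : nat) : field :=
  fun t X =>
    alpha F k t X * ((A_mix t X - A_ k t X) / A_ k t X) * div_u t X
    + A_mix t X * sum_other_phases N k (fun j =>
        (Gamma_ k t X * G_ k t X * alpha F j t X
         - Gamma_ j t X * G_ j t X * alpha F k t X) / (A_ k t X * A_ j t X)).

Definition mass_flux (k : nat) : vfield :=
  fun i t X => alpha F k t X * rho F k t X * vel F i t X.

Definition momentum (i : axis) : field := fun t X => rho_mix t X * vel F i t X.

Definition momentum_flux (i : axis) : vfield :=
  fun j t X => rho_mix t X * vel F i t X * vel F j t X - stress i j t X.

Definition energy_flux : vfield :=
  fun i t X => rhoE t X * vel F i t X
               - sum_axes (fun j => stress i j t X * vel F j t X).

Definition model_at (t : R) (X : point) : Prop :=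
  (forall k, (1 <= k <= N)%nat ->
     d_t (fun s Y => alpha F k s Y * rho F k s Y) t X
       + divergence (mass_flux k) t X = 0)
  /\ (forall i, d_t (momentum i) t X + divergence (momentum_flux i) t X = 0)
  /\ d_t rhoE t X + divergence energy_flux t X
       = sum_phases N (fun k => q_ k t X + I_ k t X)
  /\ (forall l, (2 <= l <= N)%nat ->
        d_t (alpha F l) t X
          + sum_axes (fun i => vel F i t X * d_x i (alpha F l) t X)
        = F_ l t X).

End Model.

Record plane_flow := PlaneFlow {
  pl_alpha : nat -> R -> R -> R;
  pl_rho : nat -> R -> R -> R;
  pl_u : R -> R -> R;
  pl_p : R -> R -> R
}.

(* A function of (t, x), regarded as a field depending on the first coordinate
   only, and back. *)
Definition lift (f : R -> R -> R) : field := fun t X => f t (X ax0).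
Definition on_line (f : field) : R -> R -> R :=
  fun t x => f t (fun i => match i with ax0 => x | _ => 0 end).

Definition embed (V : plane_flow) : flow :=
  Flow (fun k => lift (pl_alpha V k))
       (fun k => lift (pl_rho V k))
       (fun i => match i with ax0 => lift (pl_u V) | _ => fun _ _ => 0 end)
       (lift (pl_p V)).

Definition pl_T (M : material) (V : plane_flow) (k : nat) : R -> R -> R :=
  fun t x => temp M k (pl_rho V k t x) (pl_p V t x).

Definition cont_diff (f : R -> R -> R) : Prop :=
  forall t x,
    ex_derive (fun s => f s x) t
    /\ ex_derive (fun y => f t y) x
    /\ continuity_2d_pt (fun t x => Derive (fun s => f s x) t) t x
    /\ continuity_2d_pt (fun t x => Derive (fun y => f t y) x) t x.

(* f is continuously differentiable in [S] up to the boundary. *)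
Definition cont_diff_up_to (S : R -> R -> Prop) (f : R -> R -> R) : Prop :=
  exists g, cont_diff g /\ forall t x, S t x -> f t x = g t x.

(* The viscous stress and the heat fluxes are differentiated in the equations,
   hence are required to be as smooth as the state variables. *)
Definition smooth_on (N : nat) (M : material) (V : plane_flow)
    (S : R -> R -> Prop) : Prop :=
  cont_diff_up_to S (pl_u V) /\ cont_diff_up_to S (pl_p V)
  /\ forall k, (1 <= k <= N)%nat ->
       cont_diff_up_to S (pl_alpha V k) /\ cont_diff_up_to S (pl_rho V k)
       /\ cont_diff_up_to S (on_line (tau_ M (embed V) k ax0 ax0))
       /\ cont_diff_up_to S (on_line (fun t X =>
            lam M k (mix (embed V) t X) * d_x ax0 (T_ M (embed V) k) t X)).

Definition no_jump (f : R -> R) (x : R) : Prop :=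
  exists l : R, filterlim f (at_left x) (locally l)
                /\ filterlim f (at_right x) (locally l).

Definition vanishes_at_infinity (tend : R) (f : R -> R -> R) : Prop :=
  forall eps, 0 < eps -> exists B,
    forall t x, 0 <= t <= tend -> B < Rabs x -> Rabs (f t x) < eps.

(* Initial data: [rho0], [u0], [p0] are common to both sides. *)
Record riemann_data := RiemannData {
  alphaL : nat -> R;
  alphaR : nat -> R;
  rho0 : nat -> R;
  u0 : R;
  p0 : R
}.

(* Piecewise classical solution on the time interval [0, tend]: a flow that is
   smooth, and satisfies the equations pointwise, on both sides of a curve
   x = xi t issuing from the initial discontinuity, the two sides being linked
   by jump conditions on that curve.  The conservative equations give the
   Rankine-Hugoniot conditions.  The velocity, the phase temperatures and the
   phase heat fluxes must be continuous, otherwise the viscous stress, or the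
   terms q_k occurring in F_l, would contain singular measures; then the
   nonconservative equation for alpha_l gives (u - xi') [alpha_l] = 0.  Values
   of the flow on the curve itself are irrelevant.  At infinity the flow is
   undisturbed. *)
Record riemann_solution (N : nat) (M : material) (heat : nat -> R -> R -> R)
    (D : riemann_data) (tend : R) (V : plane_flow) (xi : R -> R) : Prop := {
  rs_curve : (forall t, ex_derive xi t /\ continuous (Derive xi) t) /\ xi 0 = 0;

  rs_admissible : forall t x, 0 <= t <= tend -> x <> xi t ->
    admissible N M (Mixture (fun k => pl_alpha V k t x)
                            (fun k => pl_rho V k t x) (pl_p V t x));

  rs_no_vacuum : exists delta, 0 < delta /\
    forall t x k, 0 <= t <= tend -> x <> xi t -> (1 <= k <= N)%nat ->
      delta <= pl_rho V k t x /\ delta <= pl_T M V k t x;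

  rs_smooth_left : smooth_on N M V (fun t x => 0 <= t <= tend /\ x < xi t);

  rs_smooth_right : smooth_on N M V (fun t x => 0 <= t <= tend /\ xi t < x);

  rs_equations : forall t X, 0 < t < tend -> X ax0 <> xi t ->
    model_at N M (fun k => lift (heat k)) (embed V) t X;

  rs_continuity : forall t, 0 < t < tend ->
    no_jump (pl_u V t) (xi t)
    /\ forall k, (1 <= k <= N)%nat ->
         no_jump (pl_T M V k t) (xi t)
         /\ no_jump (on_line (heat_flux M (embed V) k ax0) t) (xi t);

  rs_jump_mass : forall t k, 0 < t < tend -> (1 <= k <= N)%nat ->
    no_jump (fun x => on_line (mass_flux (embed V) k ax0) t x
                      - Derive xi t * (pl_alpha V k t x * pl_rho V k t x))
            (xi t);

  rs_jump_momentum : forall t i, 0 < t < tend ->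
    no_jump (fun x => on_line (momentum_flux N M (embed V) i ax0) t x
                      - Derive xi t * on_line (momentum N (embed V) i) t x)
            (xi t);

  rs_jump_energy : forall t, 0 < t < tend ->
    no_jump (fun x => on_line (energy_flux N M (embed V) ax0) t x
                      - sum_phases N (fun k =>
                          on_line (heat_flux M (embed V) k ax0) t x)
                      - Derive xi t * on_line (rhoE N M (embed V)) t x) (xi t);

  rs_jump_alpha : forall t l, 0 < t < tend -> (2 <= l <= N)%nat ->
    no_jump (fun x => (pl_u V t x - Derive xi t) * pl_alpha V l t x) (xi t);

  rs_initial : forall x, x <> 0 ->
    pl_u V 0 x = u0 D /\ pl_p V 0 x = p0 D
    /\ forall k, (1 <= k <= N)%nat ->
         pl_rho V k 0 x = rho0 D k
         /\ (x < 0 -> pl_alpha V k 0 x = alphaL D k)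
         /\ (0 < x -> pl_alpha V k 0 x = alphaR D k);

  rs_infinity :
    vanishes_at_infinity tend (fun t x => pl_u V t x - u0 D)
    /\ vanishes_at_infinity tend (fun t x => pl_p V t x - p0 D)
    /\ vanishes_at_infinity tend (on_line (tau N M (embed V) ax0 ax0))
    /\ forall k, (1 <= k <= N)%nat ->
         vanishes_at_infinity tend
           (fun t x => pl_T M V k t x - temp M k (rho0 D k) (p0 D))
         /\ vanishes_at_infinity tend (on_line (heat_flux M (embed V) k ax0))
}.

(* The heat sources alpha_k I_k vanish along the flow. *)
Definition releases_no_heat (N : nat) (heat : nat -> R -> R -> R) (tend : R)
    (V : plane_flow) (xi : R -> R) : Prop :=
  forall k t x, (1 <= k <= N)%nat -> 0 < t < tend -> x <> xi t ->
    pl_alpha V k t x * heat k t x = 0.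

Definition preserves_PVT (N : nat) (M : material) (u p T tend : R)
    (V : plane_flow) (xi : R -> R) : Prop :=
  forall t x, 0 <= t <= tend -> x <> xi t ->
    pl_u V t x = u /\ pl_p V t x = p
    /\ forall k, (1 <= k <= N)%nat -> pl_T M V k t x = T.

(* Main.v *)
(* The relative availability H = sum_k alpha_k rho_k (e_k - T0 s_k - g0_k) + p0
   + rho (u - u0)^2 / 2, with g0_k the Gibbs energy of phase k at rest, is
   nonnegative and vanishes only where every phase that is present is in the
   rest state.  The volume fraction equations together with the total energy
   equation force alpha_k rho_k T_k Ds_k/Dt = G_k for each phase separately, so
   that H_t + F_x = - T0 (viscous + conductive + relaxation entropy production)
   <= 0 for an explicit flux F.  By the jump conditions F - xi' H is continuous
   across the curve (either u = xi' and p - tau is continuous, or the whole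
   state is), and F vanishes at infinity; hence the integral of H, initially 0,
   stays 0.  Where alpha_k = 0 the identity for phase k reduces to Q_k = 0, and
   a maximum principle over the absent phases gives T_k = T.  For the existence
   part, the initial jump is advected with velocity u. *)
Require Import Defs.
From Stdlib Require Import Reals Lra Lia.
From Coquelicot Require Import Coquelicot.
Open Scope R_scope.

(** * Sums over the phases and the stiffened gas *)

(** Two obstacles shape the argument. The fields are smooth only up to the curve, so every
    computation is done on globally continuously differentiable extensions, in the frame y = x - xi
    t, where each side is a fixed half line. Outside its side an extension need not be positive, so
    the logarithm in the availability is replaced by a smooth function agreeing with it on [d, oo);
    the bound excluding vacuum supplies the floor d. Moreover, nothing is known about integrability
    over the line: the integral is taken over |y| <= B, its growth is bounded by the flux at the two
    ends, which is uniformly small in time for large B, and nonnegativity passes the smallness on to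
    every bounded interval. Subtracting the Gibbs energies at rest makes H blind to the initial
    jump: each phase has zero availability on both sides, whatever its fraction. The equations hold
    only at interior times; the end times are reached by continuity along lines of constant y. *)

Lemma sum_phases_S (N : nat) (f : nat -> R) :
  sum_phases (S N) f = sum_phases N f + f (S N).
Proof. unfold sum_phases. rewrite sum_n_Sm by lia. reflexivity. Qed.

Lemma sum_phases_0 (f : nat -> R) : sum_phases 0 f = 0.
Proof. unfold sum_phases. rewrite sum_n_m_zero by lia. reflexivity. Qed.

Lemma sum_phases_ext (N : nat) (f g : nat -> R) :
  (forall k, (1 <= k <= N)%nat -> f k = g k) -> sum_phases N f = sum_phases N g.
Proof. apply sum_n_m_ext_loc. Qed.

Lemma sum_phases_plus (N : nat) (f g : nat -> R) :
  sum_phases N (fun k => f k + g k) = sum_phases N f + sum_phases N g.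
Proof. apply (sum_n_m_plus f g). Qed.

Lemma sum_phases_scal (N : nat) (c : R) (f : nat -> R) :
  sum_phases N (fun k => c * f k) = c * sum_phases N f.
Proof. apply (sum_n_m_mult_l (K := R_Ring)). Qed.

Lemma sum_phases_scal_r (N : nat) (c : R) (f : nat -> R) :
  sum_phases N (fun k => f k * c) = sum_phases N f * c.
Proof.
  rewrite Rmult_comm, <- sum_phases_scal.
  apply sum_phases_ext; intros; ring.
Qed.

Lemma sum_phases_opp (N : nat) (f : nat -> R) :
  sum_phases N (fun k => - f k) = - sum_phases N f.
Proof.
  replace (- sum_phases N f) with ((-1) * sum_phases N f) by ring.
  rewrite <- sum_phases_scal. apply sum_phases_ext; intros; ring.
Qed.

Lemma sum_phases_minus (N : nat) (f g : nat -> R) :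
  sum_phases N (fun k => f k - g k) = sum_phases N f - sum_phases N g.
Proof.
  unfold Rminus. rewrite <- sum_phases_opp. apply sum_phases_plus.
Qed.

Lemma sum_phases_zero (N : nat) (f : nat -> R) :
  (forall k, (1 <= k <= N)%nat -> f k = 0) -> sum_phases N f = 0.
Proof.
  induction N as [|N IH]; intros H; [apply sum_phases_0|].
  rewrite sum_phases_S, IH, H; [ring | lia | intros; apply H; lia].
Qed.

Lemma sum_phases_ge0 (N : nat) (f : nat -> R) :
  (forall k, (1 <= k <= N)%nat -> 0 <= f k) -> 0 <= sum_phases N f.
Proof.
  induction N as [|N IH]; intros H.
  - rewrite sum_phases_0; lra.
  - rewrite sum_phases_S.
    assert (0 <= f (S N)) by (apply H; lia).
    assert (0 <= sum_phases N f) by (apply IH; intros; apply H; lia). lra.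
Qed.

Lemma sum_phases_term_le (N : nat) (f : nat -> R) (j : nat) :
  (forall k, (1 <= k <= N)%nat -> 0 <= f k) -> (1 <= j <= N)%nat ->
  f j <= sum_phases N f.
Proof.
  induction N as [|N IH]; intros H Hj; [lia|].
  rewrite sum_phases_S.
  assert (0 <= f (S N)) by (apply H; lia).
  assert (0 <= sum_phases N f)
    by (apply sum_phases_ge0; intros; apply H; lia).
  destruct (Nat.eq_dec j (S N)) as [->|Hn]; [lra|].
  assert (f j <= sum_phases N f) by (apply IH; [intros; apply H; lia | lia]).
  lra.
Qed.

Lemma sum_phases_ge0_eq0 (N : nat) (f : nat -> R) :
  (forall k, (1 <= k <= N)%nat -> 0 <= f k) -> sum_phases N f = 0 ->
  forall k, (1 <= k <= N)%nat -> f k = 0.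
Proof.
  intros H H0 k Hk. pose proof (sum_phases_term_le N f k H Hk).
  specialize (H k Hk). lra.
Qed.

(** Individual fractions may be zero, but fractions summing to 1 cannot all be, so strict positivity
    survives the averaging. *)
Lemma sum_phases_weighted_pos (N : nat) (a c : nat -> R) :
  (forall k, (1 <= k <= N)%nat -> 0 <= a k) -> sum_phases N a = 1 ->
  (forall k, (1 <= k <= N)%nat -> 0 < c k) ->
  0 < sum_phases N (fun k => a k * c k).
Proof.
  intros Ha Hs Hc.
  assert (Hn : forall k, (1 <= k <= N)%nat -> 0 <= a k * c k).
  { intros k Hk. apply Rmult_le_pos; [auto | apply Rlt_le; auto]. }
  destruct (Req_dec (sum_phases N (fun k => a k * c k)) 0) as [E|E].
  - exfalso. assert (sum_phases N a = 0); [|lra].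
    apply sum_phases_zero. intros k Hk.
    pose proof (sum_phases_ge0_eq0 N _ Hn E k Hk) as H0. cbv beta in H0.
    specialize (Hc k Hk).
    apply Rmult_integral in H0. destruct H0; lra.
  - pose proof (sum_phases_ge0 N _ Hn). lra.
Qed.

Lemma sum_phases_first (N : nat) (f : nat -> R) :
  (1 <= N)%nat -> sum_phases N f = f 1%nat + sum_n_m f 2 N.
Proof. intros H. unfold sum_phases. rewrite sum_Sn_m by lia. reflexivity. Qed.

(** The model has a volume fraction equation, and the curve a jump condition, only for l >= 2. The
    saturation constraint recovers phase 1 through this lemma. *)
Lemma sum_phases_eq_first (N : nat) (f g : nat -> R) :
  (forall l, (2 <= l <= N)%nat -> f l = g l) ->
  sum_phases N f = sum_phases N g ->
  forall k, (1 <= k <= N)%nat -> f k = g k.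
Proof.
  intros H Hs k Hk. destruct (Nat.eq_dec k 1) as [->|Hn]; [|apply H; lia].
  rewrite !sum_phases_first in Hs by lia.
  rewrite (sum_n_m_ext_loc f g) in Hs by exact H. lra.
Qed.

Lemma sum_phases_swap (N M : nat) (f : nat -> nat -> R) :
  sum_phases N (fun i => sum_phases M (fun j => f i j))
  = sum_phases M (fun j => sum_phases N (fun i => f i j)).
Proof.
  induction N as [|N IH].
  - rewrite sum_phases_0. symmetry. apply sum_phases_zero.
    intros. apply sum_phases_0.
  - rewrite sum_phases_S, IH, <- sum_phases_plus.
    apply sum_phases_ext. intros. now rewrite sum_phases_S.
Qed.

Lemma sum_other_phases_full (N k : nat) (f : nat -> R) :
  f k = 0 -> sum_other_phases N k f = sum_phases N f.
Proof.
  intros H. apply sum_phases_ext. intros j _.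
  destruct (Nat.eqb_spec j k); subst; auto.
Qed.

Lemma pos_lower_bound (N : nat) (f : nat -> R) :
  (forall k, (1 <= k <= N)%nat -> 0 < f k) ->
  exists d, 0 < d /\ forall k, (1 <= k <= N)%nat -> d <= f k.
Proof.
  induction N as [|N IH]; intros H.
  - exists 1. split; [lra | intros; lia].
  - destruct IH as [d [Hd Hl]]; [intros; apply H; lia|].
    exists (Rmin d (f (S N))). split.
    + apply Rmin_glb_lt; [auto | apply H; lia].
    + intros k Hk. destruct (Nat.eq_dec k (S N)) as [->|Hn].
      * apply Rmin_r.
      * apply Rle_trans with d; [apply Rmin_l | apply Hl; lia].
Qed.

(** Choice over finitely many labels holds by induction, without an axiom. It selects the smooth
    extensions of all phase fields at once. *)
Lemma finite_choice {A : Type} (a0 : A) (N : nat) (Q : nat -> A -> Prop) :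
  (forall k, (1 <= k <= N)%nat -> exists x, Q k x) ->
  exists f, forall k, (1 <= k <= N)%nat -> Q k (f k).
Proof.
  induction N as [|N IH]; intros H.
  - exists (fun _ => a0). intros; lia.
  - destruct IH as [f Hf]; [intros; apply H; lia|].
    destruct (H (S N)) as [x Hx]; [lia|].
    exists (fun k => if Nat.eqb k (S N) then x else f k).
    intros k Hk. destruct (Nat.eqb_spec k (S N)) as [->|Hn]; auto.
    apply Hf; lia.
Qed.

Lemma is_derive_sum_phases (N : nat) (f : nat -> R -> R) (l : nat -> R) (x : R) :
  (forall k, (1 <= k <= N)%nat -> is_derive (f k) x (l k)) ->
  is_derive (fun y => sum_phases N (fun k => f k y)) x (sum_phases N l).
Proof.
  induction N as [|N IH]; intros H.
  - apply is_derive_ext with (fun _ => 0); [intros; now rewrite sum_phases_0|].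
    rewrite sum_phases_0. apply (is_derive_const (K := R_AbsRing) 0).
  - apply is_derive_ext with
      (fun y => plus (sum_phases N (fun k => f k y)) (f (S N) y)).
    { intros y. now rewrite sum_phases_S. }
    rewrite sum_phases_S. change (sum_phases N l + l (S N))
      with (plus (sum_phases N l) (l (S N))).
    apply (is_derive_plus (K := R_AbsRing) (V := R_NormedModule)).
    + apply IH. intros; apply H; lia.
    + apply H; lia.
Qed.

(** * Closed forms for the stiffened gas *)

Section Thermo.
Variables (M : material) (k : nat).
Hypotheses (Hg : 1 < gam M k) (HC : 0 < Cv M k).

Lemma temp_eq (r q : R) : 0 < r ->
  temp M k r q = (q + pinf M k) / ((gam M k - 1) * Cv M k * r).
Proof. intros Hr. unfold temp, energy. field. repeat split; lra. Qed.

Lemma temp_pos (r q : R) : 0 < r -> 0 < temp M k r q -> 0 < q + pinf M k.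
Proof.
  intros Hr HT. rewrite temp_eq in HT by auto.
  assert (Hd : 0 < (gam M k - 1) * Cv M k * r)
    by (repeat apply Rmult_lt_0_compat; lra).
  replace (q + pinf M k) with
    ((q + pinf M k) / ((gam M k - 1) * Cv M k * r)
      * ((gam M k - 1) * Cv M k * r)) by (field; lra).
  now apply Rmult_lt_0_compat.
Qed.

(** On an isentrope q + pinf is proportional to r^gam, so its logarithmic derivative in r is gam. *)
Lemma bulk_eq (r q : R) : 0 < r -> 0 < q + pinf M k ->
  bulk M k r q = gam M k * (q + pinf M k).
Proof.
  intros Hr Hq. unfold bulk, sound_speed_sq.
  pose proof (isentropic_pressure_entropy M k r q HC Hq) as Hi.
  set (s := entropy M k r q) in *.
  rewrite (is_derive_unique _ r
    (gam M k * (isentropic_pressure M k r s + pinf M k) / r)).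
  - rewrite Hi. field. lra.
  - unfold isentropic_pressure, Rpower. auto_derive; [lra | field; lra].
Qed.

Lemma Gruneisen_eq (r q : R) : 0 < r -> Gruneisen M k r q = gam M k - 1.
Proof.
  intros Hr. unfold Gruneisen, xi_coef.
  rewrite (is_derive_unique _ q (/ (gam M k - 1) / r)).
  - field. lra.
  - unfold energy. auto_derive; [lra | field; lra].
Qed.

End Thermo.

(** * Heat received by each phase *)

Section Transport.
Variables (N : nat) (a A Gam G aD : nat -> R) (pD ux : R).
Hypotheses (HN : (1 <= N)%nat)
  (Ha : forall k, (1 <= k <= N)%nat -> 0 <= a k)
  (Hs : sum_phases N a = 1)
  (HA : forall k, (1 <= k <= N)%nat -> 0 < A k)
  (HGam : forall k, (1 <= k <= N)%nat -> 0 < Gam k).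

Let Am := / sum_phases N (fun k => a k / A k).
Let W := sum_phases N (fun j => Gam j * G j / A j).

(** The source F_k with all fields frozen at one point, so that the argument on the heat of each
    phase is pure algebra. *)
Definition volume_source (k : nat) : R :=
  a k * ((Am - A k) / A k) * ux
  + Am * sum_other_phases N k (fun j =>
      (Gam k * G k * a j - Gam j * G j * a k) / (A k * A j)).

Lemma compliance_pos : 0 < sum_phases N (fun k => a k / A k).
Proof.
  apply (sum_phases_weighted_pos N a (fun k => / A k)); auto.
  intros k Hk. apply Rinv_0_lt_compat; auto.
Qed.

(** The exchange sum includes j = k for free, since that term is zero. It then splits in two: the
    first half contains the sum of a j / A j, which is 1 / Am, and the second half is a multiple of
    [W]. *)
Lemma volume_source_eq (k : nat) : (1 <= k <= N)%nat ->
  A k * volume_source k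
  = a k * (Am - A k) * ux + Gam k * G k - Am * a k * W.
Proof.
  intros Hk. unfold volume_source.
  rewrite sum_other_phases_full.
  2: { assert (HAk := HA k Hk). field. lra. }
  replace (sum_phases N (fun j =>
      (Gam k * G k * a j - Gam j * G j * a k) / (A k * A j)))
    with (Gam k * G k / A k * / Am - a k / A k * W).
  - pose proof compliance_pos as Hc. assert (HAk := HA k Hk).
    unfold Am. field. lra.
  - unfold Am, W. rewrite Rinv_inv, <- !sum_phases_scal, <- sum_phases_minus.
    apply sum_phases_ext. intros j Hj.
    assert (HAk := HA k Hk). assert (HAj := HA j Hj). field. lra.
Qed.

(** The sources respect saturation, so phase 1, which has no equation of its own in the model, obeys
    the same one as the others. *)
Lemma sum_volume_source : sum_phases N volume_source = 0.
Proof.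
  rewrite (sum_phases_ext N volume_source
    (fun k => (Am * ux - Am * W) * (a k / A k) - ux * a k
              + Gam k * G k / A k)).
  - rewrite sum_phases_plus, sum_phases_minus, !sum_phases_scal, Hs.
    fold W. pose proof compliance_pos. unfold Am. field. lra.
  - intros k Hk. assert (HAk := HA k Hk).
    apply Rmult_eq_reg_l with (A k); [|lra].
    rewrite volume_source_eq by auto. field. lra.
Qed.

(** This is alpha_k rho_k T_k Ds_k/Dt. The Gibbs relation gives rho T Ds = (Dp - c^2 D rho) / Gamma
    with c the sound speed, and mass conservation replaces alpha D rho by - rho (aD + a ux), with A
    = rho c^2. *)
Definition heating (k : nat) : R :=
  (a k * pD + A k * (aD k + a k * ux)) / Gam k.

(* The volume fraction equations leave the excess heat of phase k equal to
   a_k / Gamma_k times a factor common to all phases, which the total energy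
   equation forces to vanish. *)
Lemma heating_eq :
  sum_phases N aD = 0 ->
  (forall l, (2 <= l <= N)%nat -> aD l = volume_source l) ->
  sum_phases N heating = sum_phases N G ->
  forall k, (1 <= k <= N)%nat -> heating k = G k.
Proof.
  intros HaD HF Hsum.
  assert (HFall : forall k, (1 <= k <= N)%nat -> aD k = volume_source k).
  { apply sum_phases_eq_first; auto. now rewrite sum_volume_source. }
  (* [Z] = 0 is the evolution equation of the common pressure, which the model contains only
     implicitly. *)
  set (Z := pD + Am * ux - Am * W).
  assert (HY : forall k, (1 <= k <= N)%nat ->
    heating k - G k = Z * (a k * / Gam k)).
  { intros k Hk. unfold heating. rewrite HFall, Rmult_plus_distr_l by auto.
    rewrite volume_source_eq by auto. unfold Z.
    assert (Hq := HGam k Hk). field. lra. }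
  assert (HZ : Z * sum_phases N (fun k => a k * / Gam k) = 0).
  { rewrite <- sum_phases_scal, <- (sum_phases_ext _ _ _ HY),
      sum_phases_minus, Hsum. ring. }
  assert (0 < sum_phases N (fun k => a k * / Gam k)).
  { apply sum_phases_weighted_pos; auto.
    intros; apply Rinv_0_lt_compat; auto. }
  assert (HZ0 : Z = 0) by (apply Rmult_integral in HZ; destruct HZ; lra).
  intros k Hk. specialize (HY k Hk). rewrite HZ0 in HY. lra.
Qed.

End Transport.

(** Exchanging the two summation indices changes the sign of every term, because the rates are
    symmetric. *)
Lemma relaxation_sum_zero (N : nat) (sg : nat -> nat -> R) (T : nat -> R) :
  (forall j k, (1 <= j <= N)%nat -> (1 <= k <= N)%nat -> j <> k ->
     sg j k = sg k j) ->
  sum_phases N (fun k => sum_other_phases N k (fun j => sg j k * (T j - T k)))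
  = 0.
Proof.
  intros Hs.
  set (S := sum_phases N _).
  assert (S = - S); [|lra].
  unfold S at 1. unfold sum_other_phases.
  rewrite sum_phases_swap. unfold S, sum_other_phases.
  rewrite <- sum_phases_opp. apply sum_phases_ext. intros j Hj.
  rewrite <- sum_phases_opp. apply sum_phases_ext. intros k Hk.
  destruct (Nat.eqb_spec j k), (Nat.eqb_spec k j); try lia; [ring|].
  rewrite (Hs j k) by auto. ring.
Qed.

(** Twice the sum is formed by adding it to its transpose; the pair (j, k) then contributes sg j k
    (T j - T k)^2 / (T j * T k). *)
Lemma relaxation_entropy (N : nat) (sg : nat -> nat -> R) (T : nat -> R) :
  (forall j k, (1 <= j <= N)%nat -> (1 <= k <= N)%nat -> j <> k ->
     sg j k = sg k j /\ 0 < sg j k) ->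
  (forall k, (1 <= k <= N)%nat -> 0 < T k) ->
  0 <= sum_phases N (fun k =>
         sum_other_phases N k (fun j => sg j k * (T j - T k)) * / T k).
Proof.
  intros Hs HT.
  set (S := sum_phases N _).
  set (f := fun k j => if Nat.eqb j k then 0
                       else sg j k * (T j - T k) * / T k).
  assert (HS : S = sum_phases N (fun k => sum_phases N (fun j => f k j))).
  { apply sum_phases_ext. intros k Hk. unfold sum_other_phases.
    rewrite <- sum_phases_scal_r. apply sum_phases_ext. intros j Hj.
    unfold f. destruct (Nat.eqb j k); ring. }
  assert (HS2 : S = sum_phases N (fun k => sum_phases N (fun j => f j k))).
  { rewrite HS. apply sum_phases_swap. }
  assert (0 <= S + S); [|lra].
  rewrite HS at 1. rewrite HS2.
  rewrite <- sum_phases_plus. apply sum_phases_ge0. intros k Hk.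
  rewrite <- sum_phases_plus. apply sum_phases_ge0. intros j Hj.
  unfold f. destruct (Nat.eqb_spec j k), (Nat.eqb_spec k j); try lia; [lra|].
  destruct (Hs j k) as [E P]; auto. rewrite <- E.
  assert (HTj := HT j Hj). assert (HTk := HT k Hk).
  replace (sg j k * (T j - T k) * / T k + sg j k * (T k - T j) * / T j)
    with (sg j k * ((T j - T k) * (T j - T k)) / (T j * T k))
    by (field; lra).
  apply Rlt_le in P.
  apply Rdiv_le_0_compat; [|now apply Rmult_lt_0_compat].
  apply Rmult_le_pos; auto. apply Rle_0_sqr.
Qed.

(* Discrete maximum principle on the phases that are absent. *)
Lemma absent_phases_relax (N : nat) (sg : nat -> nat -> R) (T : nat -> R)
  (present : nat -> Prop) (T0 : R) :
  (forall j k, (1 <= j <= N)%nat -> (1 <= k <= N)%nat -> j <> k ->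
     0 < sg j k) ->
  (exists j, (1 <= j <= N)%nat /\ present j) ->
  (forall k, (1 <= k <= N)%nat -> present k -> T k = T0) ->
  (forall k, (1 <= k <= N)%nat -> ~ present k ->
     sum_other_phases N k (fun j => sg j k * (T j - T k)) = 0) ->
  (forall k, (1 <= k <= N)%nat -> present k \/ ~ present k) ->
  forall k, (1 <= k <= N)%nat -> T k <= T0.
Proof.
  intros Hs [j0 [Hj0 Hp]] HT HQ Hdec.
  assert (Hmax : exists m, (1 <= m <= N)%nat /\
                  forall k, (1 <= k <= N)%nat -> T k <= T m).
  { clear - Hj0. assert (HN : (1 <= N)%nat) by lia. clear Hj0.
    induction N as [|n IH]; [lia|].
    destruct (Nat.eq_dec n 0) as [->|Hn].
    - exists 1%nat. split; [lia|]. intros k Hk.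
      replace k with 1%nat by lia. lra.
    - destruct IH as [m [Hm H]]; [lia|].
      destruct (Rle_lt_dec (T (S n)) (T m)).
      + exists m. split; [lia|]. intros k Hk.
        destruct (Nat.eq_dec k (S n)) as [->|]; [auto | apply H; lia].
      + exists (S n). split; [lia|]. intros k Hk.
        destruct (Nat.eq_dec k (S n)) as [->|]; [lra|].
        assert (T k <= T m) by (apply H; lia). lra. }
  destruct Hmax as [m [Hm Hmax]].
  intros k Hk. apply Rle_trans with (T m); auto.
  destruct (Hdec m Hm) as [P|P]; [rewrite (HT m); auto; lra|].
  specialize (HQ m Hm P). unfold sum_other_phases in HQ.
  (* At a hottest phase m all exchange terms have the same sign. If m is absent they sum to zero, so
     each vanishes, in particular the one with the present phase j0. *)
  assert (H0 : - (if Nat.eqb j0 m then 0 else sg j0 m * (T j0 - T m)) = 0).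
  { apply (sum_phases_ge0_eq0 N
      (fun j => - (if Nat.eqb j m then 0 else sg j m * (T j - T m)))).
    - intros j Hj. destruct (Nat.eqb_spec j m); [lra|].
      specialize (Hs j m Hj Hm n). specialize (Hmax j Hj).
      assert (0 <= sg j m * (T m - T j)) by (apply Rmult_le_pos; lra). lra.
    - rewrite sum_phases_opp, HQ. ring.
    - auto. }
  destruct (Nat.eqb_spec j0 m) as [->|n]; [contradiction|].
  specialize (Hs j0 m Hj0 Hm n). rewrite (HT j0 Hj0 Hp) in H0.
  assert (HP : sg j0 m * (T0 - T m) = 0) by lra.
  apply Rmult_integral in HP. destruct HP; lra.
Qed.

(** * Balance of relative availability *)

Ltac derive_from H :=
  lazymatch type of H with
  | is_derive ?f ?x ?l =>
      replace (Derive (fun y : R => f y) x) with l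
        by (symmetry; exact (is_derive_unique _ _ _ H))
  end.

Section Availability.
Variables (N : nat) (M : material).
Variables (rh : nat -> R) (u0 p0 T0 : R).

(* [L] stands for the logarithm, or for a globally smooth function agreeing
   with it away from 0. *)
Variable L : R -> R.

(** Specific Gibbs energy e + p/rho - T0 s of the rest state, for the entropy normalised as Cv (ln
    (p + pinf) - gam ln rho). When T0 is the rest temperature, it makes [avail] and both its partial
    derivatives vanish at rest. *)
Definition gibbs0 (k : nat) : R :=
  ((p0 + gam M k * pinf M k) / (gam M k - 1) + p0) / rh k + w M k
  - T0 * Cv M k * (ln (p0 + pinf M k) - gam M k * ln (rh k)).

(* rho (e - T0 s) + p0 - rho g0 for phase k. *)
Definition avail (k : nat) (r q : R) : R :=
  (q + gam M k * pinf M k) / (gam M k - 1) + r * w M k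
  - T0 * Cv M k * (r * (L (q + pinf M k) - gam M k * L r))
  + p0 - r * gibbs0 k.

(** Like the other [d...] expressions below, a formal rate written in values and rates alone. The
    dissipation inequality is thus an algebraic statement at a point, and the [is_derive_...] lemmas
    connect it to actual derivatives. *)
Definition davail (k : nat) (r q rD qD : R) : R :=
  qD / (gam M k - 1) + rD * w M k
  - T0 * Cv M k * (rD * (L (q + pinf M k) - gam M k * L r)
                   + r * (qD / (q + pinf M k)) - gam M k * rD)
  - rD * gibbs0 k.

Definition total_avail (a r : nat -> R) (q v : R) : R :=
  sum_phases N (fun k => a k * avail k (r k) q)
  + / 2 * sum_phases N (fun k => a k * r k) * ((v - u0) * (v - u0)).

Definition dtotal_avail (a r : nat -> R) (q v : R) (aD rD : nat -> R)
    (qD vD : R) : R :=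
  sum_phases N (fun k => aD k * avail k (r k) q
                         + a k * davail k (r k) q (rD k) qD)
  + / 2 * sum_phases N (fun k => aD k * r k + a k * rD k)
        * ((v - u0) * (v - u0))
  + sum_phases N (fun k => a k * r k) * ((v - u0) * vD).

(* The availability flux relative to a frame of velocity [s]. *)
Definition avail_flux (a r : nat -> R) (q v : R) (tk hf : nat -> R) (s : R)
    : R :=
  total_avail a r q v * (v - s) + (q - p0) * (v - u0)
  - sum_phases N (fun k => a k * tk k) * (v - u0)
  - sum_phases N (fun k => a k * hf k * (1 - T0 / temp M k (r k) q)).

Definition dtemp (k : nat) (r q rD qD : R) : R :=
  temp M k r q * (qD / (q + pinf M k) - rD / r).

Definition davail_flux (a r : nat -> R) (q v : R) (tk hf : nat -> R) (s : R)
    (aX rX : nat -> R) (qX vX : R) (tX hX : nat -> R) : R :=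
  dtotal_avail a r q v aX rX qX vX * (v - s) + total_avail a r q v * vX
  + qX * (v - u0) + (q - p0) * vX
  - sum_phases N (fun k => aX k * tk k + a k * tX k) * (v - u0)
  - sum_phases N (fun k => a k * tk k) * vX
  - sum_phases N (fun k =>
      (aX k * hf k + a k * hX k) * (1 - T0 / temp M k (r k) q)
      + a k * hf k * T0 * dtemp k (r k) q (rX k) qX
        / (temp M k (r k) q) ^ 2).

Definition log_like (z : R) : Prop := 0 < z /\ is_derive L z (/ z).

Hypothesis HM : forall k, (1 <= k <= N)%nat -> 1 < gam M k /\ 0 < Cv M k.

Lemma is_derive_avail (k : nat) (f g : R -> R) (x rD qD : R) :
  (1 <= k <= N)%nat ->
  log_like (f x) -> log_like (g x + pinf M k) ->
  is_derive f x rD -> is_derive g x qD ->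
  is_derive (fun y => avail k (f y) (g y)) x (davail k (f x) (g x) rD qD).
Proof.
  intros Hk [Hf HLf] [Hg HLg] Df Dg. destruct (HM k Hk) as [H1 H2].
  unfold avail, davail.
  auto_derive.
  - repeat split; try (eexists; eassumption).
  - derive_from HLf; derive_from HLg; derive_from Df; derive_from Dg.
    field. lra.
Qed.

Lemma is_derive_total_avail (a r : nat -> R -> R) (q v : R -> R) (x : R)
  (aD rD : nat -> R) (qD vD : R) :
  (forall k, (1 <= k <= N)%nat ->
     log_like (r k x) /\ log_like (q x + pinf M k)) ->
  (forall k, (1 <= k <= N)%nat ->
     is_derive (a k) x (aD k) /\ is_derive (r k) x (rD k)) ->
  is_derive q x qD -> is_derive v x vD ->
  is_derive (fun y => total_avail (fun k => a k y) (fun k => r k y) (q y) (v y))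
    x (dtotal_avail (fun k => a k x) (fun k => r k x) (q x) (v x) aD rD qD vD).
Proof.
  intros Hp Har Hq Hv. unfold total_avail, dtotal_avail.
  assert (H1 : is_derive
    (fun y => sum_phases N (fun k => a k y * avail k (r k y) (q y))) x
    (sum_phases N (fun k => aD k * avail k (r k x) (q x)
                   + a k x * davail k (r k x) (q x) (rD k) qD))).
  { apply (is_derive_sum_phases N (fun k y => a k y * avail k (r k y) (q y))).
    intros k Hk. destruct (Hp k Hk), (Har k Hk).
    pose proof (is_derive_avail k (r k) q x (rD k) qD Hk) as Hd.
    apply (is_derive_mult (K := R_AbsRing) (a k)
             (fun y => avail k (r k y) (q y))); auto.
    intros; apply Rmult_comm. }
  assert (H2 : is_derive (fun y => sum_phases N (fun k => a k y * r k y)) x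
    (sum_phases N (fun k => aD k * r k x + a k x * rD k))).
  { apply (is_derive_sum_phases N (fun k y => a k y * r k y)).
    intros k Hk. destruct (Har k Hk).
    apply (is_derive_mult (K := R_AbsRing) (a k) (r k)); auto.
    intros; apply Rmult_comm. }
  (* The finite sums are abstracted to opaque functions, so that [auto_derive] only meets a
     polynomial expression. *)
  assert (Hgen : forall (S1 S2 : R -> R) (s1 s2 : R),
    is_derive S1 x s1 -> is_derive S2 x s2 ->
    is_derive (fun y => S1 y + / 2 * S2 y * ((v y - u0) * (v y - u0))) x
      (s1 + / 2 * s2 * ((v x - u0) * (v x - u0)) + S2 x * ((v x - u0) * vD))).
  { intros S1 S2 s1 s2 D1 D2. auto_derive.
    - repeat split; eexists; eassumption.
    - derive_from D1; derive_from D2; derive_from Hv. field. }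
  exact (Hgen _ _ _ _ H1 H2).
Qed.

Lemma is_derive_temp (k : nat) (f g : R -> R) (x rD qD : R) :
  (1 <= k <= N)%nat -> 0 < f x -> 0 < g x + pinf M k ->
  is_derive f x rD -> is_derive g x qD ->
  is_derive (fun y => temp M k (f y) (g y)) x (dtemp k (f x) (g x) rD qD).
Proof.
  intros Hk Hf Hg Df Dg. destruct (HM k Hk) as [H1 H2].
  unfold dtemp, temp, energy. auto_derive.
  - repeat split; try (eexists; eassumption); try lra.
    apply Rgt_not_eq, Rmult_lt_0_compat; lra.
  - derive_from Df; derive_from Dg.
    field. lra.
Qed.

Lemma is_derive_avail_flux (a r : nat -> R -> R) (q v : R -> R)
  (tk hf : nat -> R -> R) (s x : R)
  (aX rX : nat -> R) (qX vX : R) (tX hX : nat -> R) :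
  (forall k, (1 <= k <= N)%nat ->
     log_like (r k x) /\ log_like (q x + pinf M k)) ->
  (forall k, (1 <= k <= N)%nat ->
     is_derive (a k) x (aX k) /\ is_derive (r k) x (rX k)
     /\ is_derive (tk k) x (tX k) /\ is_derive (hf k) x (hX k)) ->
  is_derive q x qX -> is_derive v x vX ->
  is_derive (fun y => avail_flux (fun k => a k y) (fun k => r k y) (q y) (v y)
                        (fun k => tk k y) (fun k => hf k y) s) x
    (davail_flux (fun k => a k x) (fun k => r k x) (q x) (v x)
       (fun k => tk k x) (fun k => hf k x) s aX rX qX vX tX hX).
Proof.
  intros Hp Hd Hq Hv.
  assert (H1 := is_derive_total_avail a r q v x aX rX qX vX Hp
                  (fun k Hk => conj (proj1 (Hd k Hk))
                                    (proj1 (proj2 (Hd k Hk)))) Hq Hv).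
  unfold avail_flux, davail_flux.
  assert (H2 : is_derive (fun y => sum_phases N (fun k => a k y * tk k y)) x
    (sum_phases N (fun k => aX k * tk k x + a k x * tX k))).
  { apply (is_derive_sum_phases N (fun k y => a k y * tk k y)).
    intros k Hk. destruct (Hd k Hk) as (?&?&?&?).
    apply (is_derive_mult (K := R_AbsRing) (a k) (tk k)); auto.
    intros; apply Rmult_comm. }
  assert (H3 : is_derive (fun y => sum_phases N (fun k =>
      a k y * hf k y * (1 - T0 / temp M k (r k y) (q y)))) x
    (sum_phases N (fun k =>
      (aX k * hf k x + a k x * hX k) * (1 - T0 / temp M k (r k x) (q x))
      + a k x * hf k x * T0 * dtemp k (r k x) (q x) (rX k) qX
        / (temp M k (r k x) (q x)) ^ 2))).
  { apply (is_derive_sum_phases N (fun k y =>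
      a k y * hf k y * (1 - T0 / temp M k (r k y) (q y)))).
    intros k Hk. destruct (Hd k Hk) as (Da&Dr&Dt&Dh).
    destruct (Hp k Hk) as [[Hr _] [Hqp _]]. destruct (HM k Hk).
    assert (HT := is_derive_temp k (r k) q x (rX k) qX Hk Hr Hqp Dr Hq).
    assert (Hpos : temp M k (r k x) (q x) <> 0).
    { rewrite temp_eq by auto. apply Rgt_not_eq.
      apply Rdiv_lt_0_compat; auto.
      repeat apply Rmult_lt_0_compat; lra. }
    assert (Hgen : forall (T : R -> R) (TX : R), T x <> 0 ->
      is_derive T x TX ->
      is_derive (fun y => a k y * hf k y * (1 - T0 / T y)) x
        ((aX k * hf k x + a k x * hX k) * (1 - T0 / T x)
         + a k x * hf k x * T0 * TX / T x ^ 2)).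
    { intros T TX HT0 DT. auto_derive.
      - repeat split; auto; eexists; eassumption.
      - derive_from DT; derive_from Da; derive_from Dh. field. auto. }
    exact (Hgen _ _ Hpos HT). }
  assert (Hgen : forall (S1 S2 S3 : R -> R) (s1 s2 s3 : R),
    is_derive S1 x s1 -> is_derive S2 x s2 -> is_derive S3 x s3 ->
    is_derive (fun y => S1 y * (v y - s) + (q y - p0) * (v y - u0)
      - S2 y * (v y - u0) - S3 y) x
      (s1 * (v x - s) + S1 x * vX + qX * (v x - u0) + (q x - p0) * vX
       - s2 * (v x - u0) - S2 x * vX - s3)).
  { intros S1 S2 S3 s1 s2 s3 D1 D2 D3. auto_derive.
    - repeat split; eexists; eassumption.
    - derive_from D1; derive_from D2; derive_from D3; derive_from Hv;
        derive_from Hq. ring. }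
  exact (Hgen _ _ _ _ _ _ H1 H2 H3).
Qed.

(** * Entropy production at a point; suffixes T, X, D mark time rates, slopes and material
    derivatives *)

Section Dissipation.
Variables (a r aT aX rT rX : nat -> R) (q qT qX v vT vX : R).
Variables (tk tX hf hX : nat -> R) (sg : nat -> nat -> R).

Let aD k := aT k + v * aX k.
Let rD k := rT k + v * rX k.
Let qD := qT + v * qX.
Let vD := vT + v * vX.
Let T k := temp M k (r k) q.
Let Q k := sum_other_phases N k (fun j => sg j k * (T j - T k)).
Let G k := a k * (tk k * vX) + Q k + (aX k * hf k + a k * hX k).
Let Y := heating a (fun k => gam M k * (q + pinf M k)) (fun k => gam M k - 1)
           aD qD vX.

Hypotheses
  (HT0 : 0 <= T0)
  (Ha : forall k, (1 <= k <= N)%nat -> 0 <= a k)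
  (HaD : sum_phases N aD = 0)
  (Hr : forall k, (1 <= k <= N)%nat -> 0 < r k)
  (Hq : forall k, (1 <= k <= N)%nat -> 0 < q + pinf M k)
  (Has : sum_phases N a = 1)
  (Hmass : forall k, (1 <= k <= N)%nat ->
     a k * rD k + r k * aD k + a k * r k * vX = 0)
  (Hmom : sum_phases N (fun k => a k * r k) * vD
          = - qX + sum_phases N (fun k => aX k * tk k + a k * tX k))
  (HY : forall k, (1 <= k <= N)%nat -> Y k = G k)
  (Hsg : forall j k, (1 <= j <= N)%nat -> (1 <= k <= N)%nat -> j <> k ->
     sg j k = sg k j /\ 0 < sg j k)
  (Hvisc : forall k, (1 <= k <= N)%nat -> 0 <= tk k * vX)
  (Hcond : forall k, (1 <= k <= N)%nat ->
     0 <= hf k * dtemp k (r k) q (rX k) qX).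

Lemma T_pos (k : nat) : (1 <= k <= N)%nat -> 0 < T k.
Proof.
  intros Hk. destruct (HM k Hk). unfold T. rewrite temp_eq by auto.
  apply Rdiv_lt_0_compat; [auto|].
  repeat apply Rmult_lt_0_compat; auto; lra.
Qed.

(** Gibbs relation for one phase: heat G received at temperature T raises the availability by the
    Carnot fraction 1 - T0/T of it, and the rest is work against the excess pressure. *)
Lemma avail_transport (k : nat) : (1 <= k <= N)%nat ->
  aD k * avail k (r k) q + a k * davail k (r k) q (rD k) qD
    + a k * avail k (r k) q * vX
  = G k * (1 - T0 / T k) + (p0 - q) * (aD k + a k * vX).
Proof.
  intros Hk. rewrite <- HY by auto.
  assert (Hm := Hmass k Hk). assert (Hrk := Hr k Hk). assert (Hqk := Hq k Hk).
  destruct (HM k Hk).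
  apply Rminus_diag_uniq.
  (* The two sides differ by the mass balance of phase k times this factor, which is the partial
     derivative of [avail] in the density. *)
  rewrite <- (Rmult_0_l
    (w M k - T0 * Cv M k * (L (q + pinf M k) - gam M k * L (r k))
     + T0 * Cv M k * gam M k - gibbs0 k)), <- Hm.
  unfold Y, heating, T, avail, davail. rewrite temp_eq by auto.
  field. repeat split; lra.
Qed.

Lemma availability_dissipates :
  dtotal_avail a r q v aT rT qT vT
  + davail_flux a r q v tk hf 0 aX rX qX vX tX hX <= 0.
Proof.
  (* [D] is the rate of entropy production: viscous, by temperature relaxation, and by heat
     conduction. *)
  set (D := sum_phases N (fun k => a k * (tk k * vX) / T k
      + Q k * / T k
      + a k * (hf k * dtemp k (r k) q (rX k) qX) / T k ^ 2)).
  assert (HD : 0 <= D).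
  { unfold D. rewrite sum_phases_plus.
    apply Rplus_le_le_0_compat; [rewrite sum_phases_plus;
      apply Rplus_le_le_0_compat|].
    - apply sum_phases_ge0. intros k Hk. apply Rdiv_le_0_compat.
      + apply Rmult_le_pos; auto.
      + now apply T_pos.
    - apply (relaxation_entropy N sg T); auto. exact T_pos.
    - apply sum_phases_ge0. intros k Hk. apply Rdiv_le_0_compat.
      + apply Rmult_le_pos; auto.
      + apply pow_lt. now apply T_pos. }
  replace (dtotal_avail a r q v aT rT qT vT
    + davail_flux a r q v tk hf 0 aX rX qX vX tX hX) with (- (T0 * D)).
  { assert (0 <= T0 * D) by now apply Rmult_le_pos. lra. }
  assert (E1 : sum_phases N (fun k =>
      aD k * avail k (r k) q + a k * davail k (r k) q (rD k) qD
      + a k * avail k (r k) q * vX)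
    = sum_phases N (fun k => G k * (1 - T0 / T k)) + (p0 - q) * vX).
  { rewrite (sum_phases_ext _ _ _ avail_transport).
    rewrite sum_phases_plus, sum_phases_scal, sum_phases_plus,
      sum_phases_scal_r, HaD, Has. ring. }
  assert (E2 : sum_phases N (fun k => aD k * r k + a k * rD k)
               + sum_phases N (fun k => a k * r k) * vX = 0).
  { rewrite <- sum_phases_scal_r, <- sum_phases_plus.
    apply sum_phases_zero. intros k Hk. rewrite <- (Hmass k Hk). ring. }
  assert (E3 : sum_phases N Q = 0).
  { apply (relaxation_sum_zero N sg T). intros; now apply Hsg. }
  assert (E4 : sum_phases N (fun k => G k * (1 - T0 / T k))
    = sum_phases N (fun k => a k * tk k) * vX
      + sum_phases N (fun k =>
          (aX k * hf k + a k * hX k) * (1 - T0 / T k)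
          + a k * hf k * T0 * dtemp k (r k) q (rX k) qX / T k ^ 2)
      - T0 * D).
  (* The relaxation heats sum to zero and are inserted here, so that Q (1 - T0/T) on the left is
     matched term by term with the part - T0 Q / T of - T0 [D]. *)
  { rewrite <- (Rplus_0_r (sum_phases N (fun k => a k * tk k) * vX)), <- E3.
    unfold D. rewrite <- sum_phases_scal, <- sum_phases_scal_r,
      <- !sum_phases_plus, <- sum_phases_minus.
    apply sum_phases_ext. intros k Hk. pose proof (T_pos k Hk).
    unfold G. field. lra. }
  (* Time rate plus convective part of the flux divergence, regrouped into material derivatives. In
     the kinetic part the mass balance [E2] leaves only the power of the acceleration, which [Hmom]
     evaluates. *)
  assert (E5 : dtotal_avail a r q v aT rT qT vT
      + dtotal_avail a r q v aX rX qX vX * v + total_avail a r q v * vX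
    = sum_phases N (fun k =>
      aD k * avail k (r k) q + a k * davail k (r k) q (rD k) qD
      + a k * avail k (r k) q * vX)
      + / 2 * (sum_phases N (fun k => aD k * r k + a k * rD k)
               + sum_phases N (fun k => a k * r k) * vX)
            * ((v - u0) * (v - u0))
      + sum_phases N (fun k => a k * r k) * vD * (v - u0)).
  { unfold dtotal_avail, total_avail.
    rewrite (sum_phases_ext N (fun k => aD k * avail k (r k) q
        + a k * davail k (r k) q (rD k) qD + a k * avail k (r k) q * vX)
      (fun k => (aT k * avail k (r k) q + a k * davail k (r k) q (rT k) qT)
        + (aX k * avail k (r k) q + a k * davail k (r k) q (rX k) qX) * v
        + a k * avail k (r k) q * vX)).
    2: { intros k Hk. unfold davail, aD, rD, qD.
         assert (Hqk := Hq k Hk). destruct (HM k Hk). field. lra. }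
    rewrite (sum_phases_ext N (fun k => aD k * r k + a k * rD k)
      (fun k => (aT k * r k + a k * rT k) + (aX k * r k + a k * rX k) * v)).
    2: { intros k Hk. unfold aD, rD. ring. }
    rewrite !sum_phases_plus, !sum_phases_scal_r, !sum_phases_plus.
    unfold vD. ring. }
  rewrite E1, E2, Hmom, E4 in E5.
  unfold davail_flux. unfold T in E5. lra.
Qed.

End Dissipation.
End Availability.

(** * The model in one space dimension *)

Definition line_point (x : R) : point :=
  fun i => match i with ax0 => x | _ => 0 end.

Definition pl_tau (M : material) (V : plane_flow) (k : nat) : R -> R -> R :=
  on_line (tau_ M (embed V) k ax0 ax0).

Definition pl_fourier (M : material) (V : plane_flow) (k : nat) : R -> R -> R :=
  on_line (fun t X =>
    lam M k (mix (embed V) t X) * d_x ax0 (T_ M (embed V) k) t X).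

Definition pl_mix (V : plane_flow) (t x : R) : mixture :=
  Mixture (fun k => pl_alpha V k t x) (fun k => pl_rho V k t x) (pl_p V t x).

Lemma d_x_const (i : axis) (f : field) (t : R) (Y : point) (c : R) :
  (forall s, f t (upd Y i s) = c) -> d_x i f t Y = 0.
Proof.
  intros H. unfold d_x. rewrite (Derive_ext _ (fun _ => c)); auto.
  apply Derive_const.
Qed.

Section PlaneModel.
Variables (N : nat) (M : material) (heat : nat -> R -> R -> R) (V : plane_flow).

Lemma d_x_vel (i j : axis) (t : R) (Y : point) :
  d_x i (vel (embed V) j) t Y
  = match i, j with
    | ax0, ax0 => Derive (fun z => pl_u V t z) (Y ax0)
    | _, _ => 0
    end.
Proof.
  destruct i, j; try reflexivity;
    first [ apply d_x_const with 0; intros s; reflexivity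
          | apply d_x_const with (pl_u V t (Y ax0)); intros s; reflexivity ].
Qed.

Lemma div_u_plane (t : R) (Y : point) :
  div_u (embed V) t Y = Derive (fun z => pl_u V t z) (Y ax0).
Proof.
  unfold div_u, divergence, sum_axes. rewrite !d_x_vel. ring.
Qed.

Lemma strain_plane (i j : axis) (t : R) (Y : point) :
  strain (embed V) i j t Y
  = match i, j with
    | ax0, ax0 => Derive (fun z => pl_u V t z) (Y ax0)
    | _, _ => 0
    end.
Proof.
  unfold strain. rewrite !d_x_vel. destruct i, j; field.
Qed.

Lemma tau_shear (k : nat) (i j : axis) (t : R) (Y : point) :
  axis_eqb i j = false -> tau_ M (embed V) k i j t Y = 0.
Proof.
  intros H. unfold tau_, kron. rewrite H, strain_plane.
  destruct i, j; try discriminate; ring.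
Qed.

Lemma stress_shear (i j : axis) (t : R) (Y : point) :
  axis_eqb i j = false -> stress N M (embed V) i j t Y = 0.
Proof.
  intros H. unfold stress, tau, kron. rewrite H, sum_phases_zero; [ring|].
  intros k _. rewrite tau_shear by exact H. ring.
Qed.

(** In one dimension the strain and the divergence coincide, and 2 mu - 2/3 mu = 4/3 mu. The
    positive coefficient gives the sign of viscous dissipation. *)
Lemma pl_tau_eq (k : nat) (t x : R) :
  pl_tau M V k t x
  = (4 / 3 * mu M k (pl_mix V t x) + mub M k (pl_mix V t x))
    * Derive (fun z => pl_u V t z) x.
Proof.
  unfold pl_tau, on_line, tau_. rewrite strain_plane, div_u_plane.
  unfold kron, pl_mix; simpl. unfold mix; simpl. unfold lift. field.
Qed.

Lemma pl_fourier_eq (k : nat) (t x : R) :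
  pl_fourier M V k t x
  = lam M k (pl_mix V t x) * Derive (fun z => pl_T M V k t z) x.
Proof. reflexivity. Qed.

Lemma heat_flux_line (k : nat) (t x : R) :
  on_line (heat_flux M (embed V) k ax0) t x
  = pl_alpha V k t x * pl_fourier M V k t x.
Proof.
  unfold on_line, heat_flux, pl_fourier, on_line. simpl. unfold lift. ring.
Qed.

Lemma q_line (k : nat) (t x : R) :
  q_ M (embed V) k t (line_point x)
  = Derive (fun z => pl_alpha V k t z * pl_fourier M V k t z) x.
Proof.
  unfold q_, divergence, sum_axes.
  assert (H : forall i, axis_eqb i ax0 = false ->
    d_x i (heat_flux M (embed V) k i) t (line_point x) = 0).
  { intros i Hi. apply (d_x_const _ _ _ _ 0). intros s. unfold heat_flux.
    replace (d_x i (T_ M (embed V) k) t (upd (line_point x) i s)) with 0;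
      [ring|].
    symmetry. destruct i; try discriminate;
      apply d_x_const with (pl_T M V k t x); intros; reflexivity. }
  rewrite (H ax1), (H ax2) by reflexivity. rewrite !Rplus_0_r.
  apply Derive_ext. intros z.
  rewrite <- heat_flux_line. reflexivity.
Qed.

Lemma G_line (k : nat) (t x : R) :
  G_ N M (fun k => lift (heat k)) (embed V) k t (line_point x)
  = pl_alpha V k t x * (pl_tau M V k t x * Derive (fun z => pl_u V t z) x)
    + sum_other_phases N k (fun j =>
        sig M j k (pl_mix V t x) * (pl_T M V j t x - pl_T M V k t x))
    + Derive (fun z => pl_alpha V k t z * pl_fourier M V k t z) x
    + pl_alpha V k t x * heat k t x.
Proof.
  unfold G_. rewrite q_line. unfold ddot, sum_axes. rewrite !strain_plane.
  unfold pl_tau, on_line. fold (line_point x).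
  replace (tau_ M (embed V) k ax0 ax0 t (fun i : axis =>
     match i with ax0 => x | _ => 0 end))
    with (tau_ M (embed V) k ax0 ax0 t (line_point x)) by reflexivity.
  change (Q_ N M (embed V) k t (line_point x)) with
    (sum_other_phases N k (fun j =>
      sig M j k (pl_mix V t x) * (pl_T M V j t x - pl_T M V k t x))).
  change (alpha (embed V) k t (line_point x)) with (pl_alpha V k t x).
  change (I_ (fun k : nat => lift (heat k)) (embed V) k t (line_point x))
    with (pl_alpha V k t x * heat k t x).
  change (line_point x ax0) with x. ring.
Qed.

Let m k t x := pl_alpha V k t x * pl_rho V k t x.
(** The zero products of the transverse velocities are kept, so that the three-dimensional
    expressions reduce to this one by conversion. *)
Let Etot t x := sum_phases N (fun k =>
  m k t x * (energy M k (pl_rho V k t x) (pl_p V t x)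
             + / 2 * (pl_u V t x * pl_u V t x + 0 * 0 + 0 * 0))).
Let taus t x := sum_phases N (fun k => pl_alpha V k t x * pl_tau M V k t x).

Lemma mass_flux_line (k : nat) (t x : R) :
  on_line (mass_flux (embed V) k ax0) t x = m k t x * pl_u V t x.
Proof. reflexivity. Qed.

Lemma momentum_line (t x : R) :
  on_line (momentum N (embed V) ax0) t x
  = sum_phases N (fun k => m k t x) * pl_u V t x.
Proof. reflexivity. Qed.

Lemma momentum_flux_line (t x : R) :
  on_line (momentum_flux N M (embed V) ax0 ax0) t x
  = sum_phases N (fun k => m k t x) * pl_u V t x * pl_u V t x
    - (- pl_p V t x * 1 + taus t x).
Proof. reflexivity. Qed.

Lemma energy_flux_line (t x : R) :
  on_line (energy_flux N M (embed V) ax0) t x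
  = Etot t x * pl_u V t x - (- pl_p V t x * 1 + taus t x) * pl_u V t x.
Proof.
  unfold on_line, energy_flux, sum_axes.
  rewrite (stress_shear ax0 ax1), (stress_shear ax0 ax2) by reflexivity.
  change (Etot t x * pl_u V t x
    - ((- pl_p V t x * 1 + taus t x) * pl_u V t x + 0 * 0 + 0 * 0)
    = Etot t x * pl_u V t x - (- pl_p V t x * 1 + taus t x) * pl_u V t x).
  ring.
Qed.

(** The fluxes across the other two axes vanish identically: the transverse velocities are zero, and
    so are the shear stresses. Only the first axis contributes to each divergence. *)
Lemma plane_model (t x : R) :
  model_at N M (fun k => lift (heat k)) (embed V) t (line_point x) ->
  (forall k, (1 <= k <= N)%nat ->
     Derive (fun s => m k s x) t
     + Derive (fun z => m k t z * pl_u V t z) x = 0)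
  /\ Derive (fun s => sum_phases N (fun k => m k s x) * pl_u V s x) t
     + Derive (fun z => sum_phases N (fun k => m k t z) * pl_u V t z * pl_u V t z
                        - (- pl_p V t z * 1 + taus t z)) x = 0
  /\ Derive (fun s => Etot s x) t
     + Derive (fun z => Etot t z * pl_u V t z
                        - (- pl_p V t z * 1 + taus t z) * pl_u V t z) x
     = sum_phases N (fun k =>
         Derive (fun z => pl_alpha V k t z * pl_fourier M V k t z) x
         + pl_alpha V k t x * heat k t x)
  /\ (forall l, (2 <= l <= N)%nat ->
       Derive (fun s => pl_alpha V l s x) t
       + pl_u V t x * Derive (fun z => pl_alpha V l t z) x
       = volume_source N (fun k => pl_alpha V k t x)
           (fun k => bulk M k (pl_rho V k t x) (pl_p V t x))
           (fun k => Gruneisen M k (pl_rho V k t x) (pl_p V t x))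
           (fun k => G_ N M (fun k => lift (heat k)) (embed V) k t
                       (line_point x))
           (Derive (fun z => pl_u V t z) x) l).
Proof.
  intros (H1 & H2 & H3 & H4). repeat split.
  - intros k Hk. specialize (H1 k Hk).
    unfold divergence, sum_axes in H1.
    assert (E : forall i, axis_eqb i ax0 = false ->
      d_x i (mass_flux (embed V) k i) t (line_point x) = 0).
    { intros i Hi. apply (d_x_const _ _ _ _ 0). intros s.
      unfold mass_flux. destruct i; try discriminate; simpl; ring. }
    rewrite (E ax1), (E ax2), !Rplus_0_r in H1 by reflexivity. exact H1.
  - specialize (H2 ax0). unfold divergence, sum_axes in H2.
    assert (E : forall i, axis_eqb ax0 i = false ->
      d_x i (momentum_flux N M (embed V) ax0 i) t (line_point x) = 0).
    { intros i Hi. apply (d_x_const _ _ _ _ 0). intros s.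
      unfold momentum_flux. rewrite stress_shear by exact Hi.
        destruct i; try discriminate; simpl; ring. }
    rewrite (E ax1), (E ax2), !Rplus_0_r in H2 by reflexivity. exact H2.
  - unfold divergence, sum_axes in H3.
    assert (E : forall i, axis_eqb i ax0 = false ->
      d_x i (energy_flux N M (embed V) i) t (line_point x) = 0).
    { intros i Hi. apply (d_x_const _ _ _ _ 0). intros s.
        unfold energy_flux, sum_axes.
        rewrite (stress_shear i ax0) by exact Hi.
        destruct i; try discriminate; simpl; ring. }
    rewrite (E ax1), (E ax2), !Rplus_0_r in H3 by reflexivity.
    etransitivity; [|etransitivity; [exact H3|]].
    + f_equal. apply Derive_ext. intros z.
      rewrite <- energy_flux_line. reflexivity.
    + apply sum_phases_ext. intros k Hk. rewrite q_line. reflexivity.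
  - intros l Hl. specialize (H4 l Hl). unfold sum_axes in H4.
    assert (E : forall i, axis_eqb i ax0 = false ->
      vel (embed V) i t (line_point x)
      * d_x i (alpha (embed V) l) t (line_point x) = 0).
    { intros i Hi. destruct i; try discriminate; simpl; ring. }
    rewrite (E ax1), (E ax2), !Rplus_0_r in H4 by reflexivity.
    etransitivity; [exact H4|]. unfold F_. rewrite div_u_plane. reflexivity.
Qed.

End PlaneModel.

(** * The balance at a point of the flow *)

Section OneVariable.
Variables (N : nat) (M : material).
Variables (a r tk : nat -> R -> R) (q v : R -> R) (y : R).
Variables (aD rD tD : nat -> R) (qD vD : R).
Hypotheses
  (Ha : forall k, (1 <= k <= N)%nat -> is_derive (a k) y (aD k))
  (Hr : forall k, (1 <= k <= N)%nat -> is_derive (r k) y (rD k))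
  (Hq : is_derive q y qD) (Hv : is_derive v y vD).

Lemma is_derive_partial_mass (k : nat) : (1 <= k <= N)%nat ->
  is_derive (fun z => a k z * r k z) y (aD k * r k y + a k y * rD k).
Proof.
  intros Hk.
  apply (is_derive_mult (K := R_AbsRing) (a k) (r k)); auto.
  intros; apply Rmult_comm.
Qed.

Definition denergy (k : nat) : R :=
  aD k * ((q y + gam M k * pinf M k) / (gam M k - 1) + r k y * w M k)
  + a k y * (qD / (gam M k - 1) + rD k * w M k)
  + / 2 * (aD k * r k y + a k y * rD k) * (v y * v y)
  + a k y * r k y * (v y * vD).

Lemma is_derive_total_energy :
  (forall k, (1 <= k <= N)%nat -> 1 < gam M k) ->
  (forall k, (1 <= k <= N)%nat -> 0 < r k y) ->
  is_derive (fun z => sum_phases N (fun k => a k z * r k z *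
    (energy M k (r k z) (q z) + / 2 * (v z * v z + 0 * 0 + 0 * 0)))) y
    (sum_phases N denergy).
Proof.
  intros Hg Hpos.
  apply (is_derive_sum_phases N (fun k z => a k z * r k z *
    (energy M k (r k z) (q z) + / 2 * (v z * v z + 0 * 0 + 0 * 0)))).
  intros k Hk. specialize (Hg k Hk). specialize (Hpos k Hk).
  assert (Dak := Ha k Hk). assert (Drk := Hr k Hk).
  unfold energy, denergy. auto_derive.
  - repeat split; try (eexists; eassumption); lra.
  - derive_from Dak; derive_from Drk; derive_from Hq; derive_from Hv.
    field. lra.
Qed.

Lemma is_derive_sum_product :
  (forall k, (1 <= k <= N)%nat -> is_derive (tk k) y (tD k)) ->
  is_derive (fun z => sum_phases N (fun k => a k z * tk k z)) y
    (sum_phases N (fun k => aD k * tk k y + a k y * tD k)).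
Proof.
  intros Ht. apply (is_derive_sum_phases N (fun k z => a k z * tk k z)).
  intros k Hk.
  apply (is_derive_mult (K := R_AbsRing) (a k) (tk k)); auto.
  intros; apply Rmult_comm.
Qed.

End OneVariable.

(** At (s, z) the flow agrees with auxiliary functions, later chosen continuously differentiable on
    the whole plane. [TK] and [HF] stand for the viscous stress and for lambda times the temperature
    slope, which the equations differentiate once more. *)
Definition represents (N : nat) (M : material) (V : plane_flow)
    (A Rh TK HF : nat -> R -> R -> R) (U P : R -> R -> R) (s z : R)
    : Prop :=
  pl_u V s z = U s z /\ pl_p V s z = P s z
  /\ forall k, (1 <= k <= N)%nat ->
       pl_alpha V k s z = A k s z /\ pl_rho V k s z = Rh k s z
       /\ pl_tau M V k s z = TK k s z /\ pl_fourier M V k s z = HF k s z.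

Lemma cont_diff_t (f : R -> R -> R) (t x : R) :
  cont_diff f -> is_derive (fun s => f s x) t (Derive (fun s => f s x) t).
Proof. intros H. apply Derive_correct, H. Qed.

Lemma cont_diff_x (f : R -> R -> R) (t x : R) :
  cont_diff f -> is_derive (fun z => f t z) x (Derive (fun z => f t z) x).
Proof. intros H. apply Derive_correct, H. Qed.

Lemma Derive_local_min (f : R -> R) (y : R) :
  ex_derive f y -> locally y (fun z => f y <= f z) -> Derive f y = 0.
Proof.
  intros Hf [e He].
  rewrite <- (Derive_Reals f y (ex_derive_Reals_0 f y Hf)).
  apply (deriv_minimum f (y - e) (y + e) y); try (destruct e; simpl; lra).
  intros z H1 H2. apply He.
  change (Rabs (z - y) < e). apply Rabs_def1; lra.
Qed.

Section AtPoint.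
Variables (N : nat) (M : material) (heat : nat -> R -> R -> R)
  (V : plane_flow).
Variables (A Rh TK HF : nat -> R -> R -> R) (U P : R -> R -> R).
Variables (S : R -> R -> Prop) (t x : R).
Hypotheses (HN : (1 <= N)%nat) (HM : physical_material N M)
  (Hrep : forall s z, S s z -> represents N M V A Rh TK HF U P s z)
  (Hadm : forall s z, S s z -> admissible N M (pl_mix V s z))
  (Hnt : locally t (fun s => S s x)) (Hnx : locally x (fun z => S t z))
  (CA : forall k, (1 <= k <= N)%nat -> cont_diff (A k))
  (CR : forall k, (1 <= k <= N)%nat -> cont_diff (Rh k))
  (CT : forall k, (1 <= k <= N)%nat -> cont_diff (TK k))
  (CH : forall k, (1 <= k <= N)%nat -> cont_diff (HF k))
  (CU : cont_diff U) (CP : cont_diff P)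
  (Hmodel : model_at N M (fun k => lift (heat k)) (embed V) t (line_point x))
  (Hheat : forall k, (1 <= k <= N)%nat -> pl_alpha V k t x * heat k t x = 0).

Let a k := A k t x.
Let r k := Rh k t x.
Let q := P t x.
Let v := U t x.
Let tk k := TK k t x.
Let hf k := HF k t x.
Let aT k := Derive (fun s => A k s x) t.
Let aX k := Derive (fun z => A k t z) x.
Let rT k := Derive (fun s => Rh k s x) t.
Let rX k := Derive (fun z => Rh k t z) x.
Let qT := Derive (fun s => P s x) t.
Let qX := Derive (fun z => P t z) x.
Let vT := Derive (fun s => U s x) t.
Let vX := Derive (fun z => U t z) x.
Let tX k := Derive (fun z => TK k t z) x.
Let hX k := Derive (fun z => HF k t z) x.
Let aD k := aT k + v * aX k.
Let rD k := rT k + v * rX k.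
Let qD := qT + v * qX.
Let vD := vT + v * vX.
Let T k := temp M k (r k) q.
Let sg j k := sig M j k (pl_mix V t x).

Lemma point_in_region : S t x.
Proof. exact (locally_singleton _ _ Hnx). Qed.

Lemma point_gas (k : nat) : (1 <= k <= N)%nat ->
  0 <= a k /\ 0 < r k /\ 0 < q + pinf M k /\ 0 < T k
  /\ 1 < gam M k /\ 0 < Cv M k.
Proof.
  intros Hk. destruct (Hrep _ _ point_in_region) as (_ & EP & Er).
  destruct (Er k Hk) as (Ea & Erk & _).
  destruct (proj1 (Hadm _ _ point_in_region) k Hk) as (H1 & H2 & H3).
  unfold pl_mix in H1, H2, H3; simpl in H1, H2, H3.
  rewrite Ea in H1. rewrite Erk in H2, H3. rewrite EP in H3.
  destruct (proj1 HM k Hk) as [Hg HC].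
  repeat split; auto.
  now apply (temp_pos M k Hg HC (Rh k t x) (P t x)).
Qed.

Lemma sum_region (s z : R) : S s z -> sum_phases N (fun k => A k s z) = 1.
Proof.
  intros H. destruct (Hadm _ _ H) as [_ Hs]. simpl in Hs.
  rewrite <- Hs. apply sum_phases_ext. intros k Hk.
  symmetry. now apply (Hrep _ _ H).
Qed.

(** The extensions sum to 1 throughout a neighbourhood of the point along each axis, so the
    constraint may be differentiated in t and in x. *)
Lemma saturation_rate : sum_phases N aD = 0.
Proof.
  unfold aD. rewrite sum_phases_plus, sum_phases_scal.
  assert (E1 : sum_phases N aT = 0).
  { rewrite <- (is_derive_unique (fun s => sum_phases N (fun k => A k s x)) t
                  (sum_phases N aT)).
    - rewrite (Derive_ext_loc _ (fun _ => 1)); [apply Derive_const|].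
      refine (filter_imp _ _ _ Hnt). intros s Hs. now apply sum_region.
    - apply (is_derive_sum_phases N (fun k s => A k s x)).
      intros k Hk. now apply cont_diff_t, CA. }
  assert (E2 : sum_phases N aX = 0).
  { rewrite <- (is_derive_unique (fun z => sum_phases N (fun k => A k t z)) x
                  (sum_phases N aX)).
    - rewrite (Derive_ext_loc _ (fun _ => 1)); [apply Derive_const|].
      refine (filter_imp _ _ _ Hnx). intros z Hz. now apply sum_region.
    - apply (is_derive_sum_phases N (fun k z => A k t z)).
      intros k Hk. now apply cont_diff_x, CA. }
  rewrite E1, E2. ring.
Qed.

(** Moves a derivative from the flow to its smooth representative; agreement on the neighbourhood
    [Q] suffices. *)
Lemma Derive_near (f g : R -> R) (y l : R) (Q : R -> Prop) :
  locally y Q -> (forall z, Q z -> f z = g z) -> is_derive g y l ->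
  Derive f y = l.
Proof.
  intros HQ Heq Hg. rewrite (Derive_ext_loc f g).
  - now apply is_derive_unique.
  - refine (filter_imp _ _ _ HQ). exact Heq.
Qed.

Lemma point_mass (k : nat) : (1 <= k <= N)%nat ->
  a k * rD k + r k * aD k + a k * r k * vX = 0.
Proof.
  intros Hk. destruct (plane_model N M heat V t x Hmodel) as (H1 & _).
  specialize (H1 k Hk).
  rewrite (Derive_near _ (fun s => A k s x * Rh k s x) t
    (aT k * r k + a k * rT k) _ Hnt) in H1.
  2: { intros s Hs. destruct (Hrep _ _ Hs) as (_ & _ & E).
       now destruct (E k Hk) as (-> & -> & _). }
  2: { apply (is_derive_partial_mass N (fun k s => A k s x) (fun k s => Rh k s x));
         auto; intros; apply cont_diff_t; auto. }
  rewrite (Derive_near _ (fun z => A k t z * Rh k t z * U t z) x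
    ((aX k * r k + a k * rX k) * v + a k * r k * vX) _ Hnx) in H1.
  2: { intros z Hz. destruct (Hrep _ _ Hz) as (-> & _ & E).
       now destruct (E k Hk) as (-> & -> & _). }
  2: { apply (is_derive_mult (K := R_AbsRing) (fun z => A k t z * Rh k t z)
         (fun z => U t z)).
       - apply (is_derive_partial_mass N (fun k z => A k t z)
                  (fun k z => Rh k t z)); auto; intros; apply cont_diff_x; auto.
       - now apply cont_diff_x.
       - intros; apply Rmult_comm. }
  rewrite <- H1. unfold rD, aD. ring.
Qed.

Lemma sum_region_mass (s z : R) : S s z ->
  sum_phases N (fun k => pl_alpha V k s z * pl_rho V k s z)
  = sum_phases N (fun k => A k s z * Rh k s z).
Proof.
  intros H. destruct (Hrep _ _ H) as (_ & _ & E). apply sum_phases_ext.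
  intros k Hk. now destruct (E k Hk) as (-> & -> & _).
Qed.

Lemma sum_region_viscous (s z : R) : S s z ->
  sum_phases N (fun k => pl_alpha V k s z * pl_tau M V k s z)
  = sum_phases N (fun k => A k s z * TK k s z).
Proof.
  intros H. destruct (Hrep _ _ H) as (_ & _ & E). apply sum_phases_ext.
  intros k Hk. now destruct (E k Hk) as (-> & _ & -> & _).
Qed.

Lemma sum_region_energy (s z : R) : S s z ->
  sum_phases N (fun k => pl_alpha V k s z * pl_rho V k s z *
    (energy M k (pl_rho V k s z) (pl_p V s z)
     + / 2 * (pl_u V s z * pl_u V s z + 0 * 0 + 0 * 0)))
  = sum_phases N (fun k => A k s z * Rh k s z *
    (energy M k (Rh k s z) (P s z)
     + / 2 * (U s z * U s z + 0 * 0 + 0 * 0))).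
Proof.
  intros H. destruct (Hrep _ _ H) as (Eu & Ep & E). apply sum_phases_ext.
  intros k Hk. destruct (E k Hk) as (-> & -> & _). now rewrite Eu, Ep.
Qed.

Let dmT := sum_phases N (fun k => aT k * r k + a k * rT k).
Let dmX := sum_phases N (fun k => aX k * r k + a k * rX k).
Let mm := sum_phases N (fun k => a k * r k).
Let ta := sum_phases N (fun k => a k * tk k).
Let taX := sum_phases N (fun k => aX k * tk k + a k * tX k).

Lemma derive_mass_t :
  is_derive (fun s => sum_phases N (fun k => A k s x * Rh k s x)) t dmT.
Proof.
  apply (is_derive_sum_product N (fun k s => A k s x) (fun k s => Rh k s x) t aT rT);
    intros; apply cont_diff_t; auto.
Qed.

Lemma derive_mass_x :
  is_derive (fun z => sum_phases N (fun k => A k t z * Rh k t z)) x dmX.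
Proof.
  apply (is_derive_sum_product N (fun k z => A k t z) (fun k z => Rh k t z) x aX rX);
    intros; apply cont_diff_x; auto.
Qed.

Lemma derive_viscous_x :
  is_derive (fun z => sum_phases N (fun k => A k t z * TK k t z)) x taX.
Proof.
  apply (is_derive_sum_product N (fun k z => A k t z) (fun k z => TK k t z) x aX tX);
    intros; apply cont_diff_x; auto.
Qed.

Lemma mass_balance : dmT + dmX * v + mm * vX = 0.
Proof.
  unfold dmT, dmX, mm. rewrite <- !sum_phases_scal_r, <- !sum_phases_plus.
  apply sum_phases_zero. intros k Hk. rewrite <- (point_mass k Hk).
  unfold rD, aD. ring.
Qed.

Lemma point_momentum : mm * vD = - qX + taX.
Proof.
  destruct (plane_model N M heat V t x Hmodel) as (_ & H2 & _).
  rewrite (Derive_near _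
    (fun s => sum_phases N (fun k => A k s x * Rh k s x) * U s x) t
    (dmT * v + mm * vT) _ Hnt) in H2.
  2: { intros s Hs. rewrite sum_region_mass by exact Hs.
       now destruct (Hrep _ _ Hs) as (-> & _). }
  2: { apply (is_derive_mult (K := R_AbsRing)
         (fun s => sum_phases N (fun k => A k s x * Rh k s x)) (fun s => U s x)).
       - apply derive_mass_t.
       - now apply cont_diff_t.
       - intros; apply Rmult_comm. }
  rewrite (Derive_near _
    (fun z => sum_phases N (fun k => A k t z * Rh k t z) * U t z * U t z
      - (- P t z * 1 + sum_phases N (fun k => A k t z * TK k t z))) x
    (dmX * v * v + 2 * mm * v * vX + qX - taX) _ Hnx) in H2.
  2: { intros z Hz. rewrite sum_region_mass, sum_region_viscous by exact Hz.
       now destruct (Hrep _ _ Hz) as (-> & -> & _). }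
  2: { assert (Hgen : forall S1 S2 : R -> R,
         is_derive S1 x dmX -> is_derive S2 x taX ->
         is_derive (fun z => S1 z * U t z * U t z - (- P t z * 1 + S2 z)) x
           (dmX * v * v + 2 * S1 x * v * vX + qX - taX)).
       { intros S1 S2 D1 D2.
         assert (DU := cont_diff_x U t x CU).
         assert (DP := cont_diff_x P t x CP).
         auto_derive.
         - repeat split; eexists; eassumption.
         - derive_from D1; derive_from D2. fold vX qX. unfold v. ring. }
       exact (Hgen _ _ derive_mass_x derive_viscous_x). }
  (* Subtracting v times the mass balance from the conservative equation leaves mass times
     acceleration. *)
  pose proof mass_balance as Hb. unfold vD.
  replace (dmX * v) with (- dmT - mm * vX) in H2 by lra. lra.
Qed.

Lemma point_energy :
  sum_phases N (heating a (fun k => gam M k * (q + pinf M k))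
                  (fun k => gam M k - 1) aD qD vX)
  = sum_phases N (fun k => aX k * hf k + a k * hX k) + ta * vX.
Proof.
  destruct (plane_model N M heat V t x Hmodel) as (_ & _ & H3 & _).
  assert (Hg : forall k, (1 <= k <= N)%nat -> 1 < gam M k)
    by (intros k Hk; apply (proj1 HM k Hk)).
  assert (Hr : forall k, (1 <= k <= N)%nat -> 0 < Rh k t x)
    by (intros k Hk; apply (point_gas k Hk)).
  assert (DET : is_derive (fun s => sum_phases N (fun k => A k s x * Rh k s x *
    (energy M k (Rh k s x) (P s x)
     + / 2 * (U s x * U s x + 0 * 0 + 0 * 0)))) t
    (sum_phases N (denergy M (fun k s => A k s x) (fun k s => Rh k s x)
       (fun s => P s x) (fun s => U s x) t aT rT qT vT))).
  { apply (is_derive_total_energy N M (fun k s => A k s x)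
      (fun k s => Rh k s x) (fun s => P s x) (fun s => U s x)); auto;
      intros; apply cont_diff_t; auto. }
  assert (DEX : is_derive (fun z => sum_phases N (fun k => A k t z * Rh k t z *
    (energy M k (Rh k t z) (P t z)
     + / 2 * (U t z * U t z + 0 * 0 + 0 * 0)))) x
    (sum_phases N (denergy M (fun k z => A k t z) (fun k z => Rh k t z)
       (fun z => P t z) (fun z => U t z) x aX rX qX vX))).
  { apply (is_derive_total_energy N M (fun k z => A k t z)
      (fun k z => Rh k t z) (fun z => P t z) (fun z => U t z)); auto;
      intros; apply cont_diff_x; auto. }
  set (eT := sum_phases N (denergy M (fun k s => A k s x) _ _ _ _ _ _ _ _))
    in DET.
  set (eX := sum_phases N (denergy M (fun k z => A k t z) _ _ _ _ _ _ _ _))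
    in DEX.
  rewrite (Derive_near _ _ t eT _ Hnt
    (fun s Hs => sum_region_energy s x Hs) DET) in H3.
  set (E0 := sum_phases N (fun k => A k t x * Rh k t x *
    (energy M k (Rh k t x) (P t x)
     + / 2 * (U t x * U t x + 0 * 0 + 0 * 0)))).
  rewrite (Derive_near _
    (fun z => sum_phases N (fun k => A k t z * Rh k t z *
      (energy M k (Rh k t z) (P t z)
       + / 2 * (U t z * U t z + 0 * 0 + 0 * 0))) * U t z
      - (- P t z * 1 + sum_phases N (fun k => A k t z * TK k t z)) * U t z) x
    (eX * v + E0 * vX - (- qX + taX) * v - (- q + ta) * vX) _ Hnx) in H3.
  2: { intros z Hz. rewrite sum_region_energy, sum_region_viscous by exact Hz.
       now destruct (Hrep _ _ Hz) as (-> & -> & _). }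
  2: { assert (Hgen : forall S1 S2 : R -> R,
         is_derive S1 x eX -> is_derive S2 x taX ->
         is_derive (fun z => S1 z * U t z - (- P t z * 1 + S2 z) * U t z) x
           (eX * v + S1 x * vX - (- qX + taX) * v - (- q + S2 x) * vX)).
       { intros S1 S2 D1 D2.
         assert (DU := cont_diff_x U t x CU).
         assert (DP := cont_diff_x P t x CP).
         auto_derive.
         - repeat split; eexists; eassumption.
         - derive_from D1; derive_from D2. fold vX qX. unfold v, q. ring. }
       exact (Hgen _ _ DEX derive_viscous_x). }
  rewrite (sum_phases_ext N _ (fun k => aX k * hf k + a k * hX k)) in H3.
  2: { intros k Hk. rewrite Hheat, Rplus_0_r by exact Hk.
       apply (Derive_near _ (fun z => A k t z * HF k t z) x _ _ Hnx).
       - intros z Hz. destruct (Hrep _ _ Hz) as (_ & _ & E).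
         now destruct (E k Hk) as (-> & _ & _ & ->).
       - apply (is_derive_partial_mass N (fun k z => A k t z)
                  (fun k z => HF k t z)); auto; intros; apply cont_diff_x; auto. }
  rewrite <- H3.
  (* The total energy balance in material form. Phase by phase it is [heating] minus pressure work
     plus the power of the acceleration; saturation collapses the total pressure work to q * vX. *)
  assert (Hkey : eT + eX * v + E0 * vX
    = sum_phases N (heating a (fun k => gam M k * (q + pinf M k))
                  (fun k => gam M k - 1) aD qD vX)
      - q * vX + mm * vD * v).
  { unfold eT, eX, E0, mm.
    rewrite <- !sum_phases_scal_r, <- !sum_phases_plus.
    transitivity (sum_phases N (fun k =>
      heating a (fun k => gam M k * (q + pinf M k))
                  (fun k => gam M k - 1) aD qD vX k
      - q * (aD k + a k * vX) + a k * r k * vD * v)).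
    - apply sum_phases_ext. intros k Hk.
      destruct (point_gas k Hk) as (_ & Hrk & Hqk & _ & Hgk & HCk).
      apply Rminus_diag_uniq.
      (* The two forms differ by the mass balance of phase k times the energy per unit mass w +
         v^2/2 that is simply carried along. *)
      transitivity ((a k * rD k + r k * aD k + a k * r k * vX)
                    * (w M k + / 2 * (v * v)));
        [|rewrite (point_mass k Hk); ring].
      unfold denergy, heating, energy, rD, aD, qD, vD.
      unfold a, r, q, v in *. cbv beta. field. repeat split; lra.
    - rewrite sum_phases_plus, sum_phases_minus, sum_phases_scal,
        sum_phases_plus, saturation_rate, !sum_phases_scal_r.
      replace (sum_phases N a) with 1
        by (symmetry; exact (sum_region t x point_in_region)).
      ring. }
  pose proof point_momentum as Hm. rewrite Hm in Hkey. lra.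
Qed.

Let Q k := sum_other_phases N k (fun j => sg j k * (T j - T k)).
Let G k := a k * (tk k * vX) + Q k + (aX k * hf k + a k * hX k).

Lemma point_exchange_symmetric (j k : nat) :
  (1 <= j <= N)%nat -> (1 <= k <= N)%nat -> j <> k ->
  sg j k = sg k j /\ 0 < sg j k.
Proof.
  intros Hj Hk Hn.
  apply (proj2 (proj2 HM _ (Hadm _ _ point_in_region))); auto.
Qed.

Lemma pl_u_slope : Derive (fun z => pl_u V t z) x = vX.
Proof.
  apply (Derive_near _ (fun z => U t z) x _ _ Hnx).
  - intros z Hz. apply (Hrep _ _ Hz).
  - now apply cont_diff_x.
Qed.

Lemma point_G (k : nat) : (1 <= k <= N)%nat ->
  G_ N M (fun k => lift (heat k)) (embed V) k t (line_point x) = G k.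
Proof.
  intros Hk. rewrite G_line, Hheat, pl_u_slope by exact Hk.
  destruct (Hrep _ _ point_in_region) as (_ & Ep & E).
  unfold pl_T. rewrite Ep. unfold G, Q.
  rewrite (Derive_near _ (fun z => A k t z * HF k t z) x
    (aX k * hf k + a k * hX k) _ Hnx).
  - destruct (E k Hk) as (-> & Er & -> & _). rewrite Rplus_0_r.
    f_equal. f_equal. apply sum_phases_ext. intros j Hj.
    destruct (E j Hj) as (_ & Erj & _). now rewrite Er, Erj.
  - intros z Hz. destruct (Hrep _ _ Hz) as (_ & _ & E').
    now destruct (E' k Hk) as (-> & _ & _ & ->).
  - apply (is_derive_partial_mass N (fun k z => A k t z)
      (fun k z => HF k t z)); auto; intros; apply cont_diff_x; auto.
Qed.

Lemma point_heating (k : nat) : (1 <= k <= N)%nat ->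
  heating a (fun k => gam M k * (q + pinf M k)) (fun k => gam M k - 1)
    aD qD vX k = G k.
Proof.
  intros Hk.
  destruct (plane_model N M heat V t x Hmodel) as (_ & _ & _ & H4).
  destruct (Hrep _ _ point_in_region) as (Eu & Ep & E).
  set (al := fun k => pl_alpha V k t x) in H4.
  set (bu := fun k => bulk M k (pl_rho V k t x) (pl_p V t x)) in H4.
  set (gr := fun k => Gruneisen M k (pl_rho V k t x) (pl_p V t x)) in H4.
  set (GG := fun k => G_ N M (fun k => lift (heat k)) (embed V) k t
                        (line_point x)) in H4.
  rewrite pl_u_slope in H4.
  assert (Eal : forall k, (1 <= k <= N)%nat -> al k = a k)
    by (intros; now apply E).
  assert (Ebu : forall k, (1 <= k <= N)%nat ->
    bu k = gam M k * (q + pinf M k)).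
  { intros j Hj. destruct (point_gas j Hj) as (_&?&?&_&?&?). unfold bu.
    destruct (E j Hj) as (_ & -> & _). rewrite Ep. now apply bulk_eq. }
  assert (Egr : forall k, (1 <= k <= N)%nat -> gr k = gam M k - 1).
  { intros j Hj. destruct (point_gas j Hj) as (_&?&?&_&?&?). unfold gr.
    destruct (E j Hj) as (_ & -> & _). rewrite Ep. now apply Gruneisen_eq. }
  assert (Eh : forall k, (1 <= k <= N)%nat ->
    heating al bu gr aD qD vX k
    = heating a (fun k => gam M k * (q + pinf M k)) (fun k => gam M k - 1)
        aD qD vX k).
  { intros j Hj. unfold heating. now rewrite Eal, Ebu, Egr. }
  rewrite <- Eh, <- point_G by exact Hk.
  apply (heating_eq N al bu gr GG aD qD vX); auto.
  - intros j Hj. rewrite Eal by auto. apply (point_gas j Hj).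
  - rewrite (sum_phases_ext _ _ _ Eal). exact (sum_region t x point_in_region).
  - intros j Hj. rewrite Ebu by auto.
    destruct (point_gas j Hj) as (_&?&?&_&?&?).
    apply Rmult_lt_0_compat; lra.
  - intros j Hj. rewrite Egr by auto. destruct (point_gas j Hj). lra.
  - exact saturation_rate.
  - intros l Hl. rewrite <- H4 by exact Hl. unfold aD.
    assert (Hl' : (1 <= l <= N)%nat) by lia.
    rewrite Eu. f_equal; [|f_equal]; symmetry.
    + apply (Derive_near _ (fun s => A l s x) t _ _ Hnt).
      * intros s Hs. now apply (Hrep _ _ Hs).
      * now apply cont_diff_t, CA.
    + apply (Derive_near _ (fun z => A l t z) x _ _ Hnx).
      * intros z Hz. now apply (Hrep _ _ Hz).
      * now apply cont_diff_x, CA.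
  - rewrite (sum_phases_ext _ _ _ Eh), point_energy.
    rewrite (sum_phases_ext N GG G) by exact point_G.
    unfold G. rewrite !sum_phases_plus.
    (* The total energy equation contains no relaxation terms, whereas each G k does; the totals
       agree because the relaxation heats cancel. *)
    replace (sum_phases N Q) with 0
      by (symmetry; apply relaxation_sum_zero;
          intros; now apply point_exchange_symmetric).
    unfold ta. rewrite <- sum_phases_scal_r.
    rewrite (sum_phases_ext N (fun k => a k * (tk k * vX))
               (fun k => a k * tk k * vX)) by (intros; ring).
    ring.
Qed.

(** A zero of the nonnegative fraction is a minimum in t and in x, so both its derivatives vanish
    there. Then [heating] is zero, and every term of G k except the relaxation heat disappears. *)
Lemma point_absent (k : nat) : (1 <= k <= N)%nat -> a k = 0 -> Q k = 0.
Proof.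
  intros Hk Hak.
  assert (Hge : forall s z, S s z -> 0 <= A k s z).
  { intros s z H. destruct (Hrep _ _ H) as (_ & _ & E).
    destruct (E k Hk) as (<- & _).
    apply (proj1 (Hadm _ _ H) k Hk). }
  assert (ET : aT k = 0).
  { apply (Derive_local_min (fun s => A k s x)).
    - apply CA, Hk.
    - refine (filter_imp _ _ _ Hnt). intros s Hs. cbv beta.
      change (A k t x) with (a k). rewrite Hak. now apply Hge. }
  assert (EX : aX k = 0).
  { apply (Derive_local_min (fun z => A k t z)).
    - apply CA, Hk.
    - refine (filter_imp _ _ _ Hnx). intros z Hz. cbv beta.
      change (A k t x) with (a k). rewrite Hak. now apply Hge. }
  pose proof (point_heating k Hk) as H. unfold heating, G, aD in H.
  rewrite ET, EX, Hak in H. unfold Rdiv in H. lra.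
Qed.

Lemma point_temp_slope (k : nat) : (1 <= k <= N)%nat ->
  Derive (fun z => pl_T M V k t z) x = dtemp M k (r k) q (rX k) qX.
Proof.
  intros Hk. destruct (point_gas k Hk) as (_&?&?&_&?&?).
  apply (Derive_near _ (fun z => temp M k (Rh k t z) (P t z)) x _ _ Hnx).
  - intros z Hz. destruct (Hrep _ _ Hz) as (_ & Ep & E). unfold pl_T.
    destruct (E k Hk) as (_ & -> & _). now rewrite Ep.
  - apply (is_derive_temp N M (proj1 HM) k (fun z => Rh k t z) (fun z => P t z));
      auto; apply cont_diff_x; auto.
Qed.

Lemma point_dissipation (rh : nat -> R) (u0 p0 T0 : R) (L : R -> R) :
  0 <= T0 ->
  dtotal_avail N M rh u0 p0 T0 L a r q v aT rT qT vT
  + davail_flux N M rh u0 p0 T0 L a r q v tk hf 0 aX rX qX vX tX hX <= 0.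
Proof.
  intros HT0.
  destruct (Hrep _ _ point_in_region) as (_ & _ & E).
  apply availability_dissipates with sg; auto.
  - exact (proj1 HM).
  - intros k Hk; apply (point_gas k Hk).
  - exact saturation_rate.
  - intros k Hk; apply (point_gas k Hk).
  - intros k Hk; apply (point_gas k Hk).
  - exact (sum_region t x point_in_region).
  - exact point_mass.
  - exact point_momentum.
  - exact point_heating.
  - exact point_exchange_symmetric.
  - intros k Hk. unfold tk. destruct (E k Hk) as (_ & _ & <- & _).
    rewrite pl_tau_eq, pl_u_slope.
    destruct (proj1 (proj2 HM _ (Hadm _ _ point_in_region)) k Hk)
      as (Hmu & Hmub & _).
    rewrite Rmult_assoc. apply Rmult_le_pos; [lra | apply Rle_0_sqr].
  - intros k Hk. unfold hf. destruct (E k Hk) as (_ & _ & _ & <-).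
    rewrite pl_fourier_eq, point_temp_slope by exact Hk.
    destruct (proj1 (proj2 HM _ (Hadm _ _ point_in_region)) k Hk)
      as (_ & _ & Hlam).
    rewrite Rmult_assoc. apply Rmult_le_pos; [exact Hlam | apply Rle_0_sqr].
Qed.

End AtPoint.

(** * Calculus on moving strips *)

Lemma cont_diff_intro (f ft fx : R -> R -> R) :
  (forall t x, is_derive (fun s => f s x) t (ft t x)) ->
  (forall t x, is_derive (fun y => f t y) x (fx t x)) ->
  (forall t x, continuity_2d_pt ft t x) ->
  (forall t x, continuity_2d_pt fx t x) -> cont_diff f.
Proof.
  intros H1 H2 H3 H4 t x. repeat split.
  - eexists; apply H1.
  - eexists; apply H2.
  - apply continuity_2d_pt_ext with ft; auto.
    intros; symmetry; now apply is_derive_unique.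
  - apply continuity_2d_pt_ext with fx; auto.
    intros; symmetry; now apply is_derive_unique.
Qed.

(** Joint differentiability, from the continuity of the time derivative; the chain rule along the
    moving curve needs it. *)
Lemma cont_diff_differentiable (f : R -> R -> R) (t x : R) :
  cont_diff f ->
  differentiable_pt_lim f t x (Derive (fun s => f s x) t)
                              (Derive (fun y => f t y) x).
Proof.
  intros H. apply filterdiff_differentiable_pt_lim.
  apply (is_derive_filterdiff f t x (fun t x => Derive (fun s => f s x) t)).
  - apply filter_forall. intros u. exact (cont_diff_t f (fst u) (snd u) H).
  - exact (cont_diff_x f t x H).
  - apply (proj1 (continuity_2d_pt_filterlim
      (fun t x => Derive (fun s => f s x) t) t x)), H.
Qed.

Lemma cont_diff_continuous (f : R -> R -> R) (t x : R) :
  cont_diff f -> continuity_2d_pt f t x.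
Proof.
  intros H. apply differentiable_continuity_pt.
  do 2 eexists. now apply cont_diff_differentiable.
Qed.

Lemma cont_diff_const (c : R) : cont_diff (fun _ _ => c).
Proof.
  apply (cont_diff_intro _ (fun _ _ => 0) (fun _ _ => 0));
    intros; try apply continuity_2d_pt_const;
    apply (is_derive_const (K := R_AbsRing) c).
Qed.

Lemma cont_diff_plus (f g : R -> R -> R) :
  cont_diff f -> cont_diff g -> cont_diff (fun t x => f t x + g t x).
Proof.
  intros Hf Hg.
  apply (cont_diff_intro _
    (fun t x => Derive (fun s => f s x) t + Derive (fun s => g s x) t)
    (fun t x => Derive (fun y => f t y) x + Derive (fun y => g t y) x));
    intros t x.
  - apply (is_derive_plus (K := R_AbsRing) (fun s => f s x) (fun s => g s x));
      now apply cont_diff_t.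
  - apply (is_derive_plus (K := R_AbsRing) (fun y => f t y) (fun y => g t y));
      now apply cont_diff_x.
  - apply continuity_2d_pt_plus; [apply Hf | apply Hg].
  - apply continuity_2d_pt_plus; [apply Hf | apply Hg].
Qed.

Lemma cont_diff_mult (f g : R -> R -> R) :
  cont_diff f -> cont_diff g -> cont_diff (fun t x => f t x * g t x).
Proof.
  intros Hf Hg.
  apply (cont_diff_intro _
    (fun t x => Derive (fun s => f s x) t * g t x
                + f t x * Derive (fun s => g s x) t)
    (fun t x => Derive (fun y => f t y) x * g t x
                + f t x * Derive (fun y => g t y) x));
    intros t x.
  - apply (is_derive_mult (K := R_AbsRing) (fun s => f s x) (fun s => g s x));
      [now apply cont_diff_t | now apply cont_diff_t | intros; apply Rmult_comm].
  - apply (is_derive_mult (K := R_AbsRing) (fun y => f t y) (fun y => g t y));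
      [now apply cont_diff_x | now apply cont_diff_x | intros; apply Rmult_comm].
  - apply continuity_2d_pt_plus; apply continuity_2d_pt_mult;
      try (now apply cont_diff_continuous); [apply Hf | apply Hg].
  - apply continuity_2d_pt_plus; apply continuity_2d_pt_mult;
      try (now apply cont_diff_continuous); [apply Hf | apply Hg].
Qed.

Lemma cont_diff_ext (f g : R -> R -> R) :
  (forall t x, f t x = g t x) -> cont_diff f -> cont_diff g.
Proof.
  intros E H.
  apply (cont_diff_intro _ (fun t x => Derive (fun s => f s x) t)
                           (fun t x => Derive (fun y => f t y) x));
    intros t x; try apply H.
  - apply is_derive_ext with (fun s => f s x); auto. now apply cont_diff_t.
  - apply is_derive_ext with (fun y => f t y); auto. now apply cont_diff_x.
Qed.

Lemma cont_diff_minus (f g : R -> R -> R) :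
  cont_diff f -> cont_diff g -> cont_diff (fun t x => f t x - g t x).
Proof.
  intros Hf Hg.
  apply cont_diff_ext with (fun t x => f t x + (-1) * g t x);
    [intros; ring|].
  apply cont_diff_plus; auto. apply cont_diff_mult; auto. apply cont_diff_const.
Qed.

Lemma cont_diff_opp (f : R -> R -> R) :
  cont_diff f -> cont_diff (fun t x => - f t x).
Proof.
  intros Hf. apply cont_diff_ext with (fun t x => 0 - f t x); [intros; ring|].
  apply cont_diff_minus; auto. apply cont_diff_const.
Qed.

Lemma cont_diff_sum (N : nat) (f : nat -> R -> R -> R) :
  (forall k, (1 <= k <= N)%nat -> cont_diff (f k)) ->
  cont_diff (fun t x => sum_phases N (fun k => f k t x)).
Proof.
  induction N as [|N IH]; intros H.
  - apply cont_diff_ext with (fun _ _ => 0);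
      [intros; now rewrite sum_phases_0 | apply cont_diff_const].
  - apply cont_diff_ext with
      (fun t x => sum_phases N (fun k => f k t x) + f (S N) t x);
      [intros; now rewrite sum_phases_S|].
    apply cont_diff_plus; [apply IH; intros|]; apply H; lia.
Qed.

Lemma cont_diff_comp (L dL : R -> R) (f : R -> R -> R) :
  (forall z, is_derive L z (dL z)) -> (forall z, continuous dL z) ->
  cont_diff f -> cont_diff (fun t x => L (f t x)).
Proof.
  intros HL HdL Hf.
  apply (cont_diff_intro _
    (fun t x => Derive (fun s => f s x) t * dL (f t x))
    (fun t x => Derive (fun y => f t y) x * dL (f t x))); intros t x.
  - apply (is_derive_comp L (fun s => f s x)); auto. now apply cont_diff_t.
  - apply (is_derive_comp L (fun y => f t y)); auto. now apply cont_diff_x.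
  - apply continuity_2d_pt_mult; [apply Hf|].
    apply continuity_1d_2d_pt_comp; [|now apply cont_diff_continuous].
    apply continuity_pt_filterlim, HdL.
  - apply continuity_2d_pt_mult; [apply Hf|].
    apply continuity_1d_2d_pt_comp; [|now apply cont_diff_continuous].
    apply continuity_pt_filterlim, HdL.
Qed.

Lemma continuity_2d_pt_shift (f : R -> R -> R) (xi : R -> R) (t y : R) :
  continuity_2d_pt f t (xi t + y) -> continuous xi t ->
  continuity_2d_pt (fun s z => f s (xi s + z)) t y.
Proof.
  intros Hf Hxi. apply continuity_2d_pt_filterlim.
  apply continuity_2d_pt_filterlim in Hf.
  change (continuous (fun z : R * R => f (fst z) (xi (fst z) + snd z)) (t, y)).
  apply (continuous_comp_2 (fun z : R * R => fst z)
           (fun z : R * R => xi (fst z) + snd z) f).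
  - apply continuous_fst.
  - apply (continuous_plus (K := R_AbsRing) (V := R_NormedModule)
             (fun z : R * R => xi (fst z)) (fun z : R * R => snd z)).
    + apply (continuous_comp (fun z : R * R => fst z) xi); auto.
      apply continuous_fst.
    + apply continuous_snd.
  - exact Hf.
Qed.

(** * The frame attached to the curve *)

Section MovingFrame.
Variables (f : R -> R -> R) (xi : R -> R).
Hypotheses (Hf : cont_diff f)
  (Hxi : forall t, ex_derive xi t /\ continuous (Derive xi) t).

(** The extra term with the speed of the curve is what turns the flux in the rest frame into the
    flux relative to the curve. *)
Lemma is_derive_moving_t (t y : R) :
  is_derive (fun s => f s (xi s + y)) t
    (Derive (fun s => f s (xi t + y)) t
     + Derive xi t * Derive (fun z => f t z) (xi t + y)).
Proof.
  apply is_derive_Reals.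
  replace (Derive (fun s => f s (xi t + y)) t
     + Derive xi t * Derive (fun z => f t z) (xi t + y)) with
    (Derive (fun s => f s (xi t + y)) t * 1
     + Derive (fun z => f t z) (xi t + y) * Derive xi t) by ring.
  apply (derivable_pt_lim_comp_2d f (fun s => s) (fun s => xi s + y)).
  - now apply cont_diff_differentiable.
  - apply derivable_pt_lim_id.
  - apply is_derive_Reals.
    replace (Derive xi t) with (plus (Derive xi t) 0)
      by (unfold plus; simpl; ring).
    apply (is_derive_plus (K := R_AbsRing) xi (fun _ => y)).
    + apply Derive_correct, Hxi.
    + apply (is_derive_const (K := R_AbsRing) y).
Qed.

Lemma is_derive_moving_y (g : R -> R) (c y : R) (l : R) :
  is_derive g (c + y) l -> is_derive (fun z => g (c + z)) y l.
Proof.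
  intros H. replace l with (scal 1 l) by (unfold scal; simpl; unfold mult; simpl; ring).
  apply (is_derive_comp g (fun z => c + z)); auto.
  auto_derive; auto.
Qed.

Lemma cont_diff_moving : cont_diff (fun t y => f t (xi t + y)).
Proof.
  apply (cont_diff_intro _
    (fun t y => Derive (fun s => f s (xi t + y)) t
       + Derive xi t * Derive (fun z => f t z) (xi t + y))
    (fun t y => Derive (fun z => f t z) (xi t + y))); intros t y.
  - apply is_derive_moving_t.
  - apply is_derive_moving_y. now apply cont_diff_x.
  - assert (Hc : continuous xi t).
    { apply (ex_derive_continuous (K := R_AbsRing) (V := R_NormedModule)), Hxi. }
    apply continuity_2d_pt_plus; [|apply continuity_2d_pt_mult].
    + apply (continuity_2d_pt_shift (fun t x => Derive (fun s => f s x) t));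
        auto. apply Hf.
    + apply (continuity_1d_2d_pt_comp (Derive xi) (fun s _ => s)).
      * apply continuity_pt_filterlim, Hxi.
      * apply continuity_2d_pt_id1.
    + apply (continuity_2d_pt_shift (fun t x => Derive (fun y => f t y) x));
        auto. apply Hf.
  - assert (Hc : continuous xi t).
    { apply (ex_derive_continuous (K := R_AbsRing) (V := R_NormedModule)), Hxi. }
    apply (continuity_2d_pt_shift (fun t x => Derive (fun y => f t y) x));
      auto. apply Hf.
Qed.

End MovingFrame.

(* A continuously differentiable function on the whole line that agrees with
   [ln] on [[d, oo)]. *)
Definition ln_ext (d z : R) : R := ln d + RInt (fun s => / Rmax d s) d z.

Section LnExt.
Variable d : R.
Hypothesis Hd : 0 < d.

Lemma continuous_inv_Rmax (z : R) : continuous (fun s => / Rmax d s) z.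
Proof.
  apply continuous_comp with (f := fun s => Rmax d s) (g := Rinv).
  - apply continuity_pt_filterlim.
    apply (continuity_pt_ext (fun s => (d + s + Rabs (d - s)) / 2)).
    { intros s. unfold Rmax, Rabs.
      destruct (Rle_dec d s), (Rcase_abs (d - s)); lra. }
    unfold Rdiv. apply continuity_pt_mult; [|apply continuity_pt_const; easy].
    apply continuity_pt_plus.
    + apply continuity_pt_plus; [apply continuity_pt_const; easy|].
      apply continuity_pt_id.
    + apply (continuity_pt_comp (fun s => d - s) Rabs).
      * apply continuity_pt_minus; [apply continuity_pt_const; easy|].
        apply continuity_pt_id.
      * apply Rcontinuity_abs.
  - apply continuity_pt_filterlim. apply continuity_pt_inv.
    + apply continuity_pt_id.
    + pose proof (Rmax_l d z). unfold id. lra.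
Qed.

Lemma is_derive_ln_ext (z : R) : is_derive (ln_ext d) z (/ Rmax d z).
Proof.
  unfold ln_ext.
  replace (/ Rmax d z) with (plus 0 (/ Rmax d z))
    by (unfold plus; simpl; ring).
  apply (is_derive_plus (K := R_AbsRing) (fun _ => ln d)).
  - apply (is_derive_const (K := R_AbsRing) (ln d)).
  - apply (is_derive_RInt (V := R_NormedModule) (fun s => / Rmax d s) _ d).
    + apply filter_forall. intros y. apply (RInt_correct (V := R_CompleteNormedModule)).
      apply (ex_RInt_continuous (V := R_CompleteNormedModule)).
      intros; apply continuous_inv_Rmax.
    + apply continuous_inv_Rmax.
Qed.

Lemma ln_ext_eq (z : R) : d <= z -> ln_ext d z = ln z.
Proof.
  intros Hz. unfold ln_ext.
  rewrite (is_RInt_unique _ _ _ (ln z - ln d)); [ring|].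
  apply is_RInt_ext with (fun s => / s).
  - intros s. rewrite Rmin_left, Rmax_right by auto. intros Hs.
    now rewrite Rmax_right by lra.
  - apply (is_RInt_derive ln (fun s => / s)).
    + intros s. rewrite Rmin_left, Rmax_right by auto. intros Hs.
      apply is_derive_ln. lra.
    + intros s. rewrite Rmin_left, Rmax_right by auto. intros Hs.
      apply continuous_Rinv. lra.
Qed.

Lemma ln_ext_log_like (z : R) : d <= z -> log_like (ln_ext d) z.
Proof.
  intros Hz. split; [lra|].
  pose proof (is_derive_ln_ext z) as H. now rewrite Rmax_right in H by auto.
Qed.

End LnExt.

(** * Integrals over fixed strips and closure by continuity *)

Lemma continuous_section (f : R -> R -> R) (t y : R) :
  cont_diff f -> continuous (fun z => f t z) y.
Proof.
  intros Hf.
  apply (ex_derive_continuous (K := R_AbsRing) (V := R_NormedModule)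
           (fun z => f t z)).
  exact (proj1 (proj2 (Hf t y))).
Qed.

Lemma is_derive_RInt_cont_diff (f : R -> R -> R) (a b t : R) :
  cont_diff f ->
  is_derive (fun s => RInt (fun y => f s y) a b) t
    (RInt (fun y => Derive (fun s => f s y) t) a b).
Proof.
  intros Hf. apply (is_derive_RInt_param f a b t).
  - apply filter_forall. intros s y _. exact (proj1 (Hf s y)).
  - intros y _. exact (proj1 (proj2 (proj2 (Hf t y)))).
  - apply filter_forall. intros s.
    apply (ex_RInt_continuous (V := R_CompleteNormedModule)).
    intros; now apply continuous_section.
Qed.

(* Green's formula on a strip, for a density that is dissipated. *)
Lemma strip_estimate (f G : R -> R -> R) (a b t : R) :
  a < b -> cont_diff f ->
  (forall y, a <= y <= b -> ex_derive (fun z => G t z) y) ->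
  (forall y, a < y < b ->
     Derive (fun s => f s y) t + Derive (fun z => G t z) y <= 0) ->
  RInt (fun y => Derive (fun s => f s y) t) a b <= G t a - G t b.
Proof.
  intros Hab Hf HG Hd.
  set (ft := fun y => Derive (fun s => f s y) t).
  assert (Hct : forall y, continuous ft y).
  { intros y.
    assert (H : continuity_2d_pt (fun t x => Derive (fun s => f s x) t) t y)
      by exact (proj1 (proj2 (proj2 (Hf t y)))).
    apply continuity_2d_pt_filterlim in H.
    apply (continuous_comp_2 (fun _ => t) (fun z => z)
             (fun t x => Derive (fun s => f s x) t)).
    - apply continuous_const.
    - apply continuous_id.
    - exact H. }
  assert (HI : forall y, is_derive (fun z => RInt ft a z) y (ft y)).
  { intros y. apply (is_derive_RInt (V := R_NormedModule) ft _ a); auto.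
    apply filter_forall. intros z.
    apply (RInt_correct (V := R_CompleteNormedModule)).
    apply (ex_RInt_continuous (V := R_CompleteNormedModule)). intros; auto. }
  (* The point c may be an end of [a, b], where the inequality is not assumed. Capping the
     derivative by 0 changes nothing inside and gives the sign at c in every case. *)
  destruct (MVT_gen (fun y => RInt ft a y + G t y) a b
    (fun y => Rmin 0 (ft y + Derive (fun z => G t z) y))) as [c [Hc E]].
  - rewrite Rmin_left, Rmax_right by lra. intros y Hy.
    rewrite Rmin_right by (apply Hd; auto).
    apply (is_derive_plus (K := R_AbsRing) (fun y => RInt ft a y)
             (fun y => G t y)); auto.
    apply Derive_correct, HG; lra.
  - rewrite Rmin_left, Rmax_right by lra. intros y Hy.
    apply continuity_pt_plus; apply continuity_pt_filterlim;
      apply (ex_derive_continuous (K := R_AbsRing) (V := R_NormedModule)).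
    + eexists; apply HI.
    + now apply HG.
  - rewrite RInt_point in E. unfold zero in E; simpl in E.
    assert (Rmin 0 (ft c + Derive (fun z => G t z) c) <= 0) by apply Rmin_l.
    assert (Rmin 0 (ft c + Derive (fun z => G t z) c) * (b - a) <= 0).
    { apply Rmult_le_0_r; lra. }
    fold ft. lra.
Qed.

(** For every z near y, the integrals over [a, z] and [z, b] are nonnegative with nonpositive sum.
    So the primitive is locally zero, and f y is its derivative. *)
Lemma RInt_ge0_eq0 (f : R -> R) (a b : R) :
  a < b -> (forall y, continuous f y) ->
  (forall y, a < y < b -> 0 <= f y) -> RInt f a b <= 0 ->
  forall y, a < y < b -> f y = 0.
Proof.
  intros Hab Hc Hp HI y Hy.
  assert (Hex : forall c e, ex_RInt f c e).
  { intros c e. apply (ex_RInt_continuous (V := R_CompleteNormedModule)).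
    intros; auto. }
  assert (HD : is_derive (fun z => RInt f a z) y (f y)).
  { apply (is_derive_RInt (V := R_NormedModule) f _ a); auto.
    apply filter_forall. intros z. apply (RInt_correct (V := R_CompleteNormedModule)), Hex. }
  rewrite <- (is_derive_unique _ _ _ HD).
  rewrite (Derive_ext_loc _ (fun _ => 0)); [apply Derive_const|].
  assert (He : 0 < Rmin (y - a) (b - y)) by (apply Rmin_glb_lt; lra).
  exists (mkposreal _ He). intros z Hz. simpl in Hz.
  apply Rabs_def2 in Hz. unfold minus, plus, opp in Hz; simpl in Hz.
  pose proof (Rmin_l (y - a) (b - y)). pose proof (Rmin_r (y - a) (b - y)).
  assert (H1 : 0 <= RInt f a z).
  { apply RInt_ge_0; [lra | auto | intros; apply Hp; lra]. }
  assert (H2 : 0 <= RInt f z b).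
  { apply RInt_ge_0; [lra | auto | intros; apply Hp; lra]. }
  assert (H3 : RInt f a z + RInt f z b = RInt f a b).
  { apply (RInt_Chasles f a z b); apply Hex. }
  lra.
Qed.

(** Used in space to pass to the traces on the curve, and in time to reach the instants 0 and
    [tend]. *)
Lemma closed_interval_ge (f : R -> R) (a b c : R) :
  a < b -> (forall y, continuous f y) ->
  (forall y, a < y < b -> c <= f y) -> forall y, a <= y <= b -> c <= f y.
Proof.
  intros Hab Hc H y Hy.
  destruct (Rle_lt_dec c (f y)) as [|Hlt]; auto. exfalso.
  assert (He : 0 < c - f y) by lra.
  destruct (proj1 (filterlim_locally _ _) (Hc y) (mkposreal _ He))
    as [e Hloc].
  (* A point close to y, displaced towards the middle by at most a quarter of the length, so that it
     lies in the open interval even when y is an end. *)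
  set (z := if Rlt_dec y ((a + b) / 2)
            then y + Rmin (e / 2) ((b - a) / 4)
            else y - Rmin (e / 2) ((b - a) / 4)).
  pose proof (cond_pos e) as Hep.
  assert (Hm : 0 < Rmin (e / 2) ((b - a) / 4)) by (apply Rmin_glb_lt; lra).
  pose proof (Rmin_l (e / 2) ((b - a) / 4)).
  pose proof (Rmin_r (e / 2) ((b - a) / 4)).
  assert (Hz : a < z < b /\ Rabs (z - y) < e).
  { unfold z. destruct (Rlt_dec y ((a + b) / 2)).
    - split; [lra|]. rewrite Rabs_right; lra.
    - split; [lra|]. rewrite Rabs_left; lra. }
  destruct Hz as [Hz Hze]. specialize (H z Hz).
  specialize (Hloc z Hze). apply Rabs_def2 in Hloc.
  unfold minus, plus, opp in Hloc; simpl in Hloc. lra.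
Qed.

Lemma closed_interval_eq (f : R -> R) (a b c : R) :
  a < b -> (forall y, continuous f y) ->
  (forall y, a < y < b -> f y = c) -> forall y, a <= y <= b -> f y = c.
Proof.
  intros Hab Hc H y Hy. apply Rle_antisym.
  - apply Ropp_le_cancel.
    apply (closed_interval_ge (fun z => - f z) a b (- c) Hab); auto.
    + intros z. now apply (continuous_opp (K := R_AbsRing) (V := R_NormedModule) f).
    + intros z Hz. rewrite H by auto. lra.
  - apply (closed_interval_ge f a b c Hab); auto.
    intros z Hz. rewrite H by auto. lra.
Qed.

(** * Positivity and interface continuity of the availability *)

Lemma ln_le_sub1 (z : R) : 0 < z -> 0 <= z - 1 - ln z.
Proof.
  intros Hz. pose proof (exp_ineq1_le (ln z)). rewrite exp_ln in H; lra.
Qed.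

Lemma ln_eq_sub1 (z : R) : 0 < z -> z - 1 - ln z = 0 -> z = 1.
Proof.
  intros Hz H. destruct (Req_dec (ln z) 0) as [E|E].
  - lra.
  - pose proof (exp_ineq1 (ln z) E). rewrite exp_ln in H0; lra.
Qed.

Section RestState.
Variables (N : nat) (M : material) (rh : nat -> R) (u0 p0 T0 : R) (L : R -> R).
Hypotheses
  (HM : forall k, (1 <= k <= N)%nat -> 1 < gam M k /\ 0 < Cv M k)
  (Hrh : forall k, (1 <= k <= N)%nat -> 0 < rh k)
  (Hp0 : forall k, (1 <= k <= N)%nat -> 0 < p0 + pinf M k)
  (HT0 : forall k, (1 <= k <= N)%nat -> temp M k (rh k) p0 = T0).

(** Here z is the temperature ratio T/T0 and y the ratio of specific volumes to that at rest. The
    function s - 1 - ln s is nonnegative with its only zero at 1, which yields both the sign and the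
    zero set. *)
Lemma avail_eq (k : nat) (r q : R) :
  (1 <= k <= N)%nat -> 0 < r -> 0 < q + pinf M k ->
  L r = ln r -> L (q + pinf M k) = ln (q + pinf M k) ->
  let z := (q + pinf M k) * rh k / ((p0 + pinf M k) * r) in
  let y := rh k / r in
  avail M rh p0 T0 L k r q
  = T0 * Cv M k * r * ((z - 1 - ln z) + (gam M k - 1) * (y - 1 - ln y)).
Proof.
  intros Hk Hr Hq Er Eq z y. destruct (HM k Hk) as [Hg HC].
  assert (Hrk := Hrh k Hk). assert (Hpk := Hp0 k Hk).
  assert (Ez : ln z = ln (q + pinf M k) + ln (rh k)
                      - (ln (p0 + pinf M k) + ln r)).
  { unfold z. rewrite ln_div, !ln_mult; auto; now apply Rmult_lt_0_compat. }
  assert (Ey : ln y = ln (rh k) - ln r) by (unfold y; now rewrite ln_div).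
  unfold avail, gibbs0. rewrite Ez, Ey, Er, Eq, <- (HT0 k Hk).
  rewrite temp_eq by auto. unfold z, y. field. repeat split; lra.
Qed.

Lemma rest_temp_pos (k : nat) : (1 <= k <= N)%nat -> 0 < T0.
Proof.
  intros Hk. destruct (HM k Hk). rewrite <- (HT0 k Hk), temp_eq by auto.
  apply Rdiv_lt_0_compat; auto. repeat apply Rmult_lt_0_compat; auto; lra.
Qed.

Lemma avail_nonneg (k : nat) (r q : R) :
  (1 <= k <= N)%nat -> 0 < r -> 0 < q + pinf M k ->
  L r = ln r -> L (q + pinf M k) = ln (q + pinf M k) ->
  0 <= avail M rh p0 T0 L k r q.
Proof.
  intros Hk Hr Hq Er Eq. rewrite avail_eq by auto.
  destruct (HM k Hk) as [Hg HC].
  assert (Hrk := Hrh k Hk). assert (Hpk := Hp0 k Hk).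
  pose proof (rest_temp_pos k Hk).
  apply Rmult_le_pos; [repeat apply Rmult_le_pos; lra|].
  apply Rplus_le_le_0_compat; [|apply Rmult_le_pos; [lra|]];
    apply ln_le_sub1; apply Rdiv_lt_0_compat; auto;
    now apply Rmult_lt_0_compat.
Qed.

Lemma avail_zero (k : nat) (r q : R) :
  (1 <= k <= N)%nat -> 0 < r -> 0 < q + pinf M k ->
  L r = ln r -> L (q + pinf M k) = ln (q + pinf M k) ->
  avail M rh p0 T0 L k r q = 0 -> r = rh k /\ q = p0.
Proof.
  intros Hk Hr Hq Er Eq E. rewrite avail_eq in E by auto.
  destruct (HM k Hk) as [Hg HC].
  assert (Hrk := Hrh k Hk). assert (Hpk := Hp0 k Hk).
  pose proof (rest_temp_pos k Hk).
  set (z := (q + pinf M k) * rh k / ((p0 + pinf M k) * r)) in *.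
  set (y := rh k / r) in *.
  assert (Hz : 0 < z)
    by (apply Rdiv_lt_0_compat; now apply Rmult_lt_0_compat).
  assert (Hy : 0 < y) by now apply Rdiv_lt_0_compat.
  pose proof (ln_le_sub1 z Hz) as Hz1. pose proof (ln_le_sub1 y Hy) as Hy1.
  apply Rmult_integral in E. destruct E as [E|E].
  { assert (0 < T0 * Cv M k * r) by (repeat apply Rmult_lt_0_compat; auto).
    lra. }
  assert (0 <= (gam M k - 1) * (y - 1 - ln y)) by (apply Rmult_le_pos; lra).
  assert (Ey : (gam M k - 1) * (y - 1 - ln y) = 0) by lra.
  apply Rmult_integral in Ey. destruct Ey as [Ey|Ey]; [lra|].
  apply ln_eq_sub1 in Ey; auto.
  assert (Ez : z = 1) by (apply ln_eq_sub1; auto; lra).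
  assert (Er0 : r = rh k).
  { unfold y in Ey. apply (f_equal (fun s => s * r)) in Ey.
    field_simplify in Ey; lra. }
  split; auto. unfold z in Ez. rewrite Er0 in Ez.
  apply (f_equal (fun s => s * (p0 + pinf M k))) in Ez.
  field_simplify in Ez; lra.
Qed.

Section TotalAvailability.
Variables (a r : nat -> R) (q v : R).
Hypotheses
  (Ha : forall k, (1 <= k <= N)%nat -> 0 <= a k)
  (Hr : forall k, (1 <= k <= N)%nat -> 0 < r k /\ L (r k) = ln (r k))
  (Hq : forall k, (1 <= k <= N)%nat ->
     0 < q + pinf M k /\ L (q + pinf M k) = ln (q + pinf M k)).

Lemma avail_terms_nonneg (k : nat) : (1 <= k <= N)%nat ->
  0 <= a k * avail M rh p0 T0 L k (r k) q.
Proof.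
  intros Hk. apply Rmult_le_pos; auto.
  apply avail_nonneg; auto; apply Hr || apply Hq; auto.
Qed.

Lemma total_mass_nonneg : 0 <= sum_phases N (fun k => a k * r k).
Proof.
  apply sum_phases_ge0. intros k Hk. apply Rmult_le_pos; auto.
  apply Rlt_le, Hr, Hk.
Qed.

Lemma total_avail_nonneg : 0 <= total_avail N M rh u0 p0 T0 L a r q v.
Proof.
  unfold total_avail. apply Rplus_le_le_0_compat.
  - apply sum_phases_ge0, avail_terms_nonneg.
  - apply Rmult_le_pos; [|apply Rle_0_sqr].
    pose proof total_mass_nonneg. lra.
Qed.

Lemma total_avail_zero :
  sum_phases N a = 1 -> total_avail N M rh u0 p0 T0 L a r q v = 0 ->
  v = u0 /\ q = p0
  /\ forall k, (1 <= k <= N)%nat -> a k <> 0 -> r k = rh k.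
Proof.
  intros Hs E. unfold total_avail in E.
  pose proof (sum_phases_ge0 N _ avail_terms_nonneg) as H1.
  assert (H2 : 0 < sum_phases N (fun k => a k * r k)).
  { apply sum_phases_weighted_pos; auto. intros; now apply Hr. }
  assert (H3 : 0 <= / 2 * sum_phases N (fun k => a k * r k)
                    * ((v - u0) * (v - u0))).
  { apply Rmult_le_pos; [lra | apply Rle_0_sqr]. }
  assert (E1 : sum_phases N (fun k => a k * avail M rh p0 T0 L k (r k) q) = 0)
    by lra.
  assert (E2 : / 2 * sum_phases N (fun k => a k * r k)
               * ((v - u0) * (v - u0)) = 0) by lra.
  assert (Hk : forall k, (1 <= k <= N)%nat -> a k <> 0 ->
                 r k = rh k /\ q = p0).
  { intros k Hk Hak.
    pose proof (sum_phases_ge0_eq0 N _ avail_terms_nonneg E1 k Hk) as E3.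
    cbv beta in E3. apply Rmult_integral in E3.
    destruct E3 as [E3|E3]; [contradiction|].
    apply avail_zero; auto; apply Hr || apply Hq; auto. }
  repeat split.
  - apply Rmult_integral in E2. destruct E2 as [E2|E2]; [lra|].
    apply Rmult_integral in E2. destruct E2; lra.
  - destruct (Req_dec q p0) as [|Hn]; auto. exfalso.
    assert (sum_phases N a = 0); [|lra].
    apply sum_phases_zero. intros k Hk'.
    destruct (Req_dec (a k) 0) as [|Hak]; auto.
    exfalso. now destruct (Hk k Hk' Hak).
  - intros k Hk' Hak. now apply Hk.
Qed.

End TotalAvailability.

(* Either the fluid does not cross the interface (vL = s), and p - tau is
   continuous, or it does, and the whole state is continuous. *)
Lemma avail_flux_continuous (aL rL tkL hfL aR rR tkR hfR : nat -> R)
  (qL vL qR vR s : R) :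
  (1 <= N)%nat ->
  (forall k, (1 <= k <= N)%nat -> 0 <= aL k) ->
  sum_phases N aL = 1 -> sum_phases N aR = 1 ->
  (forall k, (1 <= k <= N)%nat ->
     0 < rL k /\ 0 < qL + pinf M k /\ 0 < rR k /\ 0 < qR + pinf M k) ->
  vL = vR ->
  (forall k, (1 <= k <= N)%nat ->
     temp M k (rL k) qL = temp M k (rR k) qR
     /\ aL k * hfL k = aR k * hfR k
     /\ aL k * rL k * (vL - s) = aR k * rR k * (vR - s)) ->
  sum_phases N (fun k => aL k * rL k) * vL * (vL - s)
    + qL - sum_phases N (fun k => aL k * tkL k)
  = sum_phases N (fun k => aR k * rR k) * vR * (vR - s)
    + qR - sum_phases N (fun k => aR k * tkR k) ->
  (forall l, (2 <= l <= N)%nat -> (vL - s) * aL l = (vR - s) * aR l) ->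
  avail_flux N M rh u0 p0 T0 L aL rL qL vL tkL hfL s
  = avail_flux N M rh u0 p0 T0 L aR rR qR vR tkR hfR s.
Proof.
  intros HN Ha HsL HsR Hpos <- Hk Hmom Hal.
  assert (Em : sum_phases N (fun k => aL k * rL k) * (vL - s)
               = sum_phases N (fun k => aR k * rR k) * (vL - s)).
  { rewrite <- !sum_phases_scal_r. apply sum_phases_ext.
    intros k Hk'. now apply Hk. }
  assert (Eh : sum_phases N (fun k =>
                 aL k * hfL k * (1 - T0 / temp M k (rL k) qL))
               = sum_phases N (fun k =>
                 aR k * hfR k * (1 - T0 / temp M k (rR k) qR))).
  { apply sum_phases_ext. intros k Hk'.
    now destruct (Hk k Hk') as (-> & -> & _). }
  assert (Eq : qL - sum_phases N (fun k => aL k * tkL k)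
               = qR - sum_phases N (fun k => aR k * tkR k)).
  { assert (E : forall m, m * vL * (vL - s) = m * (vL - s) * vL)
      by (intros; ring).
    rewrite (E (sum_phases N (fun k => aL k * rL k))),
      (E (sum_phases N (fun k => aR k * rR k))), Em in Hmom. lra. }
  assert (Et : total_avail N M rh u0 p0 T0 L aL rL qL vL * (vL - s)
               = total_avail N M rh u0 p0 T0 L aR rR qR vL * (vL - s)).
  (* If the fluid crosses the curve, the jump conditions equate the fractions, hence the densities
     of the present phases. Some phase is present, and its temperature and density then equate the
     pressures. *)
  { destruct (Req_dec (vL - s) 0) as [->|Hs]; [ring|]. f_equal.
    assert (Ea : forall k, (1 <= k <= N)%nat -> aL k = aR k).
    { apply sum_phases_eq_first; [|now rewrite HsR].
      intros l Hl. apply Rmult_eq_reg_l with (vL - s); auto. }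
    assert (Er : forall k, (1 <= k <= N)%nat -> aL k <> 0 -> rL k = rR k).
    { intros k Hk' Hak. destruct (Hk k Hk') as (_ & _ & E).
      rewrite <- Ea in E by auto.
      apply Rmult_eq_reg_r in E; auto.
      now apply Rmult_eq_reg_l in E. }
    assert (Eqq : qL = qR).
    { destruct (Req_dec qL qR) as [|Hn]; auto. exfalso.
      assert (sum_phases N aL = 0); [|lra].
      apply sum_phases_zero. intros k Hk'.
      destruct (Req_dec (aL k) 0) as [|Hak]; auto. exfalso.
      destruct (Hk k Hk') as (E & _). destruct (Hpos k Hk') as (H1 & H2 & H3 & H4).
      destruct (HM k Hk') as [Hg HC].
      rewrite !temp_eq in E by auto. rewrite (Er k Hk' Hak) in E.
      apply Hn. unfold Rdiv in E. apply Rmult_eq_reg_r in E; [lra|].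
      apply Rinv_neq_0_compat, Rgt_not_eq.
      repeat apply Rmult_lt_0_compat; auto; lra. }
    unfold total_avail. rewrite <- Eqq. f_equal; [|f_equal; f_equal];
      apply sum_phases_ext; intros k Hk'; rewrite <- Ea by auto;
      (destruct (Req_dec (aL k) 0) as [->|Hak]; [ring|]);
      now rewrite Er by auto. }
  unfold avail_flux. rewrite Et, Eh.
  replace (qL - p0) with (qR - p0 + sum_phases N (fun k => aL k * tkL k)
    - sum_phases N (fun k => aR k * tkR k)) by lra.
  ring.
Qed.

End RestState.

(** * Behaviour at infinity *)

Section FarField.
Variable tend : R.

Definition far_bounded (f : R -> R -> R) : Prop :=
  exists B C, forall t x, 0 <= t <= tend -> B < Rabs x -> Rabs (f t x) <= C.

Lemma vanish_ext_far (f g : R -> R -> R) :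
  (exists B, forall t x, 0 <= t <= tend -> B < Rabs x -> f t x = g t x) ->
  vanishes_at_infinity tend f -> vanishes_at_infinity tend g.
Proof.
  intros [B0 E] H eps He. destruct (H eps He) as [B HB].
  exists (Rmax B0 B). intros t x Ht Hx.
  pose proof (Rmax_l B0 B). pose proof (Rmax_r B0 B).
  rewrite <- E by (auto; lra). apply HB; auto; lra.
Qed.

Lemma vanish_plus (f g : R -> R -> R) :
  vanishes_at_infinity tend f -> vanishes_at_infinity tend g ->
  vanishes_at_infinity tend (fun t x => f t x + g t x).
Proof.
  intros Hf Hg eps He.
  destruct (Hf (eps / 2)) as [B1 H1]; [lra|].
  destruct (Hg (eps / 2)) as [B2 H2]; [lra|].
  exists (Rmax B1 B2). intros t x Ht Hx.
  pose proof (Rmax_l B1 B2). pose proof (Rmax_r B1 B2).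
  specialize (H1 t x Ht). specialize (H2 t x Ht).
  pose proof (Rabs_triang (f t x) (g t x)). lra.
Qed.

Lemma vanish_mult_bounded (f g : R -> R -> R) :
  vanishes_at_infinity tend f -> far_bounded g ->
  vanishes_at_infinity tend (fun t x => f t x * g t x).
Proof.
  intros Hf [B2 [C H2]] eps He.
  assert (HC : 0 < Rabs C + 1) by (pose proof (Rabs_pos C); lra).
  destruct (Hf (eps / (Rabs C + 1))) as [B1 H1];
    [now apply Rdiv_lt_0_compat|].
  exists (Rmax B1 B2). intros t x Ht Hx.
  pose proof (Rmax_l B1 B2). pose proof (Rmax_r B1 B2).
  assert (E1 : Rabs (f t x) < eps / (Rabs C + 1)) by (apply H1; auto; lra).
  assert (E2 : Rabs (g t x) <= C) by (apply H2; auto; lra).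
  pose proof (Rle_abs C).
  rewrite Rabs_mult.
  apply Rle_lt_trans with (Rabs (f t x) * (Rabs C + 1)).
  - apply Rmult_le_compat_l; [apply Rabs_pos | lra].
  - replace eps with (eps / (Rabs C + 1) * (Rabs C + 1)) by (field; lra).
    apply Rmult_lt_compat_r; auto.
Qed.

Lemma vanish_zero : vanishes_at_infinity tend (fun _ _ => 0).
Proof. intros eps He. exists 0. intros. now rewrite Rabs_R0. Qed.

Lemma vanish_sum (N : nat) (f : nat -> R -> R -> R) :
  (forall k, (1 <= k <= N)%nat -> vanishes_at_infinity tend (f k)) ->
  vanishes_at_infinity tend (fun t x => sum_phases N (fun k => f k t x)).
Proof.
  induction N as [|N IH]; intros H.
  - apply vanish_ext_far with (fun _ _ => 0); [|apply vanish_zero].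
    exists 0. intros. now rewrite sum_phases_0.
  - apply vanish_ext_far with
      (fun t x => sum_phases N (fun k => f k t x) + f (S N) t x).
    + exists 0. intros. now rewrite sum_phases_S.
    + apply vanish_plus; [apply IH; intros|]; apply H; lia.
Qed.

Lemma far_bounded_const (c : R) : far_bounded (fun _ _ => c).
Proof. exists 0, (Rabs c). intros. lra. Qed.

Lemma vanish_far_bounded (f : R -> R -> R) (l : R) :
  vanishes_at_infinity tend (fun t x => f t x - l) -> far_bounded f.
Proof.
  intros H. destruct (H 1) as [B HB]; [lra|].
  exists B, (1 + Rabs l). intros t x Ht Hx. specialize (HB t x Ht Hx).
  pose proof (Rabs_triang (f t x - l) l).
  replace (f t x - l + l) with (f t x) in * by ring. lra.
Qed.

Lemma far_bounded_minus (f g : R -> R -> R) :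
  far_bounded f -> far_bounded g -> far_bounded (fun t x => f t x - g t x).
Proof.
  intros [B1 [C1 H1]] [B2 [C2 H2]]. exists (Rmax B1 B2), (C1 + C2).
  intros t x Ht Hx. pose proof (Rmax_l B1 B2). pose proof (Rmax_r B1 B2).
  specialize (H1 t x Ht). specialize (H2 t x Ht).
  pose proof (Rabs_triang (f t x) (- g t x)).
  rewrite Rabs_Ropp in *. unfold Rminus. lra.
Qed.

Lemma vanish_comp_2d (F : R -> R -> R) (f g : R -> R -> R) (l1 l2 : R) :
  continuity_2d_pt F l1 l2 ->
  vanishes_at_infinity tend (fun t x => f t x - l1) ->
  vanishes_at_infinity tend (fun t x => g t x - l2) ->
  vanishes_at_infinity tend (fun t x => F (f t x) (g t x) - F l1 l2).
Proof.
  intros HF Hf Hg eps He.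
  destruct (HF (mkposreal eps He)) as [d Hd].
  destruct (Hf d (cond_pos d)) as [B1 H1].
  destruct (Hg d (cond_pos d)) as [B2 H2].
  exists (Rmax B1 B2). intros t x Ht Hx.
  pose proof (Rmax_l B1 B2). pose proof (Rmax_r B1 B2).
  apply Hd; [apply H1 | apply H2]; auto; lra.
Qed.

Lemma continuous_bounded (f : R -> R) :
  0 < tend -> (forall t, continuous f t) ->
  exists C, forall t, 0 <= t <= tend -> Rabs (f t) <= C.
Proof.
  intros Ht Hf.
  destruct (continuity_ab_maj (fun t => Rabs (f t)) 0 tend) as [m [Hm _]].
  - lra.
  - intros t _. apply (continuity_pt_comp f Rabs).
    + apply continuity_pt_filterlim, Hf.
    + apply Rcontinuity_abs.
  - exists (Rabs (f m)). exact Hm.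
Qed.

End FarField.

Section FarFlux.
Variables (N : nat) (M : material) (heat : nat -> R -> R -> R)
  (D : riemann_data) (tend : R) (V : plane_flow) (xi : R -> R) (T0 : R).
Let rh := rho0 D.
Let p00 := p0 D.
Hypotheses
  (Htend : 0 < tend)
  (Hsol : riemann_solution N M heat D tend V xi)
  (HM : forall k, (1 <= k <= N)%nat -> 1 < gam M k /\ 0 < Cv M k)
  (Hrh : forall k, (1 <= k <= N)%nat -> 0 < rh k)
  (Hp0 : forall k, (1 <= k <= N)%nat -> 0 < p00 + pinf M k)
  (HT : forall k, (1 <= k <= N)%nat -> temp M k (rh k) p00 = T0).

(** Inverse of [temp] in the density. Temperature and pressure are the quantities controlled at
    infinity, and densities are recovered from them. *)
Definition density_of (k : nat) (T q : R) : R :=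
  (q + pinf M k) / ((gam M k - 1) * Cv M k) * / T.

Lemma density_of_temp (k : nat) (r q : R) :
  (1 <= k <= N)%nat -> 0 < r -> 0 < q + pinf M k ->
  density_of k (temp M k r q) q = r.
Proof.
  intros Hk Hr Hq. destruct (HM k Hk). rewrite temp_eq by auto.
  unfold density_of. field. repeat split; lra.
Qed.

Lemma continuity_density_of (k : nat) :
  (1 <= k <= N)%nat -> continuity_2d_pt (density_of k) T0 p00.
Proof.
  intros Hk. pose proof (rest_temp_pos N M rh p00 T0 HM Hrh Hp0 HT k Hk).
  unfold density_of, Rdiv.
  apply (continuity_2d_pt_mult
    (fun _ q => (q + pinf M k) * / ((gam M k - 1) * Cv M k))
    (fun T _ => / T)).
  - apply (continuity_2d_pt_mult (fun _ q => q + pinf M k) (fun _ _ => _)).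
    + apply (continuity_2d_pt_plus (fun _ q => q) (fun _ _ => _)).
      * apply continuity_2d_pt_id2.
      * apply continuity_2d_pt_const.
    + apply continuity_2d_pt_const.
  - apply (continuity_2d_pt_inv (fun T _ => T)).
    + apply continuity_2d_pt_id1.
    + lra.
Qed.

Lemma continuity_2d_ln (f : R -> R -> R) (x y : R) :
  continuity_2d_pt f x y -> 0 < f x y ->
  continuity_2d_pt (fun u v => ln (f u v)) x y.
Proof.
  intros Hf Hp. apply (continuity_1d_2d_pt_comp ln f); auto.
  apply continuity_pt_filterlim.
  apply (ex_derive_continuous (K := R_AbsRing) (V := R_NormedModule) ln).
  eexists. now apply is_derive_ln.
Qed.

Lemma rest_density (k : nat) :
  (1 <= k <= N)%nat -> density_of k T0 p00 = rh k.
Proof.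
  intros Hk. rewrite <- (HT k Hk). apply density_of_temp; auto.
Qed.

Lemma continuity_avail (k : nat) : (1 <= k <= N)%nat ->
  continuity_2d_pt
    (fun T q => avail M rh p00 T0 ln k (density_of k T q) q) T0 p00.
Proof.
  intros Hk. assert (Hd := continuity_density_of k Hk).
  assert (Hq : continuity_2d_pt (fun _ q => q + pinf M k) T0 p00).
  { apply (continuity_2d_pt_plus (fun _ q => q) (fun _ _ => _)).
    - apply continuity_2d_pt_id2.
    - apply continuity_2d_pt_const. }
  unfold avail, Rdiv.
  repeat match goal with
  | |- continuity_2d_pt (fun _ _ => ?c) _ _ => apply continuity_2d_pt_const
  | |- continuity_2d_pt (fun _ v => v) _ _ => apply continuity_2d_pt_id2
  | |- continuity_2d_pt (fun u v => density_of k u v) _ _ => exact Hd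
  | |- continuity_2d_pt (fun u v => ln _) _ _ => apply continuity_2d_ln
  | |- continuity_2d_pt (fun u v => _ + _) _ _ => apply continuity_2d_pt_plus
  | |- continuity_2d_pt (fun u v => _ - _) _ _ => apply continuity_2d_pt_minus
  | |- continuity_2d_pt (fun u v => _ * _) _ _ => apply continuity_2d_pt_mult
  end; auto.
  rewrite rest_density; auto.
Qed.

Lemma avail_rest (k : nat) : (1 <= k <= N)%nat ->
  avail M rh p00 T0 ln k (rh k) p00 = 0.
Proof.
  intros Hk. rewrite (avail_eq N M rh p00 T0 ln) by auto.
  assert (Hr := Hrh k Hk). assert (Hp := Hp0 k Hk).
  replace ((p00 + pinf M k) * rh k / ((p00 + pinf M k) * rh k)) with 1
    by (field; lra).
  replace (rh k / rh k) with 1 by (field; lra).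
  rewrite ln_1. ring.
Qed.

(** The curve stays bounded on the compact time interval, so far away the flow is admissible and the
    gas relations hold. *)
Lemma far_off_curve : exists B, forall t x,
  0 <= t <= tend -> B < Rabs x -> x <> xi t.
Proof.
  destruct (continuous_bounded tend xi Htend) as [C HC].
  - intros t. apply (ex_derive_continuous (K := R_AbsRing)
      (V := R_NormedModule) xi), (rs_curve _ _ _ _ _ _ _ Hsol).
  - exists C. intros t x Ht Hx ->. specialize (HC t Ht). lra.
Qed.

Lemma off_curve_gas (t x : R) (k : nat) :
  0 <= t <= tend -> x <> xi t -> (1 <= k <= N)%nat ->
  0 <= pl_alpha V k t x /\ 0 < pl_rho V k t x
  /\ 0 < pl_p V t x + pinf M k /\ 0 < pl_T M V k t x.
Proof.
  intros Ht Hx Hk.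
  destruct (proj1 (rs_admissible _ _ _ _ _ _ _ Hsol t x Ht Hx) k Hk)
    as (H1 & H2 & H3).
  simpl in H1, H2, H3. destruct (HM k Hk).
  repeat split; auto. now apply (temp_pos M k) with (pl_rho V k t x).
Qed.

Lemma off_curve_sum (t x : R) :
  0 <= t <= tend -> x <> xi t ->
  sum_phases N (fun k => pl_alpha V k t x) = 1.
Proof.
  intros Ht Hx. exact (proj2 (rs_admissible _ _ _ _ _ _ _ Hsol t x Ht Hx)).
Qed.

Lemma alpha_far_bounded (k : nat) :
  (1 <= k <= N)%nat -> far_bounded tend (pl_alpha V k).
Proof.
  intros Hk. destruct far_off_curve as [B HB].
  exists B, 1. intros t x Ht Hx. specialize (HB t x Ht Hx).
  pose proof (sum_phases_term_le N (fun k => pl_alpha V k t x) k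
    (fun j Hj => proj1 (off_curve_gas t x j Ht HB Hj)) Hk) as H.
  cbv beta in H. rewrite off_curve_sum in H by auto.
  pose proof (proj1 (off_curve_gas t x k Ht HB Hk)).
  rewrite Rabs_right; lra.
Qed.

Lemma temp_far (k : nat) : (1 <= k <= N)%nat ->
  vanishes_at_infinity tend (fun t x => pl_T M V k t x - T0).
Proof.
  intros Hk.
  destruct (rs_infinity _ _ _ _ _ _ _ Hsol) as (_ & _ & _ & H).
  destruct (H k Hk) as [H1 _]. rewrite <- (HT k Hk). exact H1.
Qed.

Lemma pres_far : vanishes_at_infinity tend (fun t x => pl_p V t x - p00).
Proof. apply (rs_infinity _ _ _ _ _ _ _ Hsol). Qed.

Lemma vel_far : vanishes_at_infinity tend (fun t x => pl_u V t x - u0 D).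
Proof. apply (rs_infinity _ _ _ _ _ _ _ Hsol). Qed.

Lemma density_far (k : nat) : (1 <= k <= N)%nat ->
  vanishes_at_infinity tend (fun t x => pl_rho V k t x - rh k).
Proof.
  intros Hk. destruct far_off_curve as [B HB].
  apply vanish_ext_far with (fun t x =>
    density_of k (pl_T M V k t x) (pl_p V t x) - density_of k T0 p00).
  - exists B. intros t x Ht Hx.
    destruct (off_curve_gas t x k Ht (HB t x Ht Hx) Hk) as (_ & ? & ? & _).
    rewrite rest_density by auto. unfold pl_T. now rewrite density_of_temp.
  - apply vanish_comp_2d;
      [now apply continuity_density_of | now apply temp_far | exact pres_far].
Qed.

Lemma avail_far (k : nat) : (1 <= k <= N)%nat ->
  vanishes_at_infinity tend (fun t x =>
    avail M rh p00 T0 ln k (pl_rho V k t x) (pl_p V t x)).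
Proof.
  intros Hk. destruct far_off_curve as [B HB].
  set (F := fun T q => avail M rh p00 T0 ln k (density_of k T q) q).
  apply vanish_ext_far with (fun t x =>
    F (pl_T M V k t x) (pl_p V t x) - F T0 p00).
  - exists B. intros t x Ht Hx.
    destruct (off_curve_gas t x k Ht (HB t x Ht Hx) Hk) as (_ & ? & ? & _).
    unfold F. rewrite rest_density, avail_rest by auto.
    unfold pl_T. rewrite density_of_temp by auto. ring.
  - apply vanish_comp_2d;
      [now apply continuity_avail | now apply temp_far | exact pres_far].
Qed.

Lemma total_avail_far :
  vanishes_at_infinity tend (fun t x =>
    total_avail N M rh (u0 D) p00 T0 ln (fun k => pl_alpha V k t x)
      (fun k => pl_rho V k t x) (pl_p V t x) (pl_u V t x)).
Proof.
  assert (H : vanishes_at_infinity tend (fun t x =>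
    sum_phases N (fun k => avail M rh p00 T0 ln k (pl_rho V k t x) (pl_p V t x)
                           * pl_alpha V k t x)
    + sum_phases N (fun k =>
        (pl_u V t x - u0 D) * (pl_u V t x - u0 D) * pl_rho V k t x
        * pl_alpha V k t x) * / 2)).
  { assert (Hu := vel_far).
    apply vanish_plus; [|apply vanish_mult_bounded;
                          [|apply far_bounded_const]].
    - apply vanish_sum. intros k Hk. apply vanish_mult_bounded.
      + now apply avail_far.
      + now apply alpha_far_bounded.
    - apply vanish_sum. intros k Hk.
      apply vanish_mult_bounded; [|now apply alpha_far_bounded].
      apply vanish_mult_bounded.
      + apply vanish_mult_bounded; auto.
        apply far_bounded_minus; [|apply far_bounded_const].
        now apply vanish_far_bounded with (u0 D).
      + apply vanish_far_bounded with (rh k). now apply density_far. }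
  apply vanish_ext_far with (2 := H). exists 0. intros t x _ _.
  unfold total_avail. f_equal.
  - apply sum_phases_ext. intros; ring.
  - rewrite (sum_phases_ext N _ (fun k => pl_alpha V k t x * pl_rho V k t x
      * ((pl_u V t x - u0 D) * (pl_u V t x - u0 D)))) by (intros; ring).
    rewrite sum_phases_scal_r. ring.
Qed.

(** Each term contains a factor that decays, namely the availability, the pressure deviation, the
    total viscous stress or a phase heat flux, while the other factors stay bounded. The phase
    stresses enter only through their total. *)
Lemma avail_flux_far :
  vanishes_at_infinity tend (fun t x =>
    avail_flux N M rh (u0 D) p00 T0 ln (fun k => pl_alpha V k t x)
      (fun k => pl_rho V k t x) (pl_p V t x) (pl_u V t x)
      (fun k => pl_tau M V k t x) (fun k => pl_fourier M V k t x)
      (Derive xi t)).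
Proof.
  assert (Hu : far_bounded tend (pl_u V))
    by (apply vanish_far_bounded with (u0 D); exact vel_far).
  assert (Huu : far_bounded tend (fun t x => pl_u V t x - u0 D))
    by (apply far_bounded_minus; auto; apply far_bounded_const).
  assert (Hs : far_bounded tend (fun t _ => Derive xi t)).
  { destruct (continuous_bounded tend (Derive xi) Htend) as [C HC].
    - intros t. apply (rs_curve _ _ _ _ _ _ _ Hsol).
    - exists 0, C. intros; auto. }
  destruct (rs_infinity _ _ _ _ _ _ _ Hsol) as (_ & _ & Htau & Hk).
  assert (H : vanishes_at_infinity tend (fun t x =>
    total_avail N M rh (u0 D) p00 T0 ln (fun k => pl_alpha V k t x)
      (fun k => pl_rho V k t x) (pl_p V t x) (pl_u V t x)
      * (pl_u V t x - Derive xi t)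
    + (pl_p V t x - p00) * (pl_u V t x - u0 D)
    + on_line (tau N M (embed V) ax0 ax0) t x * (pl_u V t x - u0 D) * -1
    + sum_phases N (fun k => on_line (heat_flux M (embed V) k ax0) t x
        * (1 - T0 * / pl_T M V k t x)) * -1)).
  { repeat apply vanish_plus.
    - apply vanish_mult_bounded; [apply total_avail_far|].
      now apply far_bounded_minus.
    - apply vanish_mult_bounded; [exact pres_far | exact Huu].
    - apply vanish_mult_bounded; [|apply far_bounded_const].
      now apply vanish_mult_bounded.
    - apply vanish_mult_bounded; [|apply far_bounded_const].
      apply vanish_sum. intros k Hk'.
      apply vanish_mult_bounded; [now apply Hk|].
      apply vanish_far_bounded with (1 - T0 * / T0).
      apply (vanish_comp_2d tend (fun T _ => 1 - T0 * / T) (pl_T M V k)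
               (pl_p V) T0 p00).
      + pose proof (rest_temp_pos N M rh p00 T0 HM Hrh Hp0 HT k Hk').
        apply (continuity_2d_pt_minus (fun _ _ => 1) (fun T _ => T0 * / T));
          [apply continuity_2d_pt_const|].
        apply (continuity_2d_pt_mult (fun _ _ => T0) (fun T _ => / T));
          [apply continuity_2d_pt_const|].
        apply (continuity_2d_pt_inv (fun T _ => T));
          [apply continuity_2d_pt_id1 | lra].
      + now apply temp_far.
      + exact pres_far. }
  apply vanish_ext_far with (2 := H). exists 0. intros t x _ _.
  unfold avail_flux.
  rewrite (sum_phases_ext N (fun k => pl_alpha V k t x * pl_fourier M V k t x
      * (1 - T0 / temp M k (pl_rho V k t x) (pl_p V t x)))
    (fun k => on_line (heat_flux M (embed V) k ax0) t x
        * (1 - T0 * / pl_T M V k t x))).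
  - change (on_line (tau N M (embed V) ax0 ax0) t x)
      with (sum_phases N (fun k => pl_alpha V k t x * pl_tau M V k t x)).
    ring.
  - intros k Hk'. rewrite heat_flux_line. reflexivity.
Qed.

End FarFlux.

(** * Solutions are at rest *)

Lemma smooth_on_represents (N : nat) (M : material) (V : plane_flow)
    (S : R -> R -> Prop) :
  smooth_on N M V S ->
  exists A Rh TK HF U P,
    (forall s z, S s z -> represents N M V A Rh TK HF U P s z)
    /\ cont_diff U /\ cont_diff P
    /\ forall k, (1 <= k <= N)%nat ->
         cont_diff (A k) /\ cont_diff (Rh k) /\ cont_diff (TK k)
         /\ cont_diff (HF k).
Proof.
  intros ((U & CU & EU) & (P & CP & EP) & H).
  (* The four extensions of a phase are bundled into one family indexed by numbers, so that
     [finite_choice] is applied once. *)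
  assert (H' : forall k, (1 <= k <= N)%nat -> exists g : nat -> R -> R -> R,
    (cont_diff (g 0%nat) /\ cont_diff (g 1%nat)
     /\ cont_diff (g 2%nat) /\ cont_diff (g 3%nat))
    /\ forall s z, S s z ->
         pl_alpha V k s z = g 0%nat s z /\ pl_rho V k s z = g 1%nat s z
         /\ pl_tau M V k s z = g 2%nat s z
         /\ pl_fourier M V k s z = g 3%nat s z).
  { intros k Hk. destruct (H k Hk) as
      ((g0 & C0 & E0) & (g1 & C1 & E1) & (g2 & C2 & E2) & (g3 & C3 & E3)).
    exists (fun i => match i with 0 => g0 | 1 => g1 | 2 => g2 | _ => g3 end%nat).
    split; [auto|]. intros s z Hs.
    unfold pl_tau, pl_fourier. auto. }
  apply (finite_choice (fun _ _ _ => 0)) in H'. destruct H' as [g Hg].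
  exists (fun k => g k 0%nat), (fun k => g k 1%nat), (fun k => g k 2%nat),
    (fun k => g k 3%nat), U, P.
  split.
  2: { split; [exact CU|]. split; [exact CP|]. intros k Hk.
       exact (proj1 (Hg k Hk)). }
  intros s z Hs. split; [exact (EU s z Hs)|]. split; [exact (EP s z Hs)|].
  intros k Hk. exact (proj2 (Hg k Hk) s z Hs).
Qed.

Lemma locally_between (f g : R -> R) (y : R) :
  continuous f y -> continuous g y -> f y < g y ->
  locally y (fun z => f z < g z).
Proof.
  intros Hf Hg H.
  assert (Hc : continuous (fun z => minus (g z) (f z)) y)
    by now apply (continuous_minus (K := R_AbsRing) (V := R_NormedModule)).
  assert (He : 0 < g y - f y) by lra.
  refine (filter_imp _ _ _
    (proj1 (filterlim_locally _ _) Hc (mkposreal _ He))).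
  intros z Hz. change (Rabs (g z - f z - (g y - f y)) < g y - f y) in Hz.
  apply Rabs_def2 in Hz. lra.
Qed.

(** Turns a jump condition, which concerns one-sided limits of the flow, into an equality between
    the values on the curve of the two smooth extensions. *)
Lemma no_jump_eq (f f1 f2 : R -> R) (x : R) :
  no_jump f x -> (forall z, z < x -> f z = f1 z) ->
  (forall z, x < z -> f z = f2 z) ->
  continuous f1 x -> continuous f2 x -> f1 x = f2 x.
Proof.
  intros [l [Hl Hr]] E1 E2 C1 C2.
  transitivity l; [|symmetry].
  - apply (filterlim_locally_unique (F := at_left x) f); auto.
    apply filterlim_ext_loc with f1.
    + exists (mkposreal 1 Rlt_0_1). intros z _ Hz. now rewrite E1.
    + apply filterlim_filter_le_1 with (2 := C1). apply filter_le_within.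
  - apply (filterlim_locally_unique (F := at_right x) f); auto.
    apply filterlim_ext_loc with f2.
    + exists (mkposreal 1 Rlt_0_1). intros z _ Hz. now rewrite E2.
    + apply filterlim_filter_le_1 with (2 := C2). apply filter_le_within.
Qed.

Section Solution.
Variables (N : nat) (M : material) (heat : nat -> R -> R -> R)
  (D : riemann_data) (tend : R) (V : plane_flow) (xi : R -> R) (T0 d : R).
Let rh := rho0 D.
Let p00 := p0 D.
Hypotheses
  (HN : (1 <= N)%nat) (HM : physical_material N M)
  (Htend : 0 < tend) (HT0 : 0 < T0)
  (Hsol : riemann_solution N M heat D tend V xi)
  (Hnoheat : releases_no_heat N heat tend V xi)
  (Hrh : forall k, (1 <= k <= N)%nat -> 0 < rh k)
  (Hp0 : forall k, (1 <= k <= N)%nat -> 0 < p00 + pinf M k)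
  (HT : forall k, (1 <= k <= N)%nat -> temp M k (rh k) p00 = T0)
  (Hd : 0 < d)
  (Hfloor : forall t x k, 0 <= t <= tend -> x <> xi t -> (1 <= k <= N)%nat ->
     d <= pl_rho V k t x /\ d <= pl_p V t x + pinf M k).

Lemma curve_continuous (t : R) : continuous xi t.
Proof.
  apply (ex_derive_continuous (K := R_AbsRing) (V := R_NormedModule) xi).
  apply (rs_curve _ _ _ _ _ _ _ Hsol).
Qed.

(** * Decay of the availability on one side of the curve *)

Section Side.
Variables (A Rh TK HF : nat -> R -> R -> R) (U P : R -> R -> R)
  (S : R -> R -> Prop).
Hypotheses
  (Hrep : forall s z, S s z -> represents N M V A Rh TK HF U P s z)
  (CU : cont_diff U) (CP : cont_diff P)
  (CA : forall k, (1 <= k <= N)%nat ->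
         cont_diff (A k) /\ cont_diff (Rh k) /\ cont_diff (TK k)
         /\ cont_diff (HF k))
  (HSoff : forall s z, S s z -> 0 <= s <= tend /\ z <> xi s)
  (HSopen : forall t x, S t x -> 0 < t < tend ->
     locally t (fun s => S s x) /\ locally x (fun z => S t z)).

(** Built with [ln_ext] because the extensions may leave the domain of the logarithm outside their
    side, while differentiation under the integral asks for smoothness on the whole plane. Inside
    the side, [Hfloor] makes the two logarithms agree. *)
Definition side_avail (t x : R) : R :=
  total_avail N M rh (u0 D) p00 T0 (ln_ext d) (fun k => A k t x)
    (fun k => Rh k t x) (P t x) (U t x).

Definition side_flux (t x : R) : R :=
  avail_flux N M rh (u0 D) p00 T0 (ln_ext d) (fun k => A k t x)
    (fun k => Rh k t x) (P t x) (U t x) (fun k => TK k t x) (fun k => HF k t x)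
    (Derive xi t).

Definition moving_avail (t y : R) : R := side_avail t (xi t + y).

Lemma side_adm (s z : R) : S s z -> admissible N M (pl_mix V s z).
Proof.
  intros H. destruct (HSoff _ _ H).
  now apply (rs_admissible _ _ _ _ _ _ _ Hsol).
Qed.

Lemma cont_diff_side_avail : cont_diff side_avail.
Proof.
  assert (CL : forall f, cont_diff f -> cont_diff (fun t x => ln_ext d (f t x))).
  { intros f Hf. apply cont_diff_comp with (fun z => / Rmax d z); auto.
    - intros z. now apply is_derive_ln_ext.
    - intros z. now apply continuous_inv_Rmax. }
  assert (CS : cont_diff (fun t x => sum_phases N (fun k =>
            A k t x * avail M rh p00 T0 (ln_ext d) k (Rh k t x) (P t x)))).
  { apply (cont_diff_sum N (fun k t x =>
            A k t x * avail M rh p00 T0 (ln_ext d) k (Rh k t x) (P t x))).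
    intros k Hk. destruct (CA k Hk) as (CAk & CRk & _).
    unfold avail, Rdiv.
    repeat match goal with
    | |- cont_diff (fun _ _ => ?c) => apply cont_diff_const
    | |- _ => assumption
    | |- cont_diff (fun u v => ln_ext d _) => apply CL
    | |- cont_diff (fun u v => _ + _) => apply cont_diff_plus
    | |- cont_diff (fun u v => _ - _) => apply cont_diff_minus
    | |- cont_diff (fun u v => _ * _) => apply cont_diff_mult
    end. }
  assert (CSM : cont_diff (fun t x => sum_phases N (fun k =>
            A k t x * Rh k t x))).
  { apply (cont_diff_sum N (fun k t x => A k t x * Rh k t x)).
    intros k Hk. destruct (CA k Hk) as (CAk & CRk & _).
    now apply cont_diff_mult. }
  assert (CUU : cont_diff (fun t x => U t x - u0 D)).
  { apply cont_diff_minus; [exact CU | apply cont_diff_const]. }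
  unfold side_avail, total_avail.
  apply (cont_diff_plus _ (fun t x => / 2 * _ * _) CS).
  apply (cont_diff_mult (fun t x => / 2 * _)).
  - apply (cont_diff_mult (fun _ _ => / 2) _ (cont_diff_const _) CSM).
  - now apply cont_diff_mult.
Qed.

Lemma cont_diff_moving_avail : cont_diff moving_avail.
Proof.
  apply cont_diff_moving.
  - exact cont_diff_side_avail.
  - apply (rs_curve _ _ _ _ _ _ _ Hsol).
Qed.

Section Strip.
Variables a b : R.
Hypotheses (Hab : a < b)
  (HS : forall t y, 0 <= t <= tend -> a < y < b -> S t (xi t + y)).

Lemma moving_continuous (f : R -> R -> R) (t y : R) :
  cont_diff f -> continuous (fun z => f t (xi t + z)) y.
Proof.
  intros Hf.
  apply (ex_derive_continuous (K := R_AbsRing) (V := R_NormedModule)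
           (fun z => f t (xi t + z))).
  eexists. apply (is_derive_moving_y (fun z => f t z)). now apply cont_diff_x.
Qed.

(** Holds on the closed strip by continuity, hence also for the traces on the curve, where the flow
    itself is unconstrained. *)
Lemma strip_floor (t y : R) (k : nat) :
  0 <= t <= tend -> a <= y <= b -> (1 <= k <= N)%nat ->
  d <= Rh k t (xi t + y) /\ d <= P t (xi t + y) + pinf M k.
Proof.
  intros Ht Hy Hk. destruct (CA k Hk) as (CAk & CRk & _).
  assert (Hin : forall z, a < z < b ->
    d <= Rh k t (xi t + z) /\ d <= P t (xi t + z) + pinf M k).
  { intros z Hz. pose proof (HS t z Ht Hz) as H.
    destruct (Hrep _ _ H) as (_ & <- & E).
    destruct (E k Hk) as (_ & <- & _).
    apply Hfloor; auto. now apply HSoff. }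
  split.
  - apply (closed_interval_ge (fun z => Rh k t (xi t + z)) a b d Hab); auto.
    + intros z. now apply moving_continuous.
    + intros z Hz. now apply Hin.
  - assert (d - pinf M k <= P t (xi t + y)); [|lra].
    apply (closed_interval_ge (fun z => P t (xi t + z)) a b _ Hab); auto.
    + intros z. now apply moving_continuous.
    + intros z Hz. destruct (Hin z Hz). lra.
Qed.

Lemma strip_fractions (t y : R) : 0 <= t <= tend -> a <= y <= b ->
  (forall k, (1 <= k <= N)%nat -> 0 <= A k t (xi t + y))
  /\ sum_phases N (fun k => A k t (xi t + y)) = 1.
Proof.
  intros Ht Hy. split.
  - intros k Hk. destruct (CA k Hk) as (CAk & _).
    apply (closed_interval_ge (fun z => A k t (xi t + z)) a b 0 Hab); auto.
    + intros z. now apply moving_continuous.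
    + intros z Hz. pose proof (HS t z Ht Hz) as H.
      destruct (Hrep _ _ H) as (_ & _ & E). destruct (E k Hk) as (<- & _).
      apply (proj1 (side_adm _ _ H) k Hk).
  - assert (CS : cont_diff (fun t x => sum_phases N (fun k => A k t x))).
    { apply (cont_diff_sum N A). intros k Hk. exact (proj1 (CA k Hk)). }
    assert (Hin : forall z, a < z < b ->
      sum_phases N (fun k => A k t (xi t + z)) = 1).
    { intros z Hz. pose proof (HS t z Ht Hz) as H.
      rewrite <- (proj2 (side_adm _ _ H)). apply sum_phases_ext.
      intros k Hk. symmetry. now apply (Hrep _ _ H). }
    apply (closed_interval_eq
      (fun z => sum_phases N (fun k => A k t (xi t + z))) a b); auto.
    intros z. apply (moving_continuous _ t z CS).
Qed.

Lemma strip_log (t y : R) (k : nat) :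
  0 <= t <= tend -> a <= y <= b -> (1 <= k <= N)%nat ->
  log_like (ln_ext d) (Rh k t (xi t + y))
  /\ log_like (ln_ext d) (P t (xi t + y) + pinf M k).
Proof.
  intros Ht Hy Hk. destruct (strip_floor t y k Ht Hy Hk).
  split; now apply ln_ext_log_like.
Qed.

Lemma is_derive_side_flux (t y : R) : 0 <= t <= tend -> a <= y <= b ->
  is_derive (fun z => side_flux t (xi t + z)) y
    (davail_flux N M rh (u0 D) p00 T0 (ln_ext d) (fun k => A k t (xi t + y))
      (fun k => Rh k t (xi t + y)) (P t (xi t + y)) (U t (xi t + y))
      (fun k => TK k t (xi t + y)) (fun k => HF k t (xi t + y)) (Derive xi t)
      (fun k => Derive (fun z => A k t z) (xi t + y))
      (fun k => Derive (fun z => Rh k t z) (xi t + y))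
      (Derive (fun z => P t z) (xi t + y)) (Derive (fun z => U t z) (xi t + y))
      (fun k => Derive (fun z => TK k t z) (xi t + y))
      (fun k => Derive (fun z => HF k t z) (xi t + y))).
Proof.
  intros Ht Hy.
  apply (is_derive_moving_y (fun z => side_flux t z)).
  apply (is_derive_avail_flux N M rh (u0 D) p00 T0 (ln_ext d) (proj1 HM)
    (fun k z => A k t z) (fun k z => Rh k t z) (fun z => P t z)
    (fun z => U t z) (fun k z => TK k t z) (fun k z => HF k t z)).
  - intros k Hk. now apply strip_log.
  - intros k Hk. destruct (CA k Hk) as (C1 & C2 & C3 & C4).
    repeat split; now apply cont_diff_x.
  - now apply cont_diff_x.
  - now apply cont_diff_x.
Qed.

Lemma strip_dissipation (t y : R) : 0 < t < tend -> a < y < b ->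
  Derive (fun s => moving_avail s y) t
  + Derive (fun z => side_flux t (xi t + z)) y <= 0.
Proof.
  intros Ht Hy. assert (Ht' : 0 <= t <= tend) by lra.
  assert (Hy' : a <= y <= b) by lra.
  pose proof (is_derive_side_flux t y Ht' Hy') as Hf.
  derive_from Hf.
  pose proof (is_derive_moving_t side_avail xi cont_diff_side_avail
    (proj1 (rs_curve _ _ _ _ _ _ _ Hsol)) t y) as Hm.
  change (fun s : R => moving_avail s y)
    with (fun s : R => side_avail s (xi s + y)).
  derive_from Hm.
  assert (HSt := HS t y Ht' Hy).
  destruct (HSopen _ _ HSt Ht) as [Hnt Hnx].
  set (x := xi t + y) in *.
  assert (E1 : Derive (fun s => side_avail s x) t
    = dtotal_avail N M rh (u0 D) p00 T0 (ln_ext d) (fun k => A k t x)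
      (fun k => Rh k t x) (P t x) (U t x)
      (fun k => Derive (fun s => A k s x) t)
      (fun k => Derive (fun s => Rh k s x) t)
      (Derive (fun s => P s x) t) (Derive (fun s => U s x) t)).
  { apply is_derive_unique.
    apply (is_derive_total_avail N M rh (u0 D) p00 T0 (ln_ext d) (proj1 HM)
      (fun k s => A k s x) (fun k s => Rh k s x) (fun s => P s x)
      (fun s => U s x)); try (now apply cont_diff_t).
    - intros k Hk. now apply strip_log.
    - intros k Hk. destruct (CA k Hk) as (C1 & C2 & _).
      split; now apply cont_diff_t. }
  assert (E2 : Derive (fun z => side_avail t z) x
    = dtotal_avail N M rh (u0 D) p00 T0 (ln_ext d) (fun k => A k t x)
      (fun k => Rh k t x) (P t x) (U t x)
      (fun k => Derive (fun z => A k t z) x)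
      (fun k => Derive (fun z => Rh k t z) x)
      (Derive (fun z => P t z) x) (Derive (fun z => U t z) x)).
  { apply is_derive_unique.
    apply (is_derive_total_avail N M rh (u0 D) p00 T0 (ln_ext d) (proj1 HM)
      (fun k z => A k t z) (fun k z => Rh k t z) (fun z => P t z)
      (fun z => U t z)); try (now apply cont_diff_x).
    - intros k Hk. now apply strip_log.
    - intros k Hk. destruct (CA k Hk) as (C1 & C2 & _).
      split; now apply cont_diff_x. }
  rewrite E1, E2.
  pose proof (point_dissipation N M heat V A Rh TK HF U P S t x HN HM Hrep
    side_adm Hnt Hnx (fun k Hk => proj1 (CA k Hk))
    (fun k Hk => proj1 (proj2 (CA k Hk)))
    (fun k Hk => proj1 (proj2 (proj2 (CA k Hk))))
    (fun k Hk => proj2 (proj2 (proj2 (CA k Hk)))) CU CP) as Hdis.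
  assert (Hoff : x <> xi t) by now apply HSoff.
  specialize (Hdis (rs_equations _ _ _ _ _ _ _ Hsol t (line_point x) Ht Hoff)
    (fun k Hk => Hnoheat k t x Hk Ht Hoff) rh (u0 D) p00 T0 (ln_ext d)
    (Rlt_le _ _ HT0)).
  (* The moving frame adds [Derive xi t] times the slope of the availability, and the relative flux
     subtracts the same term; what remains is the inequality for speed 0. *)
  unfold davail_flux in *. lra.
Qed.

Lemma strip_decay (t : R) : 0 < t < tend ->
  RInt (fun y => Derive (fun s => moving_avail s y) t) a b
  <= side_flux t (xi t + a) - side_flux t (xi t + b).
Proof.
  intros Ht.
  apply (strip_estimate moving_avail (fun t y => side_flux t (xi t + y)) a b t);
    auto.
  - exact cont_diff_moving_avail.
  - intros y Hy. eexists. apply is_derive_side_flux; auto; lra.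
  - intros y Hy. now apply strip_dissipation.
Qed.

Lemma moving_avail_nonneg (t y : R) : 0 <= t <= tend -> a < y < b ->
  0 <= moving_avail t y.
Proof.
  intros Ht Hy. assert (Hy' : a <= y <= b) by lra.
  apply (total_avail_nonneg N M rh (u0 D) p00 T0 (ln_ext d)
           (proj1 HM) Hrh Hp0 HT).
  - intros k Hk. now apply strip_fractions.
  - intros k Hk. destruct (strip_floor t y k Ht Hy' Hk).
    split; [lra | now apply ln_ext_eq].
  - intros k Hk. destruct (strip_floor t y k Ht Hy' Hk).
    split; [lra | now apply ln_ext_eq].
Qed.

(** Density, pressure and velocity start at their rest values, so every phase has zero availability
    and the fractions multiplying it do not matter. *)
Lemma moving_avail_initial (y : R) : a < y < b -> moving_avail 0 y = 0.
Proof.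
  intros Hy. assert (Ht : 0 <= 0 <= tend) by lra.
  pose proof (HS 0 y Ht Hy) as H. destruct (HSoff _ _ H) as [_ Hoff].
  unfold moving_avail, side_avail.
  destruct (rs_curve _ _ _ _ _ _ _ Hsol) as [_ E0].
  rewrite E0 in *. set (x := 0 + y) in *.
  destruct (rs_initial _ _ _ _ _ _ _ Hsol x Hoff) as (Eu & Ep & Er).
  destruct (Hrep _ _ H) as (Ru & Rp & Rk).
  rewrite Ru in Eu. rewrite Rp in Ep. unfold total_avail. rewrite Eu, Ep.
  rewrite (sum_phases_zero N (fun k => A k 0 x * _)).
  - ring.
  - intros k Hk. destruct (Er k Hk) as [Erk _].
    destruct (Rk k Hk) as (_ & Rr & _). rewrite Rr in Erk. rewrite Erk.
    (* The rest state inherits the floor from the flow at time 0, which lets [ln_ext] be replaced by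
       [ln]. *)
    assert (Hf : d <= rh k /\ d <= p00 + pinf M k).
    { destruct (Hfloor 0 x k Ht) as [F1 F2]; auto.
      - now rewrite E0.
      - rewrite Rr, Erk in F1. rewrite Rp, Ep in F2. now split. }
    destruct Hf as [F1 F2].
    replace (avail M rh p00 T0 (ln_ext d) k (rho0 D k) (p0 D))
      with (avail M rh p00 T0 ln k (rh k) p00).
    + rewrite (avail_rest N M D T0) by (auto; exact (proj1 HM)). ring.
    + unfold avail. fold rh p00. now rewrite !ln_ext_eq.
Qed.

End Strip.

Lemma side_flux_represents (t x : R) : S t x ->
  side_flux t x
  = avail_flux N M rh (u0 D) p00 T0 ln (fun k => pl_alpha V k t x)
      (fun k => pl_rho V k t x) (pl_p V t x) (pl_u V t x)
      (fun k => pl_tau M V k t x) (fun k => pl_fourier M V k t x)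
      (Derive xi t).
Proof.
  intros H. destruct (HSoff _ _ H) as [Ht Hoff].
  destruct (Hrep _ _ H) as (Eu & Ep & E).
  unfold side_flux, avail_flux, total_avail. rewrite Eu, Ep.
  rewrite (sum_phases_ext N (fun k => A k t x * avail M rh p00 T0 _ k _ _)
    (fun k => pl_alpha V k t x
              * avail M rh p00 T0 ln k (pl_rho V k t x) (P t x))),
    (sum_phases_ext N (fun k => A k t x * Rh k t x)
      (fun k => pl_alpha V k t x * pl_rho V k t x)),
    (sum_phases_ext N (fun k => A k t x * TK k t x)
      (fun k => pl_alpha V k t x * pl_tau M V k t x)),
    (sum_phases_ext N (fun k => A k t x * HF k t x * _)
      (fun k => pl_alpha V k t x * pl_fourier M V k t x
         * (1 - T0 / temp M k (pl_rho V k t x) (P t x)))); auto;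
    intros k Hk; destruct (E k Hk) as (Ea & Er & Et & Eh).
  - now rewrite Ea, Er, Eh.
  - now rewrite Ea, Et.
  - now rewrite Ea, Er.
  - destruct (Hfloor t x k Ht Hoff Hk) as [F1 F2].
    rewrite Er in *. rewrite Ep in F2. rewrite Ea.
    unfold avail. now rewrite !ln_ext_eq.
Qed.

(** Zero availability settles only the phases with nonzero fraction. For the others the relaxation
    heat vanishes, which determines their temperature, and the density follows from temperature and
    pressure. *)
Lemma side_at_rest (t x : R) : S t x -> 0 < t < tend -> side_avail t x = 0 ->
  U t x = u0 D /\ P t x = p00
  /\ forall k, (1 <= k <= N)%nat -> Rh k t x = rh k.
Proof.
  intros H Ht E.
  destruct (HSoff _ _ H) as [Ht' Hoff].
  destruct (Hrep _ _ H) as (Eu & Ep & Ek).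
  destruct (HSopen _ _ H Ht) as [Hnt Hnx].
  assert (Hgas : forall k, (1 <= k <= N)%nat ->
    0 <= A k t x /\ 0 < Rh k t x /\ 0 < P t x + pinf M k
    /\ ln_ext d (Rh k t x) = ln (Rh k t x)
    /\ ln_ext d (P t x + pinf M k) = ln (P t x + pinf M k)).
  { intros k Hk. destruct (Hfloor t x k Ht' Hoff Hk) as [F1 F2].
    destruct (Ek k Hk) as (Ea & Er & _).
    rewrite Er in F1. rewrite Ep in F2. rewrite <- Ea.
    repeat split; try lra; try (now apply ln_ext_eq).
    apply (proj1 (side_adm _ _ H) k Hk). }
  assert (Hsum : sum_phases N (fun k => A k t x) = 1).
  { rewrite <- (proj2 (side_adm _ _ H)). apply sum_phases_ext.
    intros k Hk. symmetry. now apply Ek. }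
  destruct (total_avail_zero N M rh (u0 D) p00 T0 (ln_ext d)
    (proj1 HM) Hrh Hp0 HT (fun k => A k t x) (fun k => Rh k t x)
    (P t x) (U t x)) as (E1 & E2 & E3); auto;
    try (intros k Hk; destruct (Hgas k Hk) as (?&?&?&?&?); auto).
  split; [exact E1|]. split; [exact E2|].
  set (Tk := fun k => temp M k (Rh k t x) (P t x)).
  set (sg := fun j k => sig M j k (pl_mix V t x)).
  assert (Hsg : forall j k, (1 <= j <= N)%nat -> (1 <= k <= N)%nat -> j <> k ->
    0 < sg j k).
  { intros j k Hj Hk Hn.
    apply (proj2 (proj2 HM _ (side_adm _ _ H))); auto. }
  assert (Hex : exists j, (1 <= j <= N)%nat /\ A j t x <> 0).
  { destruct (Req_dec (A 1%nat t x) 0) as [Ez|Hn];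
      [|exists 1%nat; split; [lia | auto]].
    assert (Hind : forall n, (forall j, (1 <= j <= n)%nat -> A j t x = 0)
      \/ exists j, (1 <= j <= n)%nat /\ A j t x <> 0).
    { induction n as [|n [IH|[j [Hj IH]]]].
      - left. intros; lia.
      - destruct (Req_dec (A (Datatypes.S n) t x) 0) as [E0|E0].
        + left. intros j Hj.
          destruct (Nat.eq_dec j (Datatypes.S n)) as [->|]; auto.
          apply IH; lia.
        + right. exists (Datatypes.S n). split; [lia | auto].
      - right. exists j. split; [lia | auto]. }
    destruct (Hind N) as [Hz|Hj]; auto.
    rewrite (sum_phases_zero N (fun k => A k t x)) in Hsum by exact Hz. lra. }
  assert (HTp : forall k, (1 <= k <= N)%nat -> A k t x <> 0 -> Tk k = T0).
  { intros k Hk Hak. unfold Tk. rewrite E3, E2 by auto. now apply HT. }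
  assert (HQ : forall k, (1 <= k <= N)%nat -> ~ A k t x <> 0 ->
    sum_other_phases N k (fun j => sg j k * (Tk j - Tk k)) = 0).
  { intros k Hk Hak. assert (Hak0 : A k t x = 0).
    { destruct (Req_dec (A k t x) 0); auto. contradiction. }
    exact (point_absent N M heat V A Rh TK HF U P S t x HN HM Hrep
      side_adm Hnt Hnx (fun k Hk => proj1 (CA k Hk))
      (fun k Hk => proj1 (proj2 (CA k Hk)))
      (fun k Hk => proj1 (proj2 (proj2 (CA k Hk))))
      (fun k Hk => proj2 (proj2 (proj2 (CA k Hk)))) CU CP
      (rs_equations _ _ _ _ _ _ _ Hsol t (line_point x) Ht Hoff)
      (fun k Hk => Hnoheat k t x Hk Ht Hoff) k Hk Hak0). }
  assert (Hdec : forall k, (1 <= k <= N)%nat ->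
    A k t x <> 0 \/ ~ A k t x <> 0).
  { intros k _. destruct (Req_dec (A k t x) 0); [right|left]; auto. }
  intros k Hk.
  assert (HTk : Tk k = T0).
  { apply Rle_antisym.
    - apply (absent_phases_relax N sg Tk (fun k => A k t x <> 0) T0); auto.
    - apply Ropp_le_cancel.
      (* The lower bound is the same maximum principle applied to the negated temperatures. *)
      apply (absent_phases_relax N sg (fun k => - Tk k)
               (fun k => A k t x <> 0) (- T0)); auto.
      + intros j Hj Hp. now rewrite HTp.
      + intros j Hj Hp.
        transitivity (- sum_other_phases N j (fun i => sg i j * (Tk i - Tk j)));
          [|rewrite (HQ j Hj Hp); ring].
        unfold sum_other_phases.
        rewrite <- sum_phases_opp. apply sum_phases_ext. intros i Hi.
        destruct (Nat.eqb i j); ring. }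
  destruct (Hgas k Hk) as (_ & Hr & Hq & _).
  rewrite <- (density_of_temp N M (proj1 HM) k (Rh k t x) (P t x)) by auto.
  change (temp M k (Rh k t x) (P t x)) with (Tk k). rewrite HTk, E2.
  apply (rest_density N M D T0 (proj1 HM) Hrh Hp0 HT k Hk).
Qed.

(** At times 0 and [tend] no equation is available for the absent phases. The line of constant y
    stays on one side of the curve, and continuity of the extensions along it carries the rest
    values to both ends. *)
Lemma strip_at_rest (a b : R) :
  (forall t y, 0 <= t <= tend -> a < y < b -> S t (xi t + y)) ->
  (forall t y, 0 <= t <= tend -> a < y < b -> moving_avail t y = 0) ->
  forall t y, 0 <= t <= tend -> a < y < b ->
    pl_u V t (xi t + y) = u0 D /\ pl_p V t (xi t + y) = p00
    /\ forall k, (1 <= k <= N)%nat -> pl_T M V k t (xi t + y) = T0.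
Proof.
  intros HS H0 t y Ht Hy.
  assert (Hcont : forall f, cont_diff f ->
    forall s, continuous (fun s => f s (xi s + y)) s).
  { intros f Hf s.
    apply (ex_derive_continuous (K := R_AbsRing) (V := R_NormedModule)
             (fun s => f s (xi s + y))).
    eexists. apply is_derive_moving_t; [exact Hf|].
    apply (rs_curve _ _ _ _ _ _ _ Hsol). }
  assert (Hrest : forall s, 0 < s < tend ->
    U s (xi s + y) = u0 D /\ P s (xi s + y) = p00
    /\ forall k, (1 <= k <= N)%nat -> Rh k s (xi s + y) = rh k).
  { intros s Hs. assert (Hs' : 0 <= s <= tend) by lra.
    apply side_at_rest; auto. apply (H0 s y Hs' Hy). }
  destruct (Hrep _ _ (HS t y Ht Hy)) as (-> & Ep & E).
  split; [|split].
  - apply (closed_interval_eq (fun s => U s (xi s + y)) 0 tend); auto.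
    intros s Hs. now apply Hrest.
  - rewrite Ep.
    apply (closed_interval_eq (fun s => P s (xi s + y)) 0 tend); auto.
    intros s Hs. now apply Hrest.
  - intros k Hk. unfold pl_T. destruct (E k Hk) as (_ & -> & _). rewrite Ep.
    rewrite (closed_interval_eq (fun s => P s (xi s + y)) 0 tend p00); auto.
    + rewrite (closed_interval_eq (fun s => Rh k s (xi s + y)) 0 tend (rh k));
        auto.
      * apply Hcont. exact (proj1 (proj2 (CA k Hk))).
      * intros s Hs. now apply Hrest.
    + intros s Hs. now apply Hrest.
Qed.

End Side.

Definition left_of (s z : R) : Prop := 0 <= s <= tend /\ z < xi s.
Definition right_of (s z : R) : Prop := 0 <= s <= tend /\ xi s < z.

Lemma locally_time (t : R) :
  0 < t < tend -> locally t (fun s => 0 <= s <= tend).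
Proof.
  intros Ht.
  refine (filter_imp _ _ _ (filter_and _ _
    (locally_between (fun _ => 0) (fun s => s) t (continuous_const 0 t)
       (continuous_id t) (proj1 Ht))
    (locally_between (fun s => s) (fun _ => tend) t (continuous_id t)
       (continuous_const tend t) (proj2 Ht)))).
  intros s [H1 H2]. lra.
Qed.

Lemma left_open (t x : R) : left_of t x -> 0 < t < tend ->
  locally t (fun s => left_of s x) /\ locally x (fun z => left_of t z).
Proof.
  intros [Ht Hx] Ht'. split.
  - apply filter_and; [now apply locally_time|].
    apply (locally_between (fun _ => x) xi); auto.
    + apply continuous_const.
    + apply curve_continuous.
  - refine (filter_imp _ _ _ (locally_between (fun z => z) (fun _ => xi t) x
      (continuous_id x) (continuous_const (xi t) x) Hx)).
    intros z Hz. now split.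
Qed.

Lemma right_open (t x : R) : right_of t x -> 0 < t < tend ->
  locally t (fun s => right_of s x) /\ locally x (fun z => right_of t z).
Proof.
  intros [Ht Hx] Ht'. split.
  - apply filter_and; [now apply locally_time|].
    apply (locally_between xi (fun _ => x)); auto.
    + apply curve_continuous.
    + apply continuous_const.
  - refine (filter_imp _ _ _ (locally_between (fun _ => xi t) (fun z => z) x
      (continuous_const (xi t) x) (continuous_id x) Hx)).
    intros z Hz. now split.
Qed.

Lemma left_off (s z : R) : left_of s z -> 0 <= s <= tend /\ z <> xi s.
Proof. intros [H1 H2]. split; auto. lra. Qed.

Lemma right_off (s z : R) : right_of s z -> 0 <= s <= tend /\ z <> xi s.
Proof. intros [H1 H2]. split; auto. lra. Qed.

Lemma left_strip (a t y : R) :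
  0 <= t <= tend -> a < y < 0 -> left_of t (xi t + y).
Proof. intros Ht Hy. split; lra. Qed.

Lemma right_strip (b t y : R) :
  0 <= t <= tend -> 0 < y < b -> right_of t (xi t + y).
Proof. intros Ht Hy. split; lra. Qed.

(** * Joining the two sides across the curve *)

Section BothSides.
Variables (AL RL TL HL : nat -> R -> R -> R) (UL PL : R -> R -> R)
  (AR RR TR HR : nat -> R -> R -> R) (UR PR : R -> R -> R).
Hypotheses
  (HrepL : forall s z, left_of s z -> represents N M V AL RL TL HL UL PL s z)
  (CUL : cont_diff UL) (CPL : cont_diff PL)
  (CL : forall k, (1 <= k <= N)%nat ->
         cont_diff (AL k) /\ cont_diff (RL k) /\ cont_diff (TL k)
         /\ cont_diff (HL k))
  (HrepR : forall s z, right_of s z -> represents N M V AR RR TR HR UR PR s z)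
  (CUR : cont_diff UR) (CPR : cont_diff PR)
  (CR : forall k, (1 <= k <= N)%nat ->
         cont_diff (AR k) /\ cont_diff (RR k) /\ cont_diff (TR k)
         /\ cont_diff (HR k)).

Let hL := moving_avail AL RL UL PL.
Let hR := moving_avail AR RR UR PR.
Let GL := side_flux AL RL TL HL UL PL.
Let GR := side_flux AR RR TR HR UR PR.

Ltac cont_diff_tac :=
  repeat match goal with
  | |- cont_diff (fun _ _ => ?c) => apply cont_diff_const
  | |- _ => assumption
  | |- cont_diff (fun u v => sum_phases N _) =>
      apply cont_diff_sum; intros ? Hk';
      destruct (CL _ Hk') as (?&?&?&?); destruct (CR _ Hk') as (?&?&?&?)
  | |- cont_diff (fun u v => _ + _) => apply cont_diff_plus
  | |- cont_diff (fun u v => _ - _) => apply cont_diff_minus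
  | |- cont_diff (fun u v => - _) => apply cont_diff_opp
  | |- cont_diff (fun u v => _ * _) => apply cont_diff_mult
  end.

Lemma flux_no_jump (t : R) : 0 < t < tend -> GL t (xi t) = GR t (xi t).
Proof.
  intros Ht. assert (Ht' : 0 <= t <= tend) by lra.
  (* Strips of unit width on either side of the curve; their closed ends at y = 0 provide admissible
     traces. *)
  assert (H10 : -1 < 0) by lra. assert (H01 : 0 < 1) by lra.
  assert (HyL : -1 <= 0 <= 0) by lra. assert (HyR : 0 <= 0 <= 1) by lra.
  destruct (strip_fractions AL RL TL HL UL PL left_of HrepL CL left_off
    (-1) 0 H10 (left_strip (-1)) t 0 Ht' HyL) as [FL SL].
  destruct (strip_fractions AR RR TR HR UR PR right_of HrepR CR right_off
    0 1 H01 (right_strip 1) t 0 Ht' HyR) as [_ SR].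
  pose proof (fun k => strip_floor AL RL TL HL UL PL left_of HrepL CPL CL
    left_off (-1) 0 H10 (left_strip (-1)) t 0 k Ht' HyL) as GaL.
  pose proof (fun k => strip_floor AR RR TR HR UR PR right_of HrepR CPR CR
    right_off 0 1 H01 (right_strip 1) t 0 k Ht' HyR) as GaR.
  rewrite Rplus_0_r in *.
  set (s := Derive xi t).
  assert (ErL : forall z, z < xi t ->
    represents N M V AL RL TL HL UL PL t z)
    by (intros z Hz; apply HrepL; now split).
  assert (ErR : forall z, xi t < z ->
    represents N M V AR RR TR HR UR PR t z)
    by (intros z Hz; apply HrepR; now split).
  destruct (rs_continuity _ _ _ _ _ _ _ Hsol t Ht) as [Ju Jk].
  apply (avail_flux_continuous N M rh (u0 D) p00 T0 (ln_ext d) (proj1 HM));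
    auto.
  - intros k Hk. destruct (GaL k Hk), (GaR k Hk). repeat split; lra.
  - apply (no_jump_eq (pl_u V t) (fun z => UL t z) (fun z => UR t z)); auto.
    + intros z Hz. now apply ErL.
    + intros z Hz. now apply ErR.
    + now apply continuous_section.
    + now apply continuous_section.
  - intros k Hk. destruct (Jk k Hk) as [JT Jh].
    destruct (CL k Hk) as (?&?&?&?). destruct (CR k Hk) as (?&?&?&?).
    destruct (GaL k Hk), (GaR k Hk).
    split; [|split].
    + apply (no_jump_eq (pl_T M V k t)
        (fun z => temp M k (RL k t z) (PL t z))
        (fun z => temp M k (RR k t z) (PR t z))); auto.
      * intros z Hz. destruct (ErL z Hz) as (_ & Ep & E). unfold pl_T.
        now destruct (E k Hk) as (_ & -> & _); rewrite Ep.
      * intros z Hz. destruct (ErR z Hz) as (_ & Ep & E). unfold pl_T.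
        now destruct (E k Hk) as (_ & -> & _); rewrite Ep.
      * apply (ex_derive_continuous (K := R_AbsRing) (V := R_NormedModule)
          (fun z => temp M k (RL k t z) (PL t z))). eexists.
        apply (is_derive_temp N M (proj1 HM) k (fun z => RL k t z)
                 (fun z => PL t z)); auto; try lra; now apply cont_diff_x.
      * apply (ex_derive_continuous (K := R_AbsRing) (V := R_NormedModule)
          (fun z => temp M k (RR k t z) (PR t z))). eexists.
        apply (is_derive_temp N M (proj1 HM) k (fun z => RR k t z)
                 (fun z => PR t z)); auto; try lra; now apply cont_diff_x.
    + apply (no_jump_eq (on_line (heat_flux M (embed V) k ax0) t)
        (fun z => AL k t z * HL k t z) (fun z => AR k t z * HR k t z)); auto.
      * intros z Hz. rewrite heat_flux_line.
        destruct (ErL z Hz) as (_ & _ & E).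
        now destruct (E k Hk) as (-> & _ & _ & ->).
      * intros z Hz. rewrite heat_flux_line.
        destruct (ErR z Hz) as (_ & _ & E).
        now destruct (E k Hk) as (-> & _ & _ & ->).
      * apply (continuous_section (fun t z => AL k t z * HL k t z)).
        cont_diff_tac.
      * apply (continuous_section (fun t z => AR k t z * HR k t z)).
        cont_diff_tac.
    + assert (J : AL k t (xi t) * RL k t (xi t) * UL t (xi t)
                  - s * (AL k t (xi t) * RL k t (xi t))
                  = AR k t (xi t) * RR k t (xi t) * UR t (xi t)
                  - s * (AR k t (xi t) * RR k t (xi t))).
      { apply (no_jump_eq _
          (fun z => AL k t z * RL k t z * UL t z - s * (AL k t z * RL k t z))
          (fun z => AR k t z * RR k t z * UR t z - s * (AR k t z * RR k t z))
          _ (rs_jump_mass _ _ _ _ _ _ _ Hsol t k Ht Hk)).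
        - intros z Hz. rewrite mass_flux_line.
          destruct (ErL z Hz) as (-> & _ & E).
          now destruct (E k Hk) as (-> & -> & _).
        - intros z Hz. rewrite mass_flux_line.
          destruct (ErR z Hz) as (-> & _ & E).
          now destruct (E k Hk) as (-> & -> & _).
        - apply (continuous_section (fun t z =>
            AL k t z * RL k t z * UL t z - s * (AL k t z * RL k t z))).
          cont_diff_tac.
        - apply (continuous_section (fun t z =>
            AR k t z * RR k t z * UR t z - s * (AR k t z * RR k t z))).
          cont_diff_tac. }
      cbv beta. fold s. lra.
  - set (mom := fun (A Rh T : nat -> R -> R -> R) (U P : R -> R -> R) t z =>
      sum_phases N (fun k => A k t z * Rh k t z) * U t z * U t z
      - (- P t z * 1 + sum_phases N (fun k => A k t z * T k t z))
      - s * (sum_phases N (fun k => A k t z * Rh k t z) * U t z)).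
    assert (J : mom AL RL TL UL PL t (xi t) = mom AR RR TR UR PR t (xi t)).
    { apply (no_jump_eq _ (fun z => mom AL RL TL UL PL t z)
          (fun z => mom AR RR TR UR PR t z)
          _ (rs_jump_momentum _ _ _ _ _ _ _ Hsol t ax0 Ht)).
      - intros z Hz. rewrite momentum_flux_line, momentum_line.
        rewrite (sum_region_mass N M V AL RL TL HL UL PL left_of HrepL),
          (sum_region_viscous N M V AL RL TL HL UL PL left_of HrepL)
          by now split.
        now destruct (ErL z Hz) as (-> & -> & _).
      - intros z Hz. rewrite momentum_flux_line, momentum_line.
        rewrite (sum_region_mass N M V AR RR TR HR UR PR right_of HrepR),
          (sum_region_viscous N M V AR RR TR HR UR PR right_of HrepR)
          by now split.
        now destruct (ErR z Hz) as (-> & -> & _).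
      - apply (continuous_section (mom AL RL TL UL PL) t (xi t)).
        unfold mom. cont_diff_tac.
      - apply (continuous_section (mom AR RR TR UR PR) t (xi t)).
        unfold mom. cont_diff_tac. }
    unfold mom in J. cbv beta. fold s. lra.
  - intros l Hl. assert (Hl' : (1 <= l <= N)%nat) by lia.
    destruct (CL l Hl') as (?&?&?&?). destruct (CR l Hl') as (?&?&?&?).
    apply (no_jump_eq _ (fun z => (UL t z - s) * AL l t z)
          (fun z => (UR t z - s) * AR l t z)
          _ (rs_jump_alpha _ _ _ _ _ _ _ Hsol t l Ht Hl)).
    + intros z Hz. destruct (ErL z Hz) as (-> & _ & E).
      now destruct (E l Hl') as (-> & _).
    + intros z Hz. destruct (ErR z Hz) as (-> & _ & E).
      now destruct (E l Hl') as (-> & _).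
    + apply (continuous_section (fun t z => (UL t z - s) * AL l t z)).
      cont_diff_tac.
    + apply (continuous_section (fun t z => (UR t z - s) * AR l t z)).
      cont_diff_tac.
Qed.

Lemma left_nonneg (t y : R) : 0 <= t <= tend -> y < 0 -> 0 <= hL t y.
Proof.
  intros Ht Hy. assert (Hy' : y - 1 < y < 0) by lra.
  apply (moving_avail_nonneg AL RL TL HL UL PL left_of HrepL CPL CL left_off
    (y - 1) 0 ltac:(lra) (left_strip (y - 1))); auto.
Qed.

Lemma right_nonneg (t y : R) : 0 <= t <= tend -> 0 < y -> 0 <= hR t y.
Proof.
  intros Ht Hy. assert (Hy' : 0 < y < y + 1) by lra.
  apply (moving_avail_nonneg AR RR TR HR UR PR right_of HrepR CPR CR right_off
    0 (y + 1) ltac:(lra) (right_strip (y + 1))); auto.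
Qed.

Lemma left_cont_diff : cont_diff hL.
Proof. exact (cont_diff_moving_avail AL RL TL HL UL PL CUL CPL CL). Qed.

Lemma right_cont_diff : cont_diff hR.
Proof. exact (cont_diff_moving_avail AR RR TR HR UR PR CUR CPR CR). Qed.

(** In the derivative of the two integrals the fluxes at the curve cancel by [flux_no_jump], leaving
    the fluxes at the far ends, while the initial value is zero. *)
Lemma total_avail_small (eps : R) : 0 < eps ->
  exists B0, forall B t, B0 < B -> 0 < B -> 0 <= t <= tend ->
    RInt (fun y => hL t y) (- B) 0 + RInt (fun y => hR t y) 0 B <= eps.
Proof.
  (* Two far ends, each contributing at most e per unit time over a duration of at most [tend]. *)
  intros He. set (e := eps / (2 * tend)).
  assert (Hpos : 0 < e) by (apply Rdiv_lt_0_compat; lra).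
  destruct (avail_flux_far N M heat D tend V xi T0 Htend Hsol (proj1 HM)
    Hrh Hp0 HT e Hpos) as [B1 HB1].
  destruct (continuous_bounded tend xi Htend curve_continuous) as [C HC].
  (* The curve moves by at most C, so both points xi s - B and xi s + B lie farther than B1 from the
     origin. *)
  exists (Rabs B1 + C). intros B t HB HB0 Ht.
  pose proof (Rle_abs B1). pose proof (Rabs_pos B1).
  set (K := fun s => RInt (fun y => hL s y) (- B) 0
                     + RInt (fun y => hR s y) 0 B).
  set (dK := fun s =>
    RInt (fun y => Derive (fun r => hL r y) s) (- B) 0
    + RInt (fun y => Derive (fun r => hR r y) s) 0 B).
  assert (HdK : forall s, is_derive K s (dK s)).
  { intros s. apply (is_derive_plus (K := R_AbsRing)
      (fun s => RInt (fun y => hL s y) (- B) 0)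
      (fun s => RInt (fun y => hR s y) 0 B)).
    - apply is_derive_RInt_cont_diff, left_cont_diff.
    - apply is_derive_RInt_cont_diff, right_cont_diff. }
  assert (Hsmall : forall s, 0 < s < tend -> dK s <= 2 * e).
  { intros s Hs. assert (Hs' : 0 <= s <= tend) by lra.
    pose proof (strip_decay AL RL TL HL UL PL left_of HrepL CUL CPL CL left_off
      left_open (- B) 0 ltac:(lra) (left_strip (- B)) s Hs) as HdL.
    pose proof (strip_decay AR RR TR HR UR PR right_of HrepR CUR CPR CR right_off
      right_open 0 B ltac:(lra) (right_strip B) s Hs) as HdR.
    rewrite Rplus_0_r in HdL, HdR.
    pose proof (flux_no_jump s Hs) as Hj. unfold GL, GR in Hj.
    assert (Hxi : - C <= xi s <= C) by (apply Rabs_le_between, HC, Hs').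
    assert (EL : Rabs (side_flux AL RL TL HL UL PL s (xi s + - B)) < e).
    { rewrite (side_flux_represents AL RL TL HL UL PL left_of HrepL left_off)
        by (apply (left_strip (- B - 1)); auto; lra).
      apply HB1; auto. rewrite Rabs_left1; lra. }
    assert (ER : Rabs (side_flux AR RR TR HR UR PR s (xi s + B)) < e).
    { rewrite (side_flux_represents AR RR TR HR UR PR right_of HrepR right_off)
        by (apply (right_strip (B + 1)); auto; lra).
      apply HB1; auto. rewrite Rabs_right; lra. }
    apply Rabs_def2 in EL. apply Rabs_def2 in ER.
    unfold dK, hL, hR. lra. }
  assert (HK0 : K 0 = 0).
  { unfold K. rewrite (RInt_ext (fun y => hL 0 y) (fun _ => 0)),
      (RInt_ext (fun y => hR 0 y) (fun _ => 0)), !RInt_const.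
    - unfold scal; simpl; unfold mult; simpl. ring.
    - rewrite Rmin_left, Rmax_right by lra. intros y Hy.
      apply (moving_avail_initial AR RR TR HR UR PR right_of HrepR right_off
        0 B (right_strip B)); auto.
    - rewrite Rmin_left, Rmax_right by lra. intros y Hy.
      apply (moving_avail_initial AL RL TL HL UL PL left_of HrepL left_off
        (- B) 0 (left_strip (- B))); auto. }
  destruct (MVT_gen K 0 t (fun s => Rmin (2 * e) (dK s))) as [c [_ E]].
  - rewrite Rmin_left, Rmax_right by lra. intros s Hs.
    rewrite Rmin_right by (apply Hsmall; lra). apply HdK.
  - intros s _. apply continuity_pt_filterlim.
    apply (ex_derive_continuous (K := R_AbsRing) (V := R_NormedModule) K).
    eexists. apply HdK.
  - rewrite HK0 in E. change (K t <= eps).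
    pose proof (Rmin_l (2 * e) (dK c)).
    assert (Rmin (2 * e) (dK c) * (t - 0) <= 2 * e * tend).
    { apply Rle_trans with (2 * e * (t - 0)).
      - apply Rmult_le_compat_r; lra.
      - apply Rmult_le_compat_l; lra. }
    assert (2 * e * tend = eps) by (unfold e; field; lra). lra.
Qed.

Lemma ex_RInt_section (f : R -> R -> R) (t a b : R) :
  cont_diff f -> ex_RInt (fun y => f t y) a b.
Proof.
  intros Hf. apply (ex_RInt_continuous (V := R_CompleteNormedModule)).
  intros. now apply continuous_section.
Qed.

Lemma left_vanishes (t y : R) : 0 <= t <= tend -> y < 0 -> hL t y = 0.
Proof.
  intros Ht Hy.
  apply (RInt_ge0_eq0 (fun y => hL t y) (y - 1) 0); try lra.
  - intros z. apply continuous_section, left_cont_diff.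
  - intros z Hz. apply left_nonneg; auto; lra.
  - apply Rnot_lt_le. intros Hlt.
    set (I := RInt (fun y => hL t y) (y - 1) 0) in *.
    (* If I were positive, a window containing [y - 1, 0] would have total availability at most I /
       2; yet nonnegativity makes that total at least I. *)
    destruct (total_avail_small (I / 2)) as [B0 HB]; [lra|].
    set (B := Rmax B0 (1 - y) + 1).
    pose proof (Rmax_l B0 (1 - y)). pose proof (Rmax_r B0 (1 - y)).
    assert (HBt : RInt (fun y => hL t y) (- B) 0
                  + RInt (fun y => hR t y) 0 B <= I / 2)
      by (apply HB; auto; unfold B; lra).
    assert (H1 : RInt (fun y => hL t y) (- B) (y - 1) + I
                 = RInt (fun y => hL t y) (- B) 0).
    { apply (RInt_Chasles (fun y => hL t y) (- B) (y - 1) 0);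
        apply ex_RInt_section, left_cont_diff. }
    assert (H2 : 0 <= RInt (fun y => hL t y) (- B) (y - 1)).
    { apply RInt_ge_0; [unfold B; lra | apply ex_RInt_section, left_cont_diff|].
      intros z Hz. apply left_nonneg; auto; lra. }
    assert (H3 : 0 <= RInt (fun y => hR t y) 0 B).
    { apply RInt_ge_0; [unfold B; lra | apply ex_RInt_section, right_cont_diff|].
      intros z Hz. apply right_nonneg; auto; lra. }
    lra.
Qed.

Lemma right_vanishes (t y : R) : 0 <= t <= tend -> 0 < y -> hR t y = 0.
Proof.
  intros Ht Hy.
  apply (RInt_ge0_eq0 (fun y => hR t y) 0 (y + 1)); try lra.
  - intros z. apply continuous_section, right_cont_diff.
  - intros z Hz. apply right_nonneg; auto; lra.
  - apply Rnot_lt_le. intros Hlt.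
    set (I := RInt (fun y => hR t y) 0 (y + 1)) in *.
    destruct (total_avail_small (I / 2)) as [B0 HB]; [lra|].
    set (B := Rmax B0 (y + 1) + 1).
    pose proof (Rmax_l B0 (y + 1)). pose proof (Rmax_r B0 (y + 1)).
    assert (HBt : RInt (fun y => hL t y) (- B) 0
                  + RInt (fun y => hR t y) 0 B <= I / 2)
      by (apply HB; auto; unfold B; lra).
    assert (H1 : I + RInt (fun y => hR t y) (y + 1) B
                 = RInt (fun y => hR t y) 0 B).
    { apply (RInt_Chasles (fun y => hR t y) 0 (y + 1) B);
        apply ex_RInt_section, right_cont_diff. }
    assert (H2 : 0 <= RInt (fun y => hR t y) (y + 1) B).
    { apply RInt_ge_0; [unfold B; lra | apply ex_RInt_section, right_cont_diff|].
      intros z Hz. apply right_nonneg; auto; lra. }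
    assert (H3 : 0 <= RInt (fun y => hL t y) (- B) 0).
    { apply RInt_ge_0; [unfold B; lra | apply ex_RInt_section, left_cont_diff|].
      intros z Hz. apply left_nonneg; auto; lra. }
    lra.
Qed.

Lemma both_sides_at_rest : preserves_PVT N M (u0 D) p00 T0 tend V xi.
Proof.
  intros t x Ht Hx. set (y := x - xi t).
  replace x with (xi t + y) by (unfold y; ring).
  destruct (Rtotal_order x (xi t)) as [H|[H|H]]; [|contradiction|].
  - apply (strip_at_rest AL RL TL HL UL PL left_of HrepL CUL CPL CL left_off
      left_open (y - 1) 0 (left_strip (y - 1))); auto; [|unfold y; lra].
    intros s z Hs Hz. apply left_vanishes; auto; lra.
  - apply (strip_at_rest AR RR TR HR UR PR right_of HrepR CUR CPR CR right_off
      right_open 0 (y + 1) (right_strip (y + 1))); auto; [|unfold y; lra].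
    intros s z Hs Hz. apply right_vanishes; auto; lra.
Qed.

End BothSides.

Lemma solution_at_rest : preserves_PVT N M (u0 D) p00 T0 tend V xi.
Proof.
  destruct (smooth_on_represents _ _ _ _ (rs_smooth_left _ _ _ _ _ _ _ Hsol))
    as (AL & RL & TL & HL & UL & PL & HrepL & CUL & CPL & CL).
  destruct (smooth_on_represents _ _ _ _ (rs_smooth_right _ _ _ _ _ _ _ Hsol))
    as (AR & RR & TR & HR & UR & PR & HrepR & CUR & CPR & CR).
  exact (both_sides_at_rest AL RL TL HL UL PL AR RR TR HR UR PR
           HrepL CUL CPL CL HrepR CUR CPR CR).
Qed.

End Solution.

(** * The advected contact *)

Definition contact (aL aR rh : nat -> R) (u q : R) : plane_flow :=
  PlaneFlow (fun k t x => if Rlt_dec x (u * t) then aL k else aR k)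
            (fun k _ _ => rh k) (fun _ _ => u) (fun _ _ => q).

Lemma no_jump_constant (f : R -> R) (x c : R) :
  (forall y, f y = c) -> no_jump f x.
Proof.
  intros H. exists c.
  split; apply filterlim_ext with (fun _ => c); auto; apply filterlim_const.
Qed.

Lemma cont_diff_up_to_constant (S : R -> R -> Prop) (f : R -> R -> R) (c : R) :
  (forall t x, S t x -> f t x = c) -> cont_diff_up_to S f.
Proof. intros H. exists (fun _ _ => c). split; auto. apply cont_diff_const. Qed.

Section Contact.
Variables (N : nat) (M : material) (heat : nat -> R -> R -> R)
  (aL aR rh : nat -> R) (u q T tend : R).
Hypotheses (HM : physical_material N M)
  (Hheat : forall k t x, (1 <= k <= N)%nat -> heat k t x = 0)
  (HT : 0 < T)
  (Hrh : forall k, (1 <= k <= N)%nat -> 0 < rh k)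
  (HTk : forall k, (1 <= k <= N)%nat -> temp M k (rh k) q = T)
  (HaL : (forall k, (1 <= k <= N)%nat -> 0 <= aL k) /\ sum_phases N aL = 1)
  (HaR : (forall k, (1 <= k <= N)%nat -> 0 <= aR k) /\ sum_phases N aR = 1).

Let V := contact aL aR rh u q.
Let F := embed V.
Let uu (i : axis) : R := match i with ax0 => u | _ => 0 end.

Lemma contact_vel (i : axis) (t : R) (Y : point) : vel F i t Y = uu i.
Proof. now destruct i. Qed.

Lemma contact_strain (i j : axis) (t : R) (Y : point) :
  strain F i j t Y = 0.
Proof.
  unfold F. rewrite strain_plane. destruct i, j; auto.
  exact (Derive_const u (Y ax0)).
Qed.

Lemma contact_div_u (t : R) (Y : point) : div_u F t Y = 0.
Proof. unfold F. rewrite div_u_plane. exact (Derive_const u (Y ax0)). Qed.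

Lemma contact_tau_phase (k : nat) (i j : axis) (t : R) (Y : point) :
  tau_ M F k i j t Y = 0.
Proof. unfold tau_. rewrite contact_strain, contact_div_u. ring. Qed.

Lemma contact_tau (i j : axis) (t : R) (Y : point) : tau N M F i j t Y = 0.
Proof.
  unfold tau. apply sum_phases_zero. intros k _.
  rewrite contact_tau_phase. ring.
Qed.

Lemma contact_stress (i j : axis) (t : R) (Y : point) :
  stress N M F i j t Y = - q * kron i j.
Proof. unfold stress. rewrite contact_tau. simpl. unfold lift. ring. Qed.

Lemma contact_temp_slope (k : nat) (i : axis) (t : R) (Y : point) :
  d_x i (T_ M F k) t Y = 0.
Proof. now apply d_x_const with (temp M k (rh k) q). Qed.

Lemma contact_heat_flux (k : nat) (i : axis) (t : R) (Y : point) :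
  heat_flux M F k i t Y = 0.
Proof. unfold heat_flux. rewrite contact_temp_slope. ring. Qed.

Lemma contact_q (k : nat) (t : R) (Y : point) : q_ M F k t Y = 0.
Proof.
  unfold q_, divergence, sum_axes.
  rewrite !(d_x_const _ _ _ _ 0) by (intros; apply contact_heat_flux). ring.
Qed.

Lemma contact_G (k : nat) (t : R) (Y : point) : (1 <= k <= N)%nat ->
  G_ N M (fun k => lift (heat k)) F k t Y = 0.
Proof.
  intros Hk. unfold G_, I_, ddot, sum_axes, Q_, sum_other_phases.
  rewrite !contact_strain, contact_q, sum_phases_zero.
  - unfold lift. rewrite Hheat by auto. ring.
  - intros j Hj. destruct (Nat.eqb j k); auto.
    change (T_ M F j t Y) with (temp M j (rh j) q).
    change (T_ M F k t Y) with (temp M k (rh k) q).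
    rewrite !HTk by auto. ring.
Qed.

Lemma contact_F (k : nat) (t : R) (Y : point) : (1 <= k <= N)%nat ->
  F_ N M (fun k => lift (heat k)) F k t Y = 0.
Proof.
  intros Hk. unfold F_, sum_other_phases.
  rewrite contact_div_u, sum_phases_zero; [ring|].
  intros j Hj. destruct (Nat.eqb j k); auto.
  rewrite !contact_G by auto. unfold Rdiv. ring.
Qed.

(** Every density and flux of the contact is a function f of the fractions alone, and these are
    locally constant off the front. One statement for arbitrary f thus covers all time derivatives
    in the model. *)
Lemma contact_locally_t (f : (nat -> R) -> R) (t x : R) :
  x <> u * t ->
  Derive (fun s => f (fun k => pl_alpha V k s x)) t = 0.
Proof.
  intros Hx.
  assert (Hc : continuous (fun s => u * s) t).
  { apply (ex_derive_continuous (K := R_AbsRing) (V := R_NormedModule)).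
    auto_derive; auto. }
  rewrite (Derive_ext_loc _ (fun _ => f (fun k => pl_alpha V k t x)));
    [apply Derive_const|].
  simpl. destruct (Rlt_dec x (u * t)) as [H|H].
  - refine (filter_imp _ _ _ (locally_between (fun _ => x) _ t
      (continuous_const x t) Hc H)).
    intros s Hs. now destruct (Rlt_dec x (u * s)).
  - assert (H' : u * t < x) by lra.
    refine (filter_imp _ _ _ (locally_between _ (fun _ => x) t
      Hc (continuous_const x t) H')).
    intros s Hs. destruct (Rlt_dec x (u * s)); [lra | auto].
Qed.

Lemma contact_locally_x (f : (nat -> R) -> R) (t x : R) :
  x <> u * t ->
  Derive (fun z => f (fun k => pl_alpha V k t z)) x = 0.
Proof.
  intros Hx.
  rewrite (Derive_ext_loc _ (fun _ => f (fun k => pl_alpha V k t x)));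
    [apply Derive_const|].
  simpl. destruct (Rlt_dec x (u * t)) as [H|H].
  - refine (filter_imp _ _ _ (locally_between (fun z => z) (fun _ => u * t) x
      (continuous_id x) (continuous_const (u * t) x) H)).
    intros z Hz. now destruct (Rlt_dec z (u * t)).
  - assert (H' : u * t < x) by lra.
    refine (filter_imp _ _ _ (locally_between (fun _ => u * t) (fun z => z) x
      (continuous_const (u * t) x) (continuous_id x) H')).
    intros z Hz. destruct (Rlt_dec z (u * t)); [lra | auto].
Qed.

Section OffContact.
Variables (t : R) (X : point).
Hypothesis HX : X ax0 <> u * t.

Lemma contact_d_t (f : field) (g : (nat -> R) -> R) :
  (forall s Y, f s Y = g (fun k => pl_alpha V k s (Y ax0))) ->
  d_t f t X = 0.
Proof.
  intros H. unfold d_t.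
  rewrite (Derive_ext _ (fun s => g (fun k => pl_alpha V k s (X ax0)))) by
    (intros; apply H).
  now apply contact_locally_t.
Qed.

Lemma contact_d_x (i : axis) (f : field) (g : (nat -> R) -> R) :
  (forall s Y, f s Y = g (fun k => pl_alpha V k s (Y ax0))) ->
  d_x i f t X = 0.
Proof.
  intros H. destruct i.
  - unfold d_x.
    rewrite (Derive_ext _ (fun z => g (fun k => pl_alpha V k t z))) by
      (intros; apply H).
    now apply contact_locally_x.
  - apply d_x_const with (g (fun k => pl_alpha V k t (X ax0))).
    intros s. exact (H t (upd X ax1 s)).
  - apply d_x_const with (g (fun k => pl_alpha V k t (X ax0))).
    intros s. exact (H t (upd X ax2 s)).
Qed.

Lemma contact_divergence (f : vfield) (g : axis -> (nat -> R) -> R) :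
  (forall i s Y, f i s Y = g i (fun k => pl_alpha V k s (Y ax0))) ->
  divergence f t X = 0.
Proof.
  intros H. unfold divergence, sum_axes.
  rewrite !(contact_d_x _ _ (g _)) by (intros; apply H). ring.
Qed.

Lemma contact_model : model_at N M (fun k => lift (heat k)) F t X.
Proof.
  set (E := fun k => energy M k (rh k) q + / 2 * (u * u + 0 * 0 + 0 * 0)).
  split; [|split; [|split]].
  - intros k Hk.
    rewrite (contact_d_t _ (fun a => a k * rh k)) by reflexivity.
    rewrite (contact_divergence _ (fun i a => a k * rh k * uu i)); [ring|].
    intros i s Y. unfold mass_flux. now rewrite contact_vel.
  - intros i.
    rewrite (contact_d_t _ (fun a => sum_phases N (fun k => a k * rh k) * uu i)).
    + rewrite (contact_divergence _ (fun j a =>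
        sum_phases N (fun k => a k * rh k) * uu i * uu j - - q * kron i j));
        [ring|].
      intros j s Y. unfold momentum_flux.
      now rewrite contact_stress, !contact_vel.
    + intros s Y. unfold momentum. now rewrite contact_vel.
  - rewrite (contact_d_t _ (fun a => sum_phases N (fun k => a k * rh k * E k)))
      by reflexivity.
    rewrite (contact_divergence _ (fun i a =>
      sum_phases N (fun k => a k * rh k * E k) * uu i
      - sum_axes (fun j => - q * kron i j * uu j))).
    + rewrite sum_phases_zero; [ring|].
      intros k Hk. rewrite contact_q. unfold I_, lift. rewrite Hheat by auto.
      ring.
    + intros i s Y. unfold energy_flux, sum_axes.
      now rewrite !contact_stress, !contact_vel.
  - intros l Hl. rewrite contact_F by lia.
    rewrite (contact_d_t _ (fun a => a l)) by reflexivity.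
    unfold sum_axes.
    rewrite !(contact_d_x _ _ (fun a => a l)) by reflexivity. ring.
Qed.

End OffContact.

Lemma Derive_front (t : R) : Derive (fun s => u * s) t = u.
Proof. apply is_derive_unique. auto_derive; [auto | ring]. Qed.

Lemma contact_smooth (S : R -> R -> Prop) (a : nat -> R) :
  (forall t x, S t x -> forall k, pl_alpha V k t x = a k) ->
  smooth_on N M V S.
Proof.
  intros HS. split; [|split; [|intros k Hk; split; [|split; [|split]]]].
  - now apply cont_diff_up_to_constant with u.
  - now apply cont_diff_up_to_constant with q.
  - apply cont_diff_up_to_constant with (a k). intros t x H. now apply HS.
  - now apply cont_diff_up_to_constant with (rh k).
  - apply cont_diff_up_to_constant with 0. intros t x _.
    apply contact_tau_phase.
  - apply cont_diff_up_to_constant with 0. intros t x _. unfold on_line.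
    rewrite contact_temp_slope. ring.
Qed.

Lemma vanish_null (f : R -> R -> R) :
  (forall t x, f t x = 0) -> vanishes_at_infinity tend f.
Proof.
  intros H. apply vanish_ext_far with (fun _ _ => 0); [|apply vanish_zero].
  exists 0. intros. now rewrite H.
Qed.

(** The front moves with the fluid, so no mass crosses it and the fractions may jump freely. All
    remaining jump quantities are uniform, and every dissipative term is zero because velocity and
    temperatures are constant. *)
Lemma contact_solves :
  riemann_solution N M heat (RiemannData aL aR rh u q) tend V (fun t => u * t).
Proof.
  constructor.
  - split; [|ring]. intros t. split; [auto_derive; auto|].
    apply continuous_ext with (fun _ => u); [|apply continuous_const].
    intros s. symmetry. apply Derive_front.
  - intros t x _ Hx. split; simpl.
    + intros k Hk. rewrite HTk by auto. repeat split; auto.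
      destruct (Rlt_dec x (u * t)); [now apply HaL | now apply HaR].
    + destruct (Rlt_dec x (u * t)); [apply HaL | apply HaR].
  - destruct (pos_lower_bound N rh Hrh) as [d [Hd Hl]].
    exists (Rmin d T). split; [now apply Rmin_glb_lt|].
    intros t x k _ _ Hk. change (pl_T M V k t x) with (temp M k (rh k) q).
    rewrite HTk by auto. simpl. specialize (Hl k Hk).
    pose proof (Rmin_l d T). pose proof (Rmin_r d T). lra.
  - apply contact_smooth with aL. intros t x [_ Hx] k. simpl.
    destruct (Rlt_dec x (u * t)); [auto | lra].
  - apply contact_smooth with aR. intros t x [_ Hx] k. simpl.
    destruct (Rlt_dec x (u * t)); [lra | auto].
  - intros t X _ HX. now apply contact_model.
  - intros t _. split; [now apply no_jump_constant with u|].
    intros k Hk. split.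
    + now apply no_jump_constant with (temp M k (rh k) q).
    + apply no_jump_constant with 0. intros x. apply contact_heat_flux.
  - intros t k _ Hk. apply no_jump_constant with 0. intros x.
    rewrite mass_flux_line, Derive_front. simpl. ring.
  (* Relative to the front the convective part cancels and only the pressure is transmitted; in the
     energy condition below, likewise, only its power q * u. *)
  - intros t i _. apply no_jump_constant with (q * kron i ax0). intros x.
    unfold on_line, momentum_flux, momentum.
    fold F. rewrite contact_stress, !contact_vel, Derive_front. simpl. ring.
  - intros t _. apply no_jump_constant with (q * u). intros x.
    rewrite (sum_phases_zero N (fun k =>
      on_line (heat_flux M (embed V) k ax0) t x))
      by (intros; apply contact_heat_flux).
    unfold on_line, energy_flux, sum_axes.
    fold F. rewrite !contact_stress, !contact_vel, Derive_front. simpl.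
    unfold kron. simpl. ring.
  - intros t l _ Hl. apply no_jump_constant with 0. intros x.
    rewrite Derive_front. simpl. ring.
  - intros x Hx. simpl. split; [auto|]. split; [auto|].
    intros k Hk. rewrite Rmult_0_r. split; [auto|].
    split; intros H; destruct (Rlt_dec x 0); auto; lra.
  - split; [|split; [|split]].
    + apply vanish_null. intros; simpl; ring.
    + apply vanish_null. intros; simpl; ring.
    + apply vanish_null. intros; apply contact_tau.
    + intros k Hk. split.
      * apply vanish_null. intros. unfold pl_T. simpl. ring.
      * apply vanish_null. intros; apply contact_heat_flux.
Qed.

End Contact.

Theorem proposition2 (N : nat) (M : material) (heat : nat -> R -> R -> R)
  (aL aR rh e : nat -> R) (u p T tend : R)
  (hN : (1 <= N)%nat)
  (hM : physical_material N M)
  (hheat : forall k t x, (1 <= k <= N)%nat -> 0 <= heat k t x)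
  (hu : 0 < u)
  (hT : 0 < T)
  (hrho : forall k, (1 <= k <= N)%nat -> 0 < rh k)
  (heos_p : forall k, (1 <= k <= N)%nat ->
     rh k * e k = (p + gam M k * pinf M k) / (gam M k - 1) + rh k * w M k)
  (heos_T : forall k, (1 <= k <= N)%nat ->
     rh k * e k = rh k * Cv M k * T + pinf M k + rh k * w M k)
  (haL : (forall k, (1 <= k <= N)%nat -> 0 <= aL k) /\ sum_phases N aL = 1)
  (haR : (forall k, (1 <= k <= N)%nat -> 0 <= aR k) /\ sum_phases N aR = 1)
  (hjump : forall l, (2 <= l <= N)%nat -> aL l <> aR l)
  (htend : 0 < tend) :
  ((forall k t x, (1 <= k <= N)%nat -> heat k t x = 0) ->
     exists V xi,
       riemann_solution N M heat (RiemannData aL aR rh u p) tend V xi)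
  /\ (forall V xi,
        riemann_solution N M heat (RiemannData aL aR rh u p) tend V xi ->
        releases_no_heat N heat tend V xi ->
        preserves_PVT N M u p T tend V xi).
Proof.
  (* Equating the two forms of the equation of state eliminates the energy; the resulting pressure
     law makes T the rest temperature of every phase. *)
  assert (Hp : forall k, (1 <= k <= N)%nat ->
    p + pinf M k = (gam M k - 1) * (rh k * Cv M k * T)).
  { intros k Hk. destruct (proj1 hM k Hk) as [Hg HC].
    pose proof (heos_p k Hk) as H1. rewrite heos_T in H1 by auto.
    replace (rh k * Cv M k * T) with
      ((p + gam M k * pinf M k) / (gam M k - 1) - pinf M k) by lra.
    field. lra. }
  assert (HTk : forall k, (1 <= k <= N)%nat -> temp M k (rh k) p = T).
  { intros k Hk. destruct (proj1 hM k Hk) as [Hg HC].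
    assert (Hr := hrho k Hk).
    rewrite temp_eq, Hp by auto. field. repeat split; lra. }
  assert (Hp0 : forall k, (1 <= k <= N)%nat -> 0 < p + pinf M k).
  { intros k Hk. destruct (proj1 hM k Hk) as [Hg HC].
    assert (Hr := hrho k Hk).
    rewrite Hp by auto. repeat apply Rmult_lt_0_compat; lra. }
  split.
  - intros H0. exists (contact aL aR rh u p), (fun t => u * t).
    now apply contact_solves with T.
  - intros V xi Hsol Hheat.
    destruct (rs_no_vacuum _ _ _ _ _ _ _ Hsol) as (delta & Hdelta & Hvac).
    (* Since p + pinf = (gam - 1) Cv rho T, lower bounds delta on density and temperature bound p +
       pinf from below by (gam - 1) Cv delta^2; d1 is a common such bound for all phases. *)
    destruct (pos_lower_bound N
      (fun k => (gam M k - 1) * Cv M k * (delta * delta))) as [d1 [Hd1 Hl]].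
    { intros k Hk. destruct (proj1 hM k Hk).
      repeat apply Rmult_lt_0_compat; lra. }
    apply (solution_at_rest N M heat (RiemannData aL aR rh u p) tend V xi T
             (Rmin delta d1)); auto.
    + now apply Rmin_glb_lt.
    + intros t x k Ht Hx Hk. destruct (Hvac t x k Ht Hx Hk) as [Vr VT].
      destruct (proj1 hM k Hk) as [Hg HC]. specialize (Hl k Hk).
      pose proof (Rmin_l delta d1). pose proof (Rmin_r delta d1).
      split; [lra|].
      replace (pl_p V t x + pinf M k) with
        ((gam M k - 1) * Cv M k * (pl_rho V k t x * pl_T M V k t x)).
      * assert ((gam M k - 1) * Cv M k * (delta * delta)
          <= (gam M k - 1) * Cv M k * (pl_rho V k t x * pl_T M V k t x)).
        { apply Rmult_le_compat_l; [apply Rmult_le_pos; lra|].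
          apply Rmult_le_compat; lra. }
        lra.
      * unfold pl_T. rewrite temp_eq by (auto; lra).
        field. repeat split; lra.
Qed.
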